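(* Let $G$ be a locally compact group and $T\in\mathrm{Aut}(G)$. The following hold: (1) If $G=\mathbb{Q}_{p_1}^{m_1}\times\cdots\times \mathbb{Q}_{p_n}^{m_n}$ for distinct primes $p_1,\ldots, p_n$ and $m_1,\ldots, m_n\in\mathbb{N}$ (positive integers), and if $T$ is expansive, then $T(\mathbb{Q}_{p_i}^{m_i})=\mathbb{Q}_{p_i}^{m_i}$ for each $i$ and $G=C(T)\times C(T^{-1})$. Moreover, if the $T$-action on $\mathrm{Sub}_G$ is expansive, then $m_1=\cdots =m_n=1$. (2) If $G=\mathbb{Q}_{p_1}\times\cdots\times \mathbb{Q}_{p_n}$ for distinct primes $p_1,\ldots, p_n$, then $T$ is expansive if and only if the $T$-action on $\mathrm{Sub}_G$ is expansive.
   Context: $\mathbb{Q}_p$ is the field of $p$-adic numbers with its usual topology, viewed as a topological group under addition; the factors $\mathbb{Q}_{p_i}^{m_i}$ are regarded as subgroups of the product $G$ in the canonical way, and $G=C(T)\times C(T^{-1})$ means that $G$ is the internal direct product of these subgroups. $\mathrm{Aut}(G)$ is the group of (bicontinuous) automorphisms of $G$. $\mathrm{Sub}_G$ is the set of all closed subgroups of $G$ with the Chabauty topology: a sub-basis is given by the sets $\{A\in\mathrm{Sub}_G\mid A\cap K=\emptyset\}$ for $K\subset G$ compact and $\{A\in\mathrm{Sub}_G\mid A\cap U\neq\emptyset\}$ for $U\subset G$ open. It is a compact Hausdorff space. Each $T\in\mathrm{Aut}(G)$ acts by the homeomorphism $H\mapsto T(H)$ of $\mathrm{Sub}_G$. A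 homeomorphism $\varphi$ of a compact space $X$ is expansive if, for a metric $d$ inducing the topology of $X$, there is $\delta>0$ such that for all $x\neq y$ in $X$ there is $k\in\mathbb{Z}$ with $d(\varphi^k(x),\varphi^k(y))>\delta$ (this does not depend on the choice of compatible metric). The $T$-action on $\mathrm{Sub}_G$ is expansive if the homeomorphism $H\mapsto T(H)$ is expansive. An automorphism $T$ of $G$, with identity $e$, is expansive if $\bigcap_{k\in\mathbb{Z}}T^k(U)=\{e\}$ for some neighbourhood $U$ of $e$. The contraction group of $T$ is $C(T)=\{x\in G\mid T^k(x)\to e\text{ as }k\to\infty\}$. *)

(* Defs.v *)
From HB Require Import structures.
From mathcomp Require Import all_boot all_order all_algebra.
From mathcomp Require Import ring_quotient finmap.
From mathcomp Require Import all_classical all_reals topology tvs.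
From mathcomp Require Import zify ring lra.

Set Implicit Arguments.
Unset Strict Implicit.
Unset Printing Implicit Defensive.

Import Order.TTheory GRing.Theory Num.Theory.
Local Open Scope classical_set_scope.
Local Open Scope ring_scope.

(* [p ^ (- v_p x)], where [v_p (a / b) = logn p a - logn p b]. *)
Definition rat_pnorm (p : nat) (x : rat) : rat :=
  if x == 0 then 0
  else p%:R ^+ logn p `|denq x|%N / p%:R ^+ logn p `|numq x|%N.

Section RatPnorm.
Variables (p : nat) (p_pr : prime p).
Local Notation N := (rat_pnorm p).

Let p_gt0 : 0 < p%:R :> rat.
Proof. by rewrite ltr0n prime_gt0. Qed.

Let pX_gt0 k : 0 < p%:R ^+ k :> rat.
Proof. by rewrite exprn_gt0. Qed.

Lemma rat_pnorm0 : N 0 = 0.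
Proof. by rewrite /rat_pnorm eqxx. Qed.

Lemma rat_pnorm_gt0 x : (0 < N x) = (x != 0).
Proof. by rewrite /rat_pnorm; case: eqP => //= _; rewrite divr_gt0. Qed.

Lemma rat_pnorm_ge0 x : 0 <= N x.
Proof. by rewrite /rat_pnorm; case: eqP => //= _; rewrite divr_ge0 ?ltW. Qed.

Lemma rat_pnorm_eq0 x : (N x == 0) = (x == 0).
Proof. by have := rat_pnorm_gt0 x; rewrite lt0r rat_pnorm_ge0 andbT => /negb_inj. Qed.

Lemma rat_pnorm_frac (a b : int) : a != 0 -> b != 0 ->
  N (a%:~R / b%:~R) = p%:R ^+ logn p `|b|%N / p%:R ^+ logn p `|a|%N.
Proof.
move=> a0 b0; set x := a%:~R / b%:~R.
have x0 : x != 0 by rewrite mulf_neq0 ?invr_eq0 ?intr_eq0.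
have n0 : numq x != 0 by rewrite numq_eq0.
have d0 : denq x != 0 by rewrite denq_neq0.
rewrite /rat_pnorm (negbTE x0).
have /(congr1 absz) E : (a * denq x = numq x * b)%R.
  apply/eqP; rewrite -(eqr_int rat) !intrM.
  have : x = (numq x)%:~R / (denq x)%:~R by rewrite divq_num_den.
  rewrite {1}/x => /eqP; rewrite eqr_div ?intr_eq0 //.
have /(congr1 (logn p)) := E.
rewrite !abszM !lognM ?absz_gt0 // => {}E.
apply/eqP; rewrite eqr_div ?(gt_eqF (pX_gt0 _)) // -!exprD; apply/eqP.
by congr (_ ^+ _); lia.
Qed.

Lemma rat_pnorm1 : N 1 = 1.
Proof. by rewrite /rat_pnorm oner_eq0 /= !logn1 divff ?gt_eqF. Qed.

Lemma rat_pnormM : {morph N : x y / x * y}.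
Proof.
move=> x y; have [->|x0] := eqVneq x 0; first by rewrite mul0r rat_pnorm0 mul0r.
have [->|y0] := eqVneq y 0; first by rewrite mulr0 rat_pnorm0 mulr0.
rewrite -[in LHS](divq_num_den x) -[in LHS](divq_num_den y) mulf_div -!intrM.
rewrite rat_pnorm_frac ?mulf_neq0 ?numq_eq0 ?denq_neq0 //.
rewrite /rat_pnorm (negbTE x0) (negbTE y0) mulf_div -!exprD.
by rewrite !abszM !lognM ?absz_gt0 ?numq_eq0 ?denq_neq0.
Qed.

Lemma rat_pnormN x : N (- x) = N x.
Proof.
by rewrite /rat_pnorm oppr_eq0 numqN denqN abszN.
Qed.

Let rat_pnorm_int z : N z%:~R <= 1.
Proof.
have [->|z0] := eqVneq z 0; first by rewrite rat_pnorm0.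
rewrite -[z%:~R]divr1 (_ : 1 = 1%:~R) // rat_pnorm_frac //= logn1 expr0.
by rewrite ler_pdivrMr // mul1r exprn_ege1 // ler1n prime_gt0.
Qed.

Let rat_pnorm_den x : N x <= 1 -> N (denq x)%:~R = 1.
Proof.
have [->|x0] := eqVneq x 0; first by move=> _; exact: rat_pnorm1.
rewrite {1}/rat_pnorm (negbTE x0) ler_pdivrMr // mul1r => le1.
rewrite -[(denq x)%:~R]divr1 (_ : 1 = 1%:~R) // rat_pnorm_frac ?denq_neq0 //=.
suff -> : logn p `|denq x| = 0%N by rewrite logn1 divr1.
have [pd|pd] := boolP (p %| `|denq x|)%N; last first.
  by rewrite lognE (negbTE pd) !andbF.
have pn : ~~ (p %| `|numq x|)%N.
  apply/negP => pn; have := coprime_num_den x; rewrite /coprime => /eqP g1.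
  by have := prime_gt1 p_pr; rewrite ltnNge dvdn_leq // -g1 dvdn_gcd pn.
move: le1; rewrite [logn p `|numq x|]lognE (negbTE pn) !andbF.
by rewrite ler_eXn2l ?ltr1n ?prime_gt1 // leqn0 => /eqP.
Qed.

Lemma rat_pnorm_ultra x y : N (x + y) <= Num.max (N x) (N y).
Proof.
wlog le_yx : x y / N y <= N x => [th|].
  by case/orP: (le_total (N y) (N x)) => /th //; rewrite addrC maxC.
rewrite (max_idPl le_yx); have [x0|x0] := eqVneq x 0.
  by move: le_yx; rewrite x0 add0r.
pose z := y / x.
have -> : x + y = x * (1 + z) by rewrite mulrDr mulr1 mulrCA divff ?mulr1.
have Nx : 0 < N x by rewrite rat_pnorm_gt0.
rewrite rat_pnormM ger_pMr //.
have Nz : N z <= 1 by rewrite -(ler_pM2l Nx) -rat_pnormM mulr1 mulrCA divff ?mulr1.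
have Dz := rat_pnorm_den Nz.
have -> : N (1 + z) = N ((1 + z) * (denq z)%:~R) by rewrite rat_pnormM Dz mulr1.
rewrite mulrDl mul1r.
have -> : z * (denq z)%:~R = (numq z)%:~R.
  by rewrite -{1}[z]divq_num_den divfK ?intr_eq0 ?denq_neq0.
by rewrite -intrD rat_pnorm_int.
Qed.

Lemma rat_pnorm_sum x y e : N x < e -> N y < e -> N (x + y) < e.
Proof. by move=> xe ye; rewrite (le_lt_trans (rat_pnorm_ultra x y)) // gt_max xe. Qed.

End RatPnorm.

(* The unused argument [p_pr] keys the ring structures inferred from [pcauchy]
   and, later, [padic]: they only exist for a prime [p]. *)
Definition pcauchy (p : nat) (p_pr : prime p) : {pred nat -> rat} := fun u =>
  `[< forall e : rat, 0 < e -> exists M, forall m n,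
      (M <= m)%N -> (M <= n)%N -> rat_pnorm p (u m - u n) < e >].

Definition pnull (p : nat) : {pred nat -> rat} := fun u =>
  `[< forall e : rat, 0 < e -> exists M, forall n,
      (M <= n)%N -> rat_pnorm p (u n) < e >].

Section Cauchy.
Variables (p : nat) (p_pr : prime p).
Local Notation N := (rat_pnorm p).

Lemma pcauchyP u : reflect (forall e : rat, 0 < e -> exists M, forall m n,
  (M <= m)%N -> (M <= n)%N -> N (u m - u n) < e) (u \in pcauchy p_pr).
Proof. exact: asboolP. Qed.

Lemma pnullP u : reflect (forall e : rat, 0 < e -> exists M, forall n,
  (M <= n)%N -> N (u n) < e) (u \in pnull p).
Proof. exact: asboolP. Qed.

Lemma pcauchy_bounded u : u \in pcauchy p_pr ->
  exists2 B : rat, 0 < B & forall n, N (u n) < B.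
Proof.
move=> /pcauchyP /(_ 1 ltr01) [M uM].
pose B : rat := 1 + N (u M) + \sum_(i < M) N (u i).
have S0 : 0 <= \sum_(i < M) N (u i) by apply: sumr_ge0 => i _; exact: rat_pnorm_ge0.
have NM : 0 <= N (u M) by exact: rat_pnorm_ge0.
exists B => [|n]; first by rewrite /B; lra.
have [nM|Mn] := ltnP n M.
  rewrite /B (bigD1 (Ordinal nM)) //=.
  have : 0 <= \sum_(i < M | i != Ordinal nM) N (u i).
    by apply: sumr_ge0 => i _; exact: rat_pnorm_ge0.
  lra.
rewrite -[u n](subrK (u M)); apply: rat_pnorm_sum => //; last by rewrite /B; lra.
by apply: lt_le_trans (uM n M Mn (leqnn M)) _; rewrite /B; lra.
Qed.

Lemma pcauchy_subring_closed : subring_closed (pcauchy p_pr).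
Proof.
split.
- by apply/pcauchyP => e e0; exists 0%N => m n _ _; rewrite subrr rat_pnorm0.
- move=> u v /pcauchyP uC /pcauchyP vC; apply/pcauchyP => e e0.
  have [M uM] := uC e e0; have [M' vM] := vC e e0.
  exists (maxn M M') => m n; rewrite !geq_max => /andP[m1 m2] /andP[n1 n2].
  have -> : (u - v) m - (u - v) n = (u m - u n) - (v m - v n).
    by change (u m - v m - (u n - v n) = u m - u n - (v m - v n)); ring.
  by apply: rat_pnorm_sum; rewrite ?rat_pnormN //; [exact: uM|exact: vM].
- move=> u v uC vC; apply/pcauchyP => e e0.
  have [B B0 uB] := pcauchy_bounded uC; have [C C0 vB] := pcauchy_bounded vC.
  have [M uM] := pcauchyP _ uC (e / C) (divr_gt0 e0 C0).
  have [M' vM] := pcauchyP _ vC (e / B) (divr_gt0 e0 B0).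
  exists (maxn M M') => m n; rewrite !geq_max => /andP[m1 m2] /andP[n1 n2].
  have -> : (u * v) m - (u * v) n = (u m - u n) * v m + u n * (v m - v n).
    change (u m * v m - u n * v n = (u m - u n) * v m + u n * (v m - v n)).
    by ring.
  apply: rat_pnorm_sum => //; rewrite rat_pnormM //.
  + apply: le_lt_trans (_ : N (u m - u n) * C < e).
      by rewrite ler_wpM2l ?rat_pnorm_ge0 // ltW.
    by rewrite -ltr_pdivlMr // uM.
  + apply: le_lt_trans (_ : B * N (v m - v n) < e).
      by rewrite ler_wpM2r ?rat_pnorm_ge0 // ltW.
    by rewrite mulrC -ltr_pdivlMr // vM.
Qed.

Lemma pcauchy_not_null u : u \in pcauchy p_pr -> u \notin pnull p ->
  exists2 c, 0 < c & exists M, forall n, (M <= n)%N -> N (u n) = c.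
Proof.
move=> /pcauchyP uC /pnullP /existsNP[e /not_implyP[e0 /forallNP uN]].
have [M uM] := uC e e0.
have [k /not_implyP[Mk /negP]] := (existsNP _).2 (uN M); rewrite -leNgt => ek.
exists (N (u k)); first exact: lt_le_trans ek.
exists k => n kn.
have d : N (u n - u k) < N (u k).
  by apply: lt_le_trans ek; apply: uM => //; exact: leq_trans kn.
have nE : u n = (u n - u k) + u k by rewrite subrK.
have kE : u k = - (u n - u k) + u n by rewrite opprB subrK.
apply/eqP; rewrite eq_le; apply/andP; split.
  by have := rat_pnorm_ultra p_pr (u n - u k) (u k); rewrite subrK (max_idPr (ltW d)).
rewrite leNgt; apply/negP => lt.
have := rat_pnorm_sum p_pr (_ : N (- (u n - u k)) < N (u k)) lt.
by rewrite -kE ltxx rat_pnormN => /(_ d).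
Qed.

End Cauchy.

HB.instance Definition _ (p : nat) (p_pr : prime p) :=
  GRing.isSubringClosed.Build (nat -> rat) (pcauchy p_pr)
    (pcauchy_subring_closed p_pr).

Record pcauchy_seq (p : nat) (p_pr : prime p) := PCauchySeq {
  pcauchy_val :> nat -> rat;
  _ : pcauchy_val \in pcauchy p_pr
}.

HB.instance Definition _ (p : nat) (p_pr : prime p) :=
  [isSub for @pcauchy_val p p_pr].
HB.instance Definition _ (p : nat) (p_pr : prime p) :=
  [Choice of pcauchy_seq p_pr by <:].
HB.instance Definition _ (p : nat) (p_pr : prime p) :=
  [SubChoice_isSubComNzRing of pcauchy_seq p_pr by <:].

Definition pnull_ideal (p : nat) (p_pr : prime p) : {pred pcauchy_seq p_pr} :=
  fun u => (u : nat -> rat) \in pnull p.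
Arguments pnull_ideal {p} p_pr u.

Section Padic.
Variables (p : nat) (p_pr : prime p).
Local Notation N := (rat_pnorm p).
Implicit Types u v : pcauchy_seq p_pr.

Lemma pnull_idealr_closed : idealr_closed (pnull_ideal p_pr).
Proof.
split.
- by apply/pnullP => e e0; exists 0%N => n _; rewrite rat_pnorm0.
- apply/negP => /pnullP /(_ 1 ltr01)[M /(_ M (leqnn M))].
  by rewrite rat_pnorm1 // ltxx.
- move=> a u v /pnullP uN /pnullP vN; apply/pnullP => e e0.
  have [B B0 aB] := pcauchy_bounded (valP a).
  have [M uM] := uN (e / B) (divr_gt0 e0 B0); have [M' vM] := vN e e0.
  exists (maxn M M') => n; rewrite geq_max => /andP[n1 n2].
  apply: (rat_pnorm_sum p_pr (x := val a n * val u n)); last exact: vM.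
  rewrite rat_pnormM //.
  apply: le_lt_trans (_ : B * N (val u n) < e).
    by rewrite ler_wpM2r ?rat_pnorm_ge0 // ltW.
  by rewrite mulrC -ltr_pdivlMr // uM.
Qed.

End Padic.

HB.instance Definition _ (p : nat) (p_pr : prime p) :=
  isIdealr.Build (pcauchy_seq p_pr) (pnull_ideal p_pr)
    (pnull_idealr_closed p_pr).

(* The completion of the rationals for the p-adic absolute value: Cauchy
   sequences modulo null sequences. *)
Definition padic (p : nat) (p_pr : prime p) : Type := {ideal_quot (pnull_ideal p_pr)}.

HB.instance Definition _ (p : nat) (p_pr : prime p) :=
  GRing.ComNzRing.on (padic p_pr).
HB.instance Definition _ (p : nat) (p_pr : prime p) :=
  Quotient.on (padic p_pr).

Section PadicField.
Variables (p : nat) (p_pr : prime p).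
Local Notation N := (rat_pnorm p).
Local Notation K := (padic p_pr).
Implicit Types u v : pcauchy_seq p_pr.
Local Open Scope quotient_scope.

Lemma padic_eqP u v :
  reflect (forall e : rat, 0 < e -> exists M, forall n, (M <= n)%N ->
            N (u n - v n) < e)
          (\pi_K u == \pi_K v).
Proof. by rewrite piE /= /Quotient.equiv; exact: pnullP. Qed.

Lemma padic_inv_ex (x : K) : x != 0 -> exists y : K, y * x = 1.
Proof.
elim/quotP: x => u _ x0.
have uN : val u \notin pnull p.
  apply: contra x0 => /pnullP uN; rewrite -[0](rmorph0 \pi_K).
  by apply/padic_eqP => e /uN [M h]; exists M => n /h; rewrite subr0.
have [c c0 [M uM]] := pcauchy_not_null (valP u) uN.
have u0 n : (M <= n)%N -> val u n != 0.
  by move=> /uM un; rewrite -(rat_pnorm_gt0 p_pr) un.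
pose v n := (val u n)^-1.
have vC : v \in pcauchy p_pr.
  apply/pcauchyP => e e0; have cc : 0 < c * c by rewrite mulr_gt0.
  have [M' uM'] := pcauchyP _ _ (valP u) (e * (c * c)) (mulr_gt0 e0 cc).
  exists (maxn M M') => m n; rewrite !geq_max => /andP[m1 m2] /andP[n1 n2].
  have invB (a b : rat) : a != 0 -> b != 0 ->
      (a^-1 - b^-1) * (a * b) = b - a.
    by move=> a0 b0; rewrite mulrBl mulKf // [b^-1 * _]mulrCA mulVf ?mulr1.
  have E : N (v m - v n) * (c * c) = N (val u n - val u m).
    by rewrite -{1}(uM m m1) -(uM n n1) -!rat_pnormM // invB // u0.
  by rewrite -(ltr_pM2r cc) E uM'.
exists (\pi_K (PCauchySeq vC)); rewrite -rmorphM -[1](rmorph1 \pi_K).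
apply/eqP/padic_eqP => e e0; exists M => n /u0 un.
change (N ((val u n)^-1 * val u n - 1) < e).
by rewrite mulVf // subrr rat_pnorm0.
Qed.

Definition padic_inv (x : K) : K := xget 0 [set y | y * x = 1].

Lemma padic_mulVf (x : K) : x != 0 -> padic_inv x * x = 1.
Proof. by move=> /padic_inv_ex xy; exact: (xgetPex 0 xy). Qed.

Lemma padic_inv0 : padic_inv 0 = 0.
Proof.
by apply: xgetPN => y /= /eqP; rewrite mulr0 eq_sym oner_eq0.
Qed.

End PadicField.

HB.instance Definition _ (p : nat) (p_pr : prime p) :=
  GRing.ComNzRing_isField.Build (padic p_pr)
    (@padic_mulVf p p_pr) (@padic_inv0 p p_pr).

(* The limit of the p-adic absolute values along a representative; it exists in
   the rationals because these values are eventually constant or tend to 0. *)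
Definition padic_norm (p : nat) (p_pr : prime p) (x : padic p_pr) : rat :=
  xget 0 [set c : rat | forall e : rat, 0 < e -> exists M, forall n,
    (M <= n)%N -> `|rat_pnorm p (repr x n) - c| < e].

Section PadicNorm.
Variables (p : nat) (p_pr : prime p).
Local Notation N := (rat_pnorm p).
Local Notation K := (padic p_pr).
Implicit Types (u v : pcauchy_seq p_pr) (x y : K).
Local Open Scope quotient_scope.

Let limN u (c : rat) := forall e : rat, 0 < e -> exists M, forall n,
  (M <= n)%N -> `|N (u n) - c| < e.

Let limN_ex u : exists c, limN u c.
Proof.
have [/pnullP uN|uN] := boolP (val u \in pnull p).
  exists 0 => e /uN[M h]; exists M => n /h.
  by rewrite subr0 ger0_norm // rat_pnorm_ge0.
have [c c0 [M h]] := pcauchy_not_null (valP u) uN.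
by exists c => e e0; exists M => n /h ->; rewrite subrr normr0.
Qed.

Let limN_uniq u c d : limN u c -> limN u d -> c = d.
Proof.
move=> uc ud; apply/eqP; rewrite -subr_eq0 -normr_eq0 eq_le normr_ge0 andbT.
rewrite leNgt; apply/negP => cd; have e0 : 0 < `|c - d| / 2 by lra.
have [M h] := uc _ e0; have [M' h'] := ud _ e0.
have := h (maxn M M') (leq_maxl _ _); have := h' (maxn M M') (leq_maxr _ _).
move: (N _) => a h1 h2.
have := ler_normB (a - d) (a - c); rewrite (_ : a - d - (a - c) = c - d); last by ring.
by lra.
Qed.

Let dist_pnorm a b : `|N a - N b| <= N (a - b).
Proof.
have tri (r s : rat) : N r <= N (r - s) + N s.
  have := rat_pnorm_ultra p_pr (r - s) s; rewrite subrK => /le_trans; apply.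
  by rewrite ge_max lerDl lerDr !rat_pnorm_ge0.
have := tri a b; have := tri b a.
by rewrite -[b - a]opprB rat_pnormN ler_norml; lra.
Qed.

Lemma padic_norm_lim u (e : rat) : 0 < e -> exists M, forall n,
  (M <= n)%N -> `|N (u n) - padic_norm (\pi_K u)| < e.
Proof.
move: e; rewrite -/(limN u _); set x := \pi_K u.
have xP : limN (repr x) (padic_norm x).
  exact: (xgetPex 0 (limN_ex (repr x))).
have /eqP/padic_eqP xu : \pi_K (repr x) = \pi_K u by rewrite reprK.
move=> e e0; have e2 : 0 < e / 2 by lra.
have [M h] := xP _ e2; have [M' h'] := xu _ e2.
exists (maxn M M') => n; rewrite geq_max => /andP[/h h1 /h' h2].
rewrite (_ : _ - _ = N (u n) - N (repr x n) + (N (repr x n) - padic_norm x)).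
  apply: le_lt_trans (ler_normD _ _) _; have := dist_pnorm (repr x n) (u n).
  by rewrite (distrC (N (u n))); lra.
by ring.
Qed.

Let normP u c : limN u c -> padic_norm (\pi_K u) = c.
Proof. by move=> h; apply: limN_uniq h; exact: padic_norm_lim. Qed.

Lemma padic_norm_ge0 x : 0 <= padic_norm x.
Proof.
elim/quotP: x => u _; rewrite leNgt; apply/negP => lt0.
have [M /(_ M (leqnn M))] := padic_norm_lim u (e := - padic_norm (\pi_K u)) ltac:(lra).
by have := rat_pnorm_ge0 p_pr (u M); rewrite ltr_norml; lra.
Qed.

Lemma padic_norm0 : padic_norm (0 : K) = 0.
Proof.
rewrite -[0 : K](rmorph0 \pi_K); apply: normP => e e0; exists 0%N => n _.
by rewrite rat_pnorm0 subrr normr0.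
Qed.

Lemma padic_norm_eq0 x : (padic_norm x == 0) = (x == 0).
Proof.
apply/eqP/eqP => [|->]; last exact: padic_norm0.
elim/quotP: x => u _ u0; apply/eqP; rewrite -[0 : K](rmorph0 \pi_K).
apply/padic_eqP => e /(padic_norm_lim u); rewrite u0 => -[M h].
exists M => n /h; rewrite !subr0 ger0_norm //; exact: rat_pnorm_ge0.
Qed.

Lemma padic_norm_ultra x y :
  padic_norm (x + y) <= Num.max (padic_norm x) (padic_norm y).
Proof.
elim/quotP: x => u _; elim/quotP: y => v _; rewrite -rmorphD leNgt.
set a := padic_norm _; set b := padic_norm _; set c := padic_norm _.
rewrite gt_max; apply/negP => /andP[ac bc].
pose e := Num.min ((c - a) / 2) ((c - b) / 2).
have e0 : 0 < e by rewrite lt_min; apply/andP; split; lra.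
have [M1 h1] := padic_norm_lim u e0; have [M2 h2] := padic_norm_lim v e0.
have [M3 h3] := padic_norm_lim (u + v) e0.
pose n := maxn M1 (maxn M2 M3).
have := h1 n (leq_maxl _ _).
have := h2 n (leq_trans (leq_maxl _ _) (leq_maxr _ _)).
have := h3 n (leq_trans (leq_maxr _ _) (leq_maxr _ _)).
rewrite -/a -/b -/c !ltr_norml.
have := rat_pnorm_ultra p_pr (u n) (v n).
have : e <= (c - a) / 2 by rewrite ge_min lexx.
have : e <= (c - b) / 2 by rewrite ge_min lexx orbT.
change ((u + v : pcauchy_seq p_pr) n) with (u n + v n).
rewrite le_max; move: (N _) (N _) (N _) => r s t ? ? /orP[]; lra.
Qed.

Lemma padic_normM : {morph @padic_norm p p_pr : x y / x * y}.
Proof.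
move=> x y; have [->|x0] := eqVneq x 0.
  by rewrite mul0r padic_norm0 mul0r.
have [->|y0] := eqVneq y 0; first by rewrite mulr0 padic_norm0 mulr0.
have H u : \pi_K u != 0 -> exists M, forall n, (M <= n)%N ->
    N (u n) = padic_norm (\pi_K u).
  move=> u0; have uN : val u \notin pnull p.
    apply: contra u0 => /pnullP uN; rewrite -[0](rmorph0 \pi_K).
    by apply/padic_eqP => e /uN [M h]; exists M => n /h; rewrite subr0.
  have [c c0 [M h]] := pcauchy_not_null (valP u) uN.
  exists M => n /[dup] Mn /h ->; apply/esym/normP => e e0.
  by exists M => k /h ->; rewrite subrr normr0.
elim/quotP: x x0 => u _ /H [M h]; elim/quotP: y y0 => v _ /H [M' h'].
rewrite -rmorphM; apply: normP => e e0; exists (maxn M M') => n.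
rewrite geq_max => /andP[/h <- /h' <-].
change ((u * v : pcauchy_seq p_pr) n) with (u n * v n).
by rewrite rat_pnormM // subrr normr0.
Qed.

Lemma padic_normN x : padic_norm (- x) = padic_norm x.
Proof.
elim/quotP: x => u _; rewrite -rmorphN; apply: normP => e /(padic_norm_lim u).
move=> [M h]; exists M => n /h.
by change ((- u : pcauchy_seq p_pr) n) with (- u n); rewrite rat_pnormN.
Qed.

Definition padic_dist x y := padic_norm (x - y).

Let distxx x : padic_dist x x = 0.
Proof. by rewrite /padic_dist subrr padic_norm0. Qed.

Let dist_eq0 x y : padic_dist x y = 0 -> x = y.
Proof. by move=> /eqP; rewrite padic_norm_eq0 subr_eq0 => /eqP. Qed.

Let distC x y : padic_dist x y = padic_dist y x.
Proof. by rewrite /padic_dist -padic_normN opprB. Qed.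

Let dist_tri y x z : padic_dist x z <= padic_dist x y + padic_dist y z.
Proof.
have := padic_norm_ultra (x - y) (y - z); rewrite addrA subrK => /le_trans; apply.
by rewrite ge_max lerDl lerDr !padic_norm_ge0.
Qed.

HB.instance Definition _ := @isMetric.Build rat K _ distxx dist_eq0 distC dist_tri.

Lemma padic_nbhsP x (A : set K) :
  nbhs x A <-> exists2 e : rat, 0 < e & forall y, padic_norm (x - y) < e -> A y.
Proof. by rewrite -metricType_numDomainType.filter_from_mdist_nbhs. Qed.

Let padic_sub_continuous : continuous (fun z : K * K => z.1 - z.2).
Proof.
move=> [x y] A /= /padic_nbhsP[e e0 eA].
exists ([set z | padic_norm (x - z) < e], [set z | padic_norm (y - z) < e]).
  by split; apply/padic_nbhsP; exists e.
move=> [a b] /= [xa yb]; apply: eA.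
have -> : x - y - (a - b) = (x - a) + - (y - b) by ring.
by apply: le_lt_trans (padic_norm_ultra _ _) _; rewrite gt_max padic_normN xa.
Qed.

HB.instance Definition _ :=
  PreTopologicalNmodule_isTopologicalZmodule.Build K padic_sub_continuous.

End PadicNorm.

Definition padic_space (p : nat) (p_pr : prime p) (m : nat) : Type :=
  'rV[padic p_pr]_m.

Section PadicSpace.
Variables (p : nat) (p_pr : prime p) (m : nat).
Local Notation V := (padic_space p_pr m).

HB.instance Definition _ := Uniform.copy V 'rV[padic p_pr]_m.
HB.instance Definition _ := GRing.Lmodule.copy V 'rV[padic p_pr]_m.

Let padic_space_sub_continuous : continuous (fun z : V * V => z.1 - z.2).
Proof.
move=> [x y] A /= [P nP PA].
have : forall ij, exists U : set (padic p_pr) * set (padic p_pr),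
    [/\ nbhs (x ij.1 ij.2) U.1, nbhs (y ij.1 ij.2) U.2 &
        forall a b, U.1 a -> U.2 b -> P ij.1 ij.2 (a - b)].
  move=> [i j] /=; have := nP i j; rewrite !mxE => /(@sub_continuous _ (x i j, y i j)).
  move=> [[U1 U2] [/= n1 n2] UP]; exists (U1, U2); split => // a b Ua Ub.
  exact: (UP (a, b)).
move=> /choice[U UP].
exists ([set u : V | forall i j, (U (i, j)).1 (u i j)],
        [set u : V | forall i j, (U (i, j)).2 (u i j)]) => /=.
  split; [exists (fun i j => (U (i, j)).1) | exists (fun i j => (U (i, j)).2)] => //;
    by move=> i j; have [] := UP (i, j).
move=> [u v] /= [uU vU]; apply: PA => i j; rewrite !mxE.
by have [_ _] := UP (i, j); apply.
Qed.

HB.instance Definition _ :=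
  PreTopologicalNmodule_isTopologicalZmodule.Build V padic_space_sub_continuous.

End PadicSpace.

Section ProdTopologicalZmodule.
Variables (I : Type).

Section Zmodule.
Variable G : I -> zmodType.
Local Notation P := (prod_topology G).

Let add (x y : P) : P := fun i => x i + y i.
Let opp (x : P) : P := fun i => - x i.
Let zero : P := fun i => 0.

Let addA : associative add.
Proof. by move=> x y z; apply: functional_extensionality_dep => i; rewrite /add addrA. Qed.

Let addC : commutative add.
Proof. by move=> x y; apply: functional_extensionality_dep => i; rewrite /add addrC. Qed.

Let add0 : left_id zero add.
Proof. by move=> x; apply: functional_extensionality_dep => i; rewrite /add add0r. Qed.

Let addN : left_inverse zero opp add.
Proof. by move=> x; apply: functional_extensionality_dep => i; rewrite /add addNr. Qed.

HB.instance Definition _ := Choice.copy P (forall i, G i).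
HB.instance Definition _ := GRing.isZmodule.Build P addA addC add0 addN.
End Zmodule.

Variable G : I -> topologicalZmodType.
Local Notation P := (prod_topology G).

Let prod_sub_continuous : continuous (fun z : P * P => z.1 - z.2).
Proof.
move=> z; apply/cvg_sup => i; move: z; apply: continuous_comp_initial.
move=> z A /= /(@sub_continuous _ (z.1 i, z.2 i)) [[U V] [/= nU nV] UV].
have pi := @proj_continuous {classic I} G i.
exists (proj i @^-1` U, proj i @^-1` V); first by split; [exact: pi nU|exact: pi nV].
by move=> [a b] /= [aU bV]; exact: (UV (a i, b i)).
Qed.

HB.instance Definition _ :=
  PreTopologicalNmodule_isTopologicalZmodule.Build P prod_sub_continuous.

End ProdTopologicalZmodule.

Record homeo (X : topologicalType) := Homeo {
  homeo_fun :> X -> X;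
  homeo_inv : X -> X;
  homeoK : cancel homeo_fun homeo_inv;
  homeoVK : cancel homeo_inv homeo_fun;
  homeo_continuous : continuous homeo_fun;
  homeoV_continuous : continuous homeo_inv
}.

Definition homeo_sym (X : topologicalType) (f : homeo X) : homeo X :=
  Homeo (homeoVK f) (homeoK f)
    (@homeoV_continuous X f) (@homeo_continuous X f).

(* [Negz n] is [- n.+1]. *)
Definition homeo_iter (X : topologicalType) (f : homeo X) (k : int) : X -> X :=
  match k with
  | Posz n => iter n f
  | Negz n => iter n.+1 (homeo_inv f)
  end.

(* Nonnegativity follows from the three axioms. *)
Definition is_metric (R : realType) (X : Type) (d : X -> X -> R) :=
  [/\ forall x y, d x y = 0 <-> x = y,
      forall x y, d x y = d y x &
      forall x y z, d x z <= d x y + d y z].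

Definition induces_topology (R : realType) (X : topologicalType)
    (d : X -> X -> R) :=
  forall x : X, nbhs x = nbhs_ball_ (fun x e => [set y | d x y < e]) x.

Definition expansive_homeo (R : realType) (X : topologicalType) (f : homeo X) :=
  exists d : X -> X -> R,
    [/\ is_metric d, induces_topology d &
        exists2 delta : R, 0 < delta & forall x y : X, x <> y ->
          exists k : int, delta < d (homeo_iter f k x) (homeo_iter f k y)].

Record top_aut (G : topologicalZmodType) := TopAut {
  aut_homeo :> homeo G;
  aut_zmod_morphism : zmod_morphism aut_homeo
}.

Section Automorphisms.
Variable G : topologicalZmodType.
Implicit Types T : top_aut G.

Lemma autV_zmod_morphism T : zmod_morphism (homeo_sym T).
Proof.
by move=> x y; apply: (can_inj (homeoK T)); rewrite aut_zmod_morphism !homeoVK.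
Qed.

Definition autV T : top_aut G := TopAut (autV_zmod_morphism T).

Definition expansive_aut T :=
  exists2 U : set G, nbhs (0 : G) U &
    \bigcap_(k in [set: int]) (homeo_iter T k @` U) = [set 0].

Definition contraction_group T : set G :=
  [set x | iter k T x @[k --> \oo] --> (0 : G)].

Definition subgroup (H : set G) := H 0 /\ forall x y, H x -> H y -> H (x - y).

(* Internal direct product in the category of topological groups: addition
   [A * B -> G] is bijective and bicontinuous. *)
Definition internal_direct_product (A B : set G) :=
  [/\ subgroup A, subgroup B &
      exists pr : G -> A * B,
        [/\ cancel pr (fun ab => set_val ab.1 + set_val ab.2),
            cancel (fun ab : A * B => set_val ab.1 + set_val ab.2) pr &
            continuous pr]].

Record closed_subgroup := ClosedSubgroup {
  csub_val :> set G;
  csub_closed : closed csub_val;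
  csub_subgroup : subgroup csub_val
}.

HB.instance Definition _ := gen_eqMixin closed_subgroup.
HB.instance Definition _ := gen_choiceMixin closed_subgroup.

(* The Chabauty topology. *)
Definition chabauty_subbase : set (set closed_subgroup) :=
  [set B | (exists2 K : set G, compact K & B = [set A : closed_subgroup | (A : set G) `&` K = set0])
        \/ (exists2 U : set G, open U & B = [set A : closed_subgroup | (A : set G) `&` U !=set0])].

HB.instance Definition _ :=
  isSubBaseTopological.Build closed_subgroup chabauty_subbase id.

Lemma csub_inj (A B : closed_subgroup) : csub_val A = csub_val B -> A = B.
Proof.
case: A B => [A cA sA] [B cB sB] /= AB; rewrite {}AB in cA sA *.
by rewrite (Prop_irrelevance cA cB) (Prop_irrelevance sA sB).
Qed.

Lemma aut_image T (H : set G) : T @` H = autV T @^-1` H.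
Proof.
rewrite eqEsubset; split => [_ [x Hx <-]|y Hy]; first by rewrite /= homeoK.
by exists (autV T y) => //; rewrite /= homeoVK.
Qed.

Lemma sub_image_closed T (H : closed_subgroup) : closed (T @` H).
Proof.
rewrite aut_image; apply: preimage_closed; last exact: csub_closed.
by move=> x _; exact: homeoV_continuous.
Qed.

Lemma sub_image_subgroup T (H : closed_subgroup) : subgroup (T @` H).
Proof.
have [H0 HB] := csub_subgroup H; split.
  by exists 0 => //; have := aut_zmod_morphism T 0 0; rewrite !subrr.
move=> _ _ [x Hx <-] [y Hy <-]; exists (x - y); first exact: (HB x y).
exact: aut_zmod_morphism.
Qed.

Definition sub_image T (H : closed_subgroup) : closed_subgroup :=
  ClosedSubgroup (@sub_image_closed T H) (sub_image_subgroup T H).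

Lemma sub_imageK T : cancel (sub_image T) (sub_image (autV T)).
Proof.
move=> H; apply: csub_inj => /=; rewrite image_comp.
by rewrite (_ : _ \o _ = id) ?image_id //; apply/funext => x; exact: homeoK.
Qed.

Lemma sub_imageVK T : cancel (sub_image (autV T)) (sub_image T).
Proof.
move=> H; apply: csub_inj => /=; rewrite image_comp.
by rewrite (_ : _ \o _ = id) ?image_id //; apply/funext => x; exact: homeoVK.
Qed.

Lemma chabauty_subbase_nbhs (B : set closed_subgroup) (H : closed_subgroup) :
  chabauty_subbase B -> B H -> nbhs H B.
Proof.
move=> bB BH; exists B; split => //; exists [set B]; last first.
  by rewrite predeqE => ?; split=> [[_ ->]|] //; exists B.
move=> _ ->; exists [fset B]%fset.
  by move=> C /fset1P ->; exact/mem_set.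
by rewrite predeqE => ?; split=> [|??]; [apply|]; rewrite /= inE // => /eqP->.
Qed.

Lemma sub_image_subbase T (B : set closed_subgroup) :
  chabauty_subbase B -> chabauty_subbase (sub_image T @^-1` B).
Proof.
have TI (H : closed_subgroup) (A : set G) :
    (T @` H `&` A !=set0) <-> ((H : set G) `&` T @^-1` A !=set0).
  split=> [[_ [[x Hx <-] Ax]]|[x [Hx Ax]]]; first by exists x.
  by exists (T x); split => //; exists x.
move=> [[K cK ->]|[U oU ->]]; [left|right].
  exists (autV T @` K).
    apply: continuous_compact => //; apply: continuous_subspaceT.
    exact: homeo_continuous.
  apply/funext => H; apply/propext; rewrite aut_image /=.
  split=> /eqP E; apply/eqP; apply: contraTT E => /set0P E; apply/set0P;
    exact/TI.
exists (T @^-1` U).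
  by apply: open_comp oU => x _; exact: homeo_continuous.
by apply/funext => H; apply/propext; exact: TI.
Qed.

Lemma sub_image_continuous T : continuous (sub_image T).
Proof.
move=> H A [_ [[D sD <-] [C DC CH] CA]].
have [F sF FC] := sD _ DC; subst C.
change (nbhs H (sub_image T @^-1` A)).
apply: (@filterS _ _ _ (sub_image T @^-1` \bigcap_(i in [set` F]) i)).
  by move=> X FX; apply: CA; exists (\bigcap_(i in [set` F]) i).
rewrite preimage_bigcap; apply: filter_bigI => B FB.
apply: chabauty_subbase_nbhs; last exact: CH.
by apply: sub_image_subbase; exact/set_mem/sF.
Qed.

Definition sub_action T : homeo closed_subgroup :=
  Homeo (sub_imageK T) (sub_imageVK T)
    (@sub_image_continuous T) (@sub_image_continuous (autV T)).

End Automorphisms.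

Definition direct_factor (I : Type) (G : I -> zmodType) (i : I) :
    set (prod_topology G) :=
  [set x | forall j, j <> i -> x j = 0].
Arguments direct_factor {I G} i.

(* Main.v *)
(* Part 1. The i-th factor is the set of x with p_i^k x -> 0, a description that
   every automorphism respects.  Let L be the unit ball; expansiveness says, after
   scaling, that only 0 has its whole orbit in L, and then by compactness a point
   whose forward orbit stays in L lies in C(T).  Willis' tidying argument writes
   every small x as y + z with the backward orbit of y and the forward orbit of z
   inside L; scaling by powers of p_1 ... p_n turns this into G = C(T) + C(T^-1)
   and gives the continuity of the two projections.

   If m_i >= 2, there are independent v, w in the i-th factor and a constant C
   with |T^k v| <= C |T^k w| for all integers k.  Then the lines through w and
   w + q v, for q small, stay uniformly close under all T^k, so the action on
   Sub_G is not expansive.  To find v and w, replace T by a scalar multiple of a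
   power that has determinant 1.  Either all its forward (or all its backward)
   orbits are bounded, and then the adjugate formula bounds the whole group
   generated by T; or the tidying argument gives x with bounded forward and
   unbounded backward orbit and y with the opposite behaviour, and v = x,
   w = x + y work.

   Part 2. T is multiplication by some a_i on each factor, and both conditions
   say that |a_i| <> 1 for all i: a closed subgroup of G is the product of its
   intersections with the factors, each of which is a Z_p-module. *)
Require Import Defs.
From mathcomp Require Import all_boot all_order all_algebra finmap.
From mathcomp Require Import all_classical all_reals topology tvs.
From mathcomp Require Import zify ring lra.

Set Implicit Arguments.
Unset Strict Implicit.
Unset Printing Implicit Defensive.

Import Order.TTheory GRing.Theory Num.Theory.
Local Open Scope classical_set_scope.
Local Open Scope ring_scope.

(** * Integers in the p-adic numbers *)

(** The factors are vector spaces over different fields, so [G] carries no common scalars. Integers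
    take their place: multiplication by an integer commutes with every automorphism, and
    multiplication by P = p_1 ... p_n is bijective and contracts every factor by at least 2. What
    the proof uses of the topology is packed into a rational valued ultrametric norm with compact
    balls ([unorm]) and, for each factor, the rule |k x| = |k|_p |x| ([padic_normed]).

    The metric in the definition of expansiveness on Sub_G is eliminated once and for all. As the
    norm is ultrametric, the Chabauty topology has a countable base of entourages that are
    equivalence relations; they define one compatible metric, and compactness of Sub_G compares any
    other with it.

    The determinant must be normalised: multiplication by p has bounded forward orbits but an
    unbounded inverse. Domination of v by w ignores scalars and survives the passage between a map
    and its powers, so B^n / det B in dimension n serves and no root is extracted. In the mixed case
    the orbit of w is bounded below because an unbounded orbit cannot return arbitrarily close to
    0. *)

Section RatPnormInt.
Variables (p : nat) (p_pr : prime p).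
Local Notation N := (rat_pnorm p).

Lemma pexpr_gt0 (k : nat) : 0 < (p%:R : rat) ^+ k.
Proof. by rewrite exprn_gt0 // ltr0n prime_gt0. Qed.

Lemma prime_inv_itv : 0 <= (p%:R : rat)^-1 < 1.
Proof. by rewrite invr_ge0 ler0n /= invf_lt1 ?ltr0n ?ltr1n ?prime_gt0 ?prime_gt1. Qed.

Lemma rat_pnorm_int_le1 (z : int) : N z%:~R <= 1.
Proof.
have [->|z0] := eqVneq z 0; first by rewrite rat_pnorm0.
rewrite -[z%:~R]divr1 (_ : 1 = 1%:~R) // rat_pnorm_frac //= logn1 expr0.
by rewrite ler_pdivrMr // ?pexpr_gt0 // mul1r exprn_ege1 // ler1n prime_gt0.
Qed.

Lemma rat_pnorm_nat_le1 (k : nat) : N k%:R <= 1.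
Proof. exact: (rat_pnorm_int_le1 k). Qed.

Lemma rat_pnorm_nat (k : nat) : (0 < k)%N -> N k%:R = p%:R ^- logn p k.
Proof.
move=> k0; rewrite -[k%:R]divr1 (_ : 1 = 1%:~R) // (_ : k%:R = (k : int)%:~R) //.
by rewrite rat_pnorm_frac //= ?logn1 ?expr0 ?mul1r // ?gt_eqF.
Qed.

Lemma rat_pnorm_p : N p%:R = p%:R^-1.
Proof. by rewrite rat_pnorm_nat ?prime_gt0 // logn_prime // eqxx expr1. Qed.

Lemma rat_pnorm_coprime (k : nat) : ~~ (p %| k)%N -> N k%:R = 1.
Proof.
move=> pk; rewrite rat_pnorm_nat; last by case: k pk; rewrite ?dvdn0.
by rewrite lognE (negbTE pk) !andbF expr0 invr1.
Qed.

Lemma rat_pnormX x k : N (x ^+ k) = N x ^+ k.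
Proof.
by elim: k => [|k IH]; rewrite ?expr0 ?rat_pnorm1 // !exprS rat_pnormM // IH.
Qed.

(** Norm values are powers of p, so a norm below [p] is at most 1 and the denominator is prime to p;
    the strict bound is the one that an approximation provides. A Bezout relation then inverts the
    denominator modulo [p ^ t]. *)
Lemma nat_approx_rat (q : rat) (t : nat) : N q < p%:R ->
  exists c : nat, N (q - c%:R) <= p%:R ^- t.
Proof.
move=> qp; have pd : ~~ (p %| `|denq q|)%N.
  apply/negP => pd; have pn : ~~ (p %| `|numq q|)%N.
    apply/negP => pn; have := coprime_num_den q; rewrite /coprime => /eqP g1.
    by have := prime_gt1 p_pr; rewrite ltnNge dvdn_leq // -g1 dvdn_gcd pn.
  move: qp; rewrite /rat_pnorm; case: eqP pd => [->|_ pd].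
    by rewrite /= dvdn1 => /eqP p1; move: p_pr; rewrite p1.
  rewrite [logn p `|numq q|]lognE (negbTE pn) !andbF expr0 divr1.
  rewrite -[X in _ < X]expr1 ltr_eXn2l ?ltr1n ?prime_gt1 // ltnS leqn0.
  by rewrite lognE p_pr absz_gt0 denq_neq0 pd.
have cop : coprimez (denq q) (p ^ t)%N.
  rewrite /coprimez /gcdz /= eqz_nat; change (coprime `|denq q| (p ^ t)).
  by rewrite coprime_sym coprimeXl // prime_coprime.
have [u [v uv]] := Bezoutz (denq q) (p ^ t)%N.
move: cop; rewrite /coprimez => /eqP g1; rewrite g1 in uv.
(* [z] represents q modulo p^t; taking the residue makes it nonnegative, hence a natural number. *)
pose z := (numq q * u %% (p ^ t)%N)%Z.
have pt0 : (p ^ t)%N != 0 :> int by rewrite eqz_nat expn_eq0 negb_and -lt0n prime_gt0.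
have z0 : 0 <= z by rewrite modz_ge0.
exists `|z|%N.
have dN0 : (denq q)%:~R != 0 :> rat by rewrite intr_eq0 denq_neq0.
pose w := numq q * v + (numq q * u %/ (p ^ t)%N)%Z * denq q.
have E : numq q - z * denq q = (p ^ t)%N%:Z * w.
  have := divz_eq (numq q * u) (p ^ t)%N; rewrite -/z /w.
  move: (_ %/ _)%Z uv z {z0} => d uv z /esym E.
  have {E} E : z = numq q * u - d * (p ^ t)%N by rewrite -E; ring.
  rewrite E -[LHS]mulr1.
  have : numq q = numq q * (u * denq q + v * (p ^ t)%N) by rewrite uv mulr1.
  move: (Posz (p ^ t)) => P; move: (numq q) (denq q) => a b {1}->; ring.
have Ez : `|z|%N%:R = z%:~R :> rat.
  by rewrite -[in RHS](gez0_abs z0).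
have qE : q - `|z|%N%:R = (p%:R ^+ t * w%:~R) / (denq q)%:~R.
  apply: (mulIf dN0); rewrite divfK // mulrBl Ez.
  have -> : q * (denq q)%:~R = (numq q)%:~R.
    by rewrite -{1}[q]divq_num_den divfK.
  by rewrite -intrM -intrB E intrM -natrX.
have dN1 : N (denq q)%:~R = 1.
  rewrite -[(denq q)%:~R]divr1 (_ : 1 = 1%:~R) // rat_pnorm_frac ?denq_neq0 //=.
  by rewrite logn1 expr0 [logn p `|denq q|]lognE (negbTE pd) !andbF mul1r invr1.
have : N (q - `|z|%N%:R) * N (denq q)%:~R = p%:R ^- t * N w%:~R.
  by rewrite -rat_pnormM // qE divfK // rat_pnormM // rat_pnormX rat_pnorm_p exprVn.
rewrite dN1 mulr1 => ->.
by rewrite -[X in _ <= X]mulr1 ler_wpM2l ?rat_pnorm_int_le1 // invr_ge0 ltW // pexpr_gt0.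
Qed.

End RatPnormInt.

(** * Density of the naturals in Z_p and limits of sequences of naturals *)

Section PadicDensity.
Variables (p : nat) (p_pr : prime p).
Local Notation K := (padic p_pr).
Local Notation N := (rat_pnorm p).
Local Notation "| x |" := (@padic_norm p p_pr x) (at level 0, x at level 99).
Local Open Scope quotient_scope.

Lemma padic_norm_pi_le (u : pcauchy_seq p_pr) (c : rat) :
  (exists M, forall n, (M <= n)%N -> N (u n) <= c) -> padic_norm (\pi_K u) <= c.
Proof.
move=> [M h]; rewrite leNgt; apply/negP => lt.
have [|M' h'] := padic_norm_lim u (e := padic_norm (\pi_K u) - c); first by lra.
have := h (maxn M M') (leq_maxl _ _); have := h' (maxn M M') (leq_maxr _ _).
by rewrite ltr_norml; lra.
Qed.

Lemma padic_norm_pi_ge (u : pcauchy_seq p_pr) (c : rat) :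
  (exists M, forall n, (M <= n)%N -> c <= N (u n)) -> c <= padic_norm (\pi_K u).
Proof.
move=> [M h]; rewrite leNgt; apply/negP => lt.
have [|M' h'] := padic_norm_lim u (e := c - padic_norm (\pi_K u)); first by lra.
have := h (maxn M M') (leq_maxl _ _); have := h' (maxn M M') (leq_maxr _ _).
by rewrite ltr_norml; lra.
Qed.

Lemma pcauchy_natE (k n : nat) : (k%:R : pcauchy_seq p_pr) n = k%:R.
Proof.
elim: k => [|k IH]; first by [].
by rewrite -[in LHS]addn1 -[in RHS]addn1 !natrD -IH.
Qed.

Lemma padic_norm_nat (k : nat) : padic_norm (k%:R : K) = N k%:R.
Proof.
rewrite -[k%:R : K](rmorph_nat \pi_K); apply/eqP; rewrite eq_le.
by rewrite padic_norm_pi_le ?padic_norm_pi_ge //; exists 0%N => n _; rewrite pcauchy_natE.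
Qed.

Lemma padic_nat_dense (x : K) (e : rat) : padic_norm x <= 1 -> 0 < e ->
  exists c : nat, padic_norm (x - c%:R) < e.
Proof.
elim/quotP: x => u _ u1 e0.
(* A term within [p - 1] of a limit that is at most 1 has norm below [p], as [nat_approx_rat]
   requires. *)
have p1 : 0 < (p%:R : rat) - 1 by rewrite subr_gt0 ltr1n prime_gt1.
have e2 : 0 < e / 2 by lra.
have [M1 h1] := padic_norm_lim u p1.
have [M2 h2] := pcauchyP _ _ (valP u) _ e2.
pose M := maxn M1 M2.
have uMp : N (u M) < p%:R.
  by have := h1 M (leq_maxl _ _); rewrite ltr_norml; lra.
have [t ht] : exists t : nat, (p%:R : rat) ^- t <= e / 2.
  have [k hk] : exists k : nat, (e / 2)^-1 < k%:R.
    by exists (Num.bound (e / 2)^-1); rewrite archi_boundP // invr_ge0 ltW.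
  exists k; rewrite -[X in _ <= X]invrK lef_pV2 ?posrE ?invr_gt0 ?pexpr_gt0 //.
  by rewrite ltW // (lt_le_trans hk) // -natrX ler_nat ltnW // ltn_expl // prime_gt1.
have [c hc] := nat_approx_rat p_pr t uMp.
exists c; apply: (@le_lt_trans _ _ (e / 2)); last by lra.
rewrite -[c%:R : K](rmorph_nat \pi_K) -rmorphB.
apply: padic_norm_pi_le; exists M => n Mn.
change ((u - c%:R : pcauchy_seq p_pr) n) with (u n - (c%:R : pcauchy_seq p_pr) n).
rewrite pcauchy_natE -[u n](subrK (u M)) -addrA.
apply: le_trans (rat_pnorm_ultra _ _ _) _ => //.
rewrite ge_max (le_trans hc ht) andbT ltW // h2 ?leq_maxr //.
exact: leq_trans (leq_maxr _ _) Mn.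
Qed.

(** The sequence is itself a Cauchy representative of its limit, and the bounds hold along it. *)
Lemma padic_limit (c : nat -> nat) :
  (forall m n : nat, (m <= n)%N -> N ((c m)%:R - (c n)%:R) <= p%:R ^- m) ->
  exists l : K, forall n : nat, padic_norm (l - (c n)%:R) <= p%:R ^- n.
Proof.
move=> cC; pose u n : rat := (c n)%:R.
have uC : u \in pcauchy p_pr.
  apply/pcauchyP => e e0.
  have [k hk] : exists k : nat, e^-1 < k%:R.
    by exists (Num.bound e^-1); rewrite archi_boundP // invr_ge0 ltW.
  have hk' : (p%:R : rat) ^- k < e.
    rewrite -[X in _ < X]invrK ltf_pV2 ?posrE ?invr_gt0 ?pexpr_gt0 //.
    by rewrite (lt_le_trans hk) // -natrX ler_nat ltnW // ltn_expl // prime_gt1.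
  exists k => m n km kn; rewrite /u -[(c m)%:R](subrK (c k)%:R) -addrA.
  apply: rat_pnorm_sum => //; apply: le_lt_trans hk'; last exact: cC.
  by rewrite -rat_pnormN opprB; exact: cC.
exists (\pi_K (PCauchySeq uC)) => n.
rewrite -[(c n)%:R : K](rmorph_nat \pi_K) -rmorphB.
apply: padic_norm_pi_le; exists n => m nm.
set v : pcauchy_seq p_pr := PCauchySeq uC.
change ((v - (c n)%:R : pcauchy_seq p_pr) m) with (u m - ((c n)%:R : pcauchy_seq p_pr) m).
by rewrite pcauchy_natE -rat_pnormN opprB; exact: cC.
Qed.

End PadicDensity.

(** * Archimedean estimates and ultrafilters *)

Lemma archi_inv (e : rat) : 0 < e -> exists n : nat, n.+1%:R^-1 < e.
Proof.
move=> e0; exists (Num.bound e^-1).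
have h : e^-1 < (Num.bound e^-1)%:R by rewrite archi_boundP // invr_ge0 ltW.
rewrite -[X in _ < X]invrK ltf_pV2 ?posrE ?invr_gt0 //.
by rewrite (lt_le_trans h) // ler_nat.
Qed.

(** Bernoulli's inequality for [c^-1 = 1 + d]. *)
Lemma archi_exp (c e : rat) : 0 <= c < 1 -> 0 < e -> exists n : nat, c ^+ n < e.
Proof.
move=> /andP[c0 c1] e0; have [->|cn0] := eqVneq c 0; first by exists 1%N; rewrite expr1.
have {c0 cn0} c0 : 0 < c by rewrite lt_neqAle eq_sym cn0.
pose d := c^-1 - 1; have d0 : 0 < d by rewrite subr_gt0 invf_gt1.
have bern n : 1 + n%:R * d <= (c^-1) ^+ n.
  elim: n => [|n IH]; first by rewrite mul0r addr0 expr0.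
  rewrite exprS; apply: le_trans (ler_wpM2l (_ : 0 <= c^-1) IH); last by rewrite invr_ge0 ltW.
  have -> : c^-1 = 1 + d by rewrite /d addrC subrK.
  rewrite -addn1 natrD; have : 0 <= n%:R * d * d by rewrite !mulr_ge0 ?(ltW d0) ?ler0n.
  by move: (n%:R : rat) => a; nra.
have [n hn] : exists n : nat, (e * d)^-1 < n%:R.
  by exists (Num.bound (e * d)^-1); rewrite archi_boundP // invr_ge0 mulr_ge0 ?(ltW e0) ?(ltW d0).
exists n; rewrite -[c]invrK exprVn -[X in _ < X]invrK ltf_pV2 ?posrE ?exprn_gt0 ?invr_gt0 //.
apply: lt_le_trans (bern n); rewrite -(ltr_pM2r d0) in hn.
by move: hn; rewrite invfM mulfVK ?gt_eqF // => hn; rewrite ltr_wpDl.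
Qed.

Lemma ultra_fmap (S T : Type) (f : S -> T) (F : set_system S) :
  UltraFilter F -> UltraFilter (f @ F).
Proof.
move=> FU; split; first exact: fmap_proper_filter.
move=> G GP sFG; apply/seteqP; split=> [A GA|]; last exact: sFG.
have [//|nA] := in_ultra_setVsetC (f @^-1` A) FU.
have : G (~` A) by apply: sFG.
by move=> /(filterI GA); rewrite setICr => /filter_not_empty.
Qed.

(** Pigeonhole principle for ultrafilters; it will pick a residue class modulo [p ^ n]. *)
Lemma ultra_bigcup (T : Type) (F : set_system T) (n : nat) (B : nat -> set T) :
  UltraFilter F -> F [set x | exists2 i, (i < n)%N & B i x] ->
  exists2 i, (i < n)%N & F (B i).
Proof.
move=> FU FB; apply: contrapT => /forall2NP nB.
have : F [set x | forall i : 'I_n, ~ B i x].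
  apply: filter_forall => i; have [|//] := in_ultra_setVsetC (B i) FU.
  by move=> FBi; have [|] := nB i; rewrite ?ltn_ord.
move=> /(filterI FB)/filter_ex [x [[i ilt Bix] h]].
exact: h (Ordinal ilt) Bix.
Qed.

(** * Ultrametric groups *)

(** Homogeneity is not asked for, since a product over several primes has no common field of
    scalars. Rational values suffice for p-adic norms and their finite maxima. *)
Record unorm (G : topologicalZmodType) (N : G -> rat) : Prop := UNorm {
  un_ge0 : forall x, 0 <= N x;
  un_eq0 : forall x, N x = 0 -> x = 0;
  un_0 : N 0 = 0;
  un_maxB : forall x y, N (x - y) <= Num.max (N x) (N y);
  un_nbhs : forall (x : G) A,
    nbhs x A <-> exists2 e : rat, 0 < e & forall y, N (y - x) < e -> A y;
  un_compact : forall r, compact [set x | N x <= r]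
}.

(** Integers stand in for scalars: every additive map respects them, and |k|_p tells the primes
    apart. *)
Record padic_normed (p : nat) (G : topologicalZmodType) (N : G -> rat) : Prop :=
PadicNormed {
  pn_unorm :> unorm N;
  pn_mulrn : forall x k, N (x *+ k) = rat_pnorm p k%:R * N x;
  pn_div : forall (k : nat) (x : G), (0 < k)%N -> exists y : G, y *+ k = x
}.

Section UNorm.
Variables (G : topologicalZmodType) (N : G -> rat).
Hypothesis Nu : unorm N.

Lemma un_gt0 x : x <> 0 -> 0 < N x.
Proof.
by move=> x0; rewrite lt_neqAle un_ge0 // andbT eq_sym; apply/eqP => /(un_eq0 Nu).
Qed.

Lemma un_opp x : N (- x) = N x.
Proof.
have le y : N (- y) <= N y.
  by have := un_maxB Nu 0 y; rewrite sub0r un_0 // (max_idPr _) // un_ge0.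
by apply/eqP; rewrite eq_le le -{1}[x]opprK le.
Qed.

Lemma un_dist x y : N (x - y) = N (y - x).
Proof. by rewrite -un_opp opprB. Qed.

Lemma un_maxD x y : N (x + y) <= Num.max (N x) (N y).
Proof. by rewrite -{1}[y]opprK -(un_opp y) un_maxB. Qed.

Lemma un_ltB x y e : N x < e -> N y < e -> N (x - y) < e.
Proof. by move=> xe ye; rewrite (le_lt_trans (un_maxB Nu x y)) // gt_max xe. Qed.

Lemma un_ltD x y e : N x < e -> N y < e -> N (x + y) < e.
Proof. by move=> xe ye; rewrite (le_lt_trans (un_maxD x y)) // gt_max xe. Qed.

Lemma un_leB x y e : N x <= e -> N y <= e -> N (x - y) <= e.
Proof. by move=> xe ye; rewrite (le_trans (un_maxB Nu x y)) // ge_max xe. Qed.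

Lemma un_leD x y e : N x <= e -> N y <= e -> N (x + y) <= e.
Proof. by move=> xe ye; rewrite (le_trans (un_maxD x y)) // ge_max xe. Qed.

Lemma un_leDl x y : N x <= Num.max (N (x + y)) (N y).
Proof. by have := un_maxB Nu (x + y) y; rewrite addrK. Qed.

Lemma un_nbhs0 A : nbhs (0 : G) A <-> exists2 e : rat, 0 < e & forall y, N y < e -> A y.
Proof.
rewrite (un_nbhs Nu); split=> -[e e0 h]; exists e => // y.
  by move=> ye; apply: h; rewrite subr0.
by rewrite subr0; exact: h.
Qed.

Lemma un_nbhs_lt (x : G) (e : rat) : 0 < e -> nbhs x [set y | N (y - x) < e].
Proof. by move=> e0; apply/(un_nbhs Nu); exists e. Qed.

Lemma un_openP (A : set G) :
  open A <-> forall x : G, A x -> exists2 e : rat, 0 < e & forall y, N (y - x) < e -> A y.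
Proof.
rewrite openE; split=> h x Ax; first exact/(un_nbhs Nu)/h.
by rewrite /interior; apply/(un_nbhs Nu)/h.
Qed.

Lemma un_closedP (A : set G) :
  closed A <-> forall x : G, (forall e : rat, 0 < e -> exists2 y, A y & N (y - x) < e) -> A x.
Proof.
split=> [cA x h|h x cx].
  apply: cA => B /(un_nbhs Nu)[e /h[y Ay ye] eB]; exists y; split=> //.
  exact: eB.
apply: h => e e0; have [y [Ay ye]] := cx _ (un_nbhs_lt x e0).
by exists y.
Qed.

Lemma un_ball_closed (x : G) (r : rat) : closed [set y | N (y - x) <= r].
Proof.
apply/un_closedP => y h /=; rewrite leNgt; apply/negP => lt.
have [|z /= zr zy] := h (N (y - x)); first apply: le_lt_trans lt.
  by have [z hz _] := h 1 ltr01; apply: le_trans hz; exact: un_ge0.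
have := un_ltB (le_lt_trans zr lt) zy.
by rewrite opprB addrC addrA subrK ltxx.
Qed.

Lemma un_ball_compact (x : G) (r : rat) : compact [set y | N (y - x) <= r].
Proof.
apply: (@subclosed_compact _ _ [set y | N y <= Num.max r (N x)]).
- exact: un_ball_closed.
- exact: un_compact.
- move=> y /= yr; rewrite -(subrK x y); apply: le_trans (un_maxD _ _) _.
  by rewrite ge_max !le_max yr lexx orbT.
Qed.

Lemma un_cvg0P (u : nat -> G) : u k @[k --> \oo] --> (0 : G) <->
  forall e : rat, 0 < e -> exists M, forall k, (M <= k)%N -> N (u k) < e.
Proof.
split=> [h e e0|h A].
  have /h : nbhs (0 : G) [set y | N y < e] by apply/un_nbhs0; exists e.
  by move=> [M _ Mh]; exists M => k Mk; exact: Mh.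
by move=> /un_nbhs0 [e /h[M Mh] eA]; exists M => // k /= Mk; apply/eA/Mh.
Qed.

End UNorm.

Lemma un_continuousP (G H : topologicalZmodType) (N : G -> rat) (M : H -> rat)
    (f : G -> H) : unorm N -> unorm M -> zmod_morphism f ->
  continuous f <->
  forall e : rat, 0 < e -> exists2 d : rat, 0 < d & forall x, N x < d -> M (f x) < e.
Proof.
move=> Nu Mu fB; have f0 : f 0 = 0 by have := fB 0 0; rewrite !subrr.
split=> [fc e e0|h x A /(un_nbhs Mu)[e /h[d d0 dh] eA]].
  have : nbhs (f 0) [set y | M (y - f 0) < e] by exact: un_nbhs_lt.
  by move=> /fc /(un_nbhs0 Nu)[d d0 h]; exists d => // x /h; rewrite /= f0 subr0.
by apply/(un_nbhs Nu); exists d => // y /dh yx; apply: eA; rewrite -fB.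
Qed.

(** * Q_p as an ultrametric group with compact balls *)

Section PadicInstance.
Variables (p : nat) (p_pr : prime p).
Local Notation K := (padic p_pr).
Local Notation N := (@padic_norm p p_pr).

Lemma padic_ballP (x : K) A :
  nbhs x A <-> exists2 e : rat, 0 < e & forall y, N (y - x) < e -> A y.
Proof.
split=> [/padic_nbhsP|] [e e0 h].
  by exists e => // y ye; apply: h; rewrite -padic_normN opprB.
by apply/padic_nbhsP; exists e => // y ye; apply: h; rewrite -padic_normN opprB.
Qed.

Lemma padic_norm_maxB (x y : K) : N (x - y) <= Num.max (N x) (N y).
Proof. by rewrite -(padic_normN y) padic_norm_ultra. Qed.

Lemma padic_norm1 : N 1 = 1.
Proof. by rewrite (padic_norm_nat p_pr 1) rat_pnorm1. Qed.

Lemma padic_normX x k : N (x ^+ k) = N x ^+ k.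
Proof. by elim: k => [|k IH]; rewrite ?padic_norm1 // !exprS padic_normM IH. Qed.

Lemma padic_normV x : N x^-1 = (N x)^-1.
Proof.
have [->|x0] := eqVneq x 0; first by rewrite invr0 padic_norm0 invr0.
have Nx : N x != 0 by rewrite padic_norm_eq0.
by apply: (mulIf Nx); rewrite -padic_normM !mulVf // padic_norm1.
Qed.

Lemma padic_norm_mulrn (x : K) k : N (x *+ k) = rat_pnorm p k%:R * N x.
Proof. by rewrite -(mulr_natl x) padic_normM padic_norm_nat. Qed.

Lemma padic_norm_p : N p%:R = p%:R^-1.
Proof. by rewrite padic_norm_nat rat_pnorm_p. Qed.

Lemma padic_nat_neq0 k : (0 < k)%N -> k%:R != 0 :> K.
Proof.
by move=> k0; rewrite -padic_norm_eq0 padic_norm_nat rat_pnorm_eq0 // pnatr_eq0 -lt0n.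
Qed.

Lemma padic_p_neq0 : p%:R != 0 :> K.
Proof. exact/padic_nat_neq0/prime_gt0. Qed.

Let pV1 := prime_inv_itv p_pr.

(** Compactness of Z_p. By density the balls of radius p^-n around 0, ..., p^n - 1 cover Z_p, so the
    ultrafilter contains one of them; any two such balls meet, so their centres form a Cauchy
    sequence, and its limit is [l]. *)
Lemma padic_int_ultra (F : set_system K) : UltraFilter F ->
  F [set x | N x <= 1] -> exists l : K, F --> l.
Proof.
move=> FU F1.
have ex n : exists c : nat, F [set x | N (x - c%:R) <= p%:R ^- n].
  have [|c _ Fc] := @ultra_bigcup _ F (p ^ n)%N
      (fun c => [set x | N (x - c%:R) <= p%:R ^- n]) FU; last by exists c.
  apply: filterS F1 => x /= x1.
  have pn0 : 0 < (p%:R : rat) ^- n by rewrite invr_gt0 pexpr_gt0.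
  have [c hc] := padic_nat_dense x1 pn0.
  exists (c %% p ^ n)%N; first by rewrite ltn_mod expn_gt0 prime_gt0.
  rewrite /= -[x](subrK c%:R) -addrA.
  apply: le_trans (padic_norm_ultra _ _) _; rewrite ge_max ltW //=.
  rewrite {1}(divn_eq c (p ^ n)) natrD addrK natrM padic_normM natrX padic_normX.
  rewrite padic_norm_p exprVn padic_norm_nat -[X in _ <= X]mul1r.
  by rewrite ler_wpM2r ?rat_pnorm_nat_le1 // ltW.
have [c Fc] := choice ex.
have [|l hl] := @padic_limit p p_pr c.
  move=> m n mn.
  have /filter_ex [x [/= xm xn]] : F ([set x | N (x - (c m)%:R) <= p%:R ^- m]
      `&` [set x | N (x - (c n)%:R) <= p%:R ^- n]).
    exact: filterI (Fc m) (Fc n).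
  have nm : (p%:R : rat) ^- n <= p%:R ^- m.
    rewrite lef_pV2 ?posrE ?pexpr_gt0 // ler_weXn2l // ler1n prime_gt0 //.
  have [|] := leqP (c n) (c m) => [cc|/ltnW cc].
    rewrite -natrB // -(padic_norm_nat p_pr) natrB //.
    rewrite (_ : _ - _ = (x - (c n)%:R) - (x - (c m)%:R)); last by ring.
    by rewrite (le_trans (padic_norm_maxB _ _)) // ge_max xm (le_trans xn).
  rewrite -rat_pnormN opprB -natrB // -(padic_norm_nat p_pr) natrB //.
  rewrite (_ : _ - _ = (x - (c m)%:R) - (x - (c n)%:R)); last by ring.
  by rewrite (le_trans (padic_norm_maxB _ _)) // ge_max xm (le_trans xn).
exists l => A /padic_ballP [e e0 eA].
have [n hn] := archi_exp pV1 e0; rewrite exprVn in hn.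
apply: filterS (Fc n) => x /= xn; apply: eA; apply: le_lt_trans hn.
rewrite -[x](subrK (c n)%:R) -addrA.
apply: le_trans (padic_norm_ultra _ _) _; rewrite ge_max xn /=.
by rewrite -padic_normN opprB.
Qed.

Lemma padic_scale_cvg (F : set_system K) (a l : K) : Filter F -> F --> l ->
  (fun x => a * x) @ F --> a * l.
Proof.
move=> FF Fl A /padic_ballP[e e0 eA].
have [a0|a0] := eqVneq a 0.
  change (F ((fun x => a * x) @^-1` A)).
  apply: filterS filterT => x _; apply: eA.
  by rewrite a0 !mul0r subr0 padic_norm0.
have Na : 0 < N a by rewrite lt_neqAle padic_norm_ge0 eq_sym padic_norm_eq0 a0.
have : nbhs l [set x | N (x - l) < e / N a].
  by apply/padic_ballP; exists (e / N a) => //; rewrite divr_gt0.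
move=> /Fl h; change (F ((fun x => a * x) @^-1` A)).
apply: filterS h => x /= xl; apply: eA.
by rewrite -mulrBr padic_normM mulrC -ltr_pdivlMr.
Qed.

Lemma padic_unorm : unorm N.
Proof.
split.
- exact: padic_norm_ge0.
- by move=> x /eqP; rewrite padic_norm_eq0 => /eqP.
- exact: padic_norm0.
- exact: padic_norm_maxB.
- exact: padic_ballP.
- move=> r; rewrite compact_ultra => F FU Fr.
  have r1 : 0 < `|r| + 1 by rewrite ltr_wpDl.
  have r1' : 0 < (`|r| + 1)^-1 by rewrite invr_gt0.
  have [k hk] := archi_exp pV1 r1'.
  have {}hk : (p%:R^-1) ^+ k * r <= 1 :> rat.
    have r0 : 0 <= p%:R^-1 ^+ k :> rat by rewrite exprn_ge0 // invr_ge0 ler0n.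
    move: hk; rewrite -(ltr_pM2r r1) mulVf ?gt_eqF // => /ltW; apply: le_trans.
    by rewrite ler_wpM2l // (le_trans (ler_norm _)) // lerDl.
  (* Multiplication by p^k carries the ball of radius [r] into Z_p; the limit found there is carried
     back. *)
  pose a : K := p%:R ^+ k; have a0 : a != 0 by rewrite expf_neq0 // padic_p_neq0.
  have [|l Fl] := @padic_int_ultra ((fun x => a * x) @ F) (ultra_fmap _ FU).
    change (F ((fun x => a * x) @^-1` [set x | N x <= 1])).
    apply: filterS Fr => x /= xr; rewrite padic_normM padic_normX padic_norm_p.
    by apply: le_trans hk; rewrite ler_wpM2l // exprn_ge0 // invr_ge0 ler0n.
  have Fl' : F --> a^-1 * l.
    move=> A /(padic_scale_cvg (a := a^-1) _ Fl) h.
    have {}h : F ((fun x => a * x) @^-1` ((fun x => a^-1 * x) @^-1` A)) by exact: h.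
    by apply: filterS h => x /=; rewrite mulKf.
  (* If the limit had norm above [r], a point of the ball close to it would violate the ultrametric
     inequality. *)
  exists (a^-1 * l); split=> //=; rewrite leNgt; apply/negP => lt.
  have : nbhs (a^-1 * l) [set x | N (x - a^-1 * l) < N (a^-1 * l)].
    apply/padic_ballP; exists (N (a^-1 * l)) => //; rewrite lt_neqAle padic_norm_ge0.
    rewrite andbT eq_sym; apply/eqP => Nl.
    have /filter_ex[x /= xr] := Fr.
    by have := le_lt_trans xr lt; rewrite Nl ltNge padic_norm_ge0.
  move=> /Fl' /(filterI Fr)/filter_ex[x [/= xr xl]].
  have := padic_norm_maxB x (x - a^-1 * l); rewrite opprB addrC subrK leNgt.
  by rewrite gt_max xl (le_lt_trans xr).
Qed.

Lemma padic_padic_normed : padic_normed p N.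
Proof.
split; [exact: padic_unorm|exact: padic_norm_mulrn|].
by move=> k x k0; exists (x / k%:R); rewrite -(mulr_natr (x / k%:R)) divfK // padic_nat_neq0.
Qed.

End PadicInstance.

(** * Maximum norms on finite products *)

Section MaxNorm.
Variable n : nat.
Implicit Types F : 'I_n -> rat.

Definition max_norm F : rat := \big[Num.max/0]_(i < n) F i.

Lemma max_norm_ge0 F : 0 <= max_norm F.
Proof. exact: bigmax_ge_id. Qed.

Lemma le_max_norm F i : F i <= max_norm F.
Proof. exact: (le_bigmax 0 F i). Qed.

Lemma max_norm_le F e : 0 <= e -> (forall i, F i <= e) -> max_norm F <= e.
Proof. by move=> e0 h; apply/bigmax_leP; split=> // i _. Qed.

Lemma max_norm_lt F e : 0 < e -> (forall i, F i < e) -> max_norm F < e.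
Proof. by move=> e0 h; apply/bigmax_ltP; split=> // i _. Qed.

Lemma max_norm_scale F c : 0 <= c -> max_norm (fun i => c * F i) = c * max_norm F.
Proof.
move=> c0; apply/esym/(big_morph (fun x => c * x)); last exact: mulr0.
by move=> x y; rewrite maxr_pMr.
Qed.

Lemma eq_max_norm F F' : F =1 F' -> max_norm F = max_norm F'.
Proof. by move=> FF'; apply: eq_bigr. Qed.

End MaxNorm.

Section PadicSpaceInstance.
Variables (p : nat) (p_pr : prime p) (m : nat).
Local Notation K := (padic p_pr).
Local Notation V := (padic_space p_pr m).
Local Notation N := (@padic_norm p p_pr).

Definition vec_norm (x : 'rV[K]_m) : rat := max_norm (fun j => N (x ord0 j)).

Lemma vec_norm_unorm : unorm (vec_norm : V -> rat).
Proof.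
have Ku := padic_unorm p_pr.
split.
- by move=> x; exact: max_norm_ge0.
- move=> x x0; apply/rowP => j; rewrite mxE; apply: (un_eq0 Ku); apply/eqP.
  by rewrite eq_le padic_norm_ge0 andbT -x0 (le_max_norm (fun j => N (x ord0 j))).
- apply/eqP; rewrite eq_le max_norm_ge0 andbT max_norm_le // => j.
  by rewrite mxE padic_norm0.
- move=> x y; apply: max_norm_le => [|j]; first by rewrite le_max max_norm_ge0.
  rewrite !mxE; apply: le_trans (padic_norm_maxB _ _) _.
  by rewrite ge_max !le_max (le_max_norm (fun j => N (x ord0 j)))
    (le_max_norm (fun j => N (y ord0 j))) orbT.
- move=> x A; split=> [[P nP PA]|[e e0 eA]].
    have /choice[d hd] : forall j, exists e : rat, 0 < e /\
        forall y, N (y - x ord0 j) < e -> P ord0 j y.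
      by move=> j; have /padic_ballP[e e0 h] := nP ord0 j; exists e.
    pose e : rat := \big[Num.min/1]_(j < m) d j.
    exists e; first by apply/bigmin_gtP; split=> // j _; have [] := hd j.
    move=> y ye; apply: PA => i j; rewrite ord1; have [_ h] := hd j; apply: h.
    apply: lt_le_trans (_ : e <= d j); last exact: bigmin_le.
    apply: le_lt_trans ye; have := le_max_norm (fun j => N ((y - x) ord0 j)) j.
    by rewrite /= !mxE.
  exists (fun i j => [set y | N (y - x i j) < e]).
    by move=> i j; apply/padic_ballP; exists e.
  move=> y h; apply: eA; apply: max_norm_lt => // j; rewrite !mxE; exact: h.
- move=> r; rewrite compact_ultra => F FU Fr.
  have /choice[l hl] : forall j, exists l : K, N l <= r /\ (fun x : V => x ord0 j) @ F --> l.
    move=> j; have := @un_compact _ _ Ku r; rewrite compact_ultra.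
    move=> /(_ _ (ultra_fmap (fun x : V => x ord0 j) FU)).
    case; last by move=> l [lr Fl]; exists l.
    change (F ((fun x : V => x ord0 j) @^-1` [set y | N y <= r])).
    apply: filterS Fr => x /= xr; apply: le_trans xr.
    exact: (le_max_norm (fun j => N (x ord0 j))).
  exists (\row_j l j); split.
    have /filter_ex[x /= xr] := Fr.
    apply: max_norm_le => [|j]; last by rewrite mxE; have [] := hl j.
    exact: le_trans (max_norm_ge0 _) xr.
  move=> A [P nP PA].
  have FP (j : 'I_m) : F [set x : V | P ord0 j (x ord0 j)].
    by have [_] := hl j; apply; have := nP ord0 j; rewrite mxE.
  apply: filterS (filter_forall _ FP) => x /= h; apply: PA => i j.
  by rewrite ord1.
Qed.

Lemma vec_norm_padic_normed : padic_normed p (vec_norm : V -> rat).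
Proof.
split; first exact: vec_norm_unorm.
  move=> x k; rewrite /vec_norm -max_norm_scale ?rat_pnorm_ge0 //.
  by apply: eq_max_norm => j; rewrite mulmxnE padic_norm_mulrn.
move=> k x k0; exists ((k%:R : K)^-1 *: x).
by rewrite -scaler_nat scalerA divff ?scale1r // padic_nat_neq0.
Qed.

Lemma vec_norm_maxD (x y : 'rV[K]_m) : vec_norm (x + y) <= Num.max (vec_norm x) (vec_norm y).
Proof. exact: (un_maxD vec_norm_unorm). Qed.

Lemma vec_norm_maxB (x y : 'rV[K]_m) : vec_norm (x - y) <= Num.max (vec_norm x) (vec_norm y).
Proof. exact: (un_maxB vec_norm_unorm). Qed.

Lemma vec_norm0 : vec_norm 0 = 0.
Proof. exact: (un_0 vec_norm_unorm). Qed.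

Lemma vec_norm_gt0 (x : 'rV[K]_m) : x <> 0 -> 0 < vec_norm x.
Proof. exact: (un_gt0 vec_norm_unorm). Qed.

Lemma vec_normZ (a : K) (x : 'rV[K]_m) : vec_norm (a *: x) = N a * vec_norm x.
Proof.
rewrite /vec_norm -max_norm_scale ?padic_norm_ge0 //; apply: eq_max_norm => j.
by rewrite mxE padic_normM.
Qed.

End PadicSpaceInstance.

Section ProductInstance.
Variables (n : nat) (V : 'I_n -> topologicalZmodType) (Nf : forall i, V i -> rat).
Hypothesis Nfu : forall i, unorm (@Nf i).
Local Notation G := (prod_topology V).

Definition prod_norm (x : G) : rat := max_norm (fun i => Nf (x i)).

Lemma le_prod_norm (x : G) i : Nf (x i) <= prod_norm x.
Proof. exact: (le_max_norm (fun i => Nf (x i))). Qed.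

Lemma prod_norm_unorm : unorm prod_norm.
Proof.
split.
- by move=> x; exact: max_norm_ge0.
- move=> x x0; apply: functional_extensionality_dep => i.
  apply: (un_eq0 (Nfu i)); apply/eqP.
  by rewrite eq_le (un_ge0 (Nfu i)) andbT -x0 le_prod_norm.
- apply/eqP; rewrite eq_le max_norm_ge0 andbT max_norm_le // => i.
  by rewrite (un_0 (Nfu i)).
- move=> x y; apply: max_norm_le => [|i]; first by rewrite le_max max_norm_ge0.
  apply: le_trans (un_maxB (Nfu i) _ _) _.
  by rewrite ge_max !le_max !le_prod_norm orbT.
- move=> x A; split=> [xA|[e e0 eA]].
    (* The filter of norm balls at [x] converges to [x] in every coordinate, hence in the product
       topology; so each neighbourhood of [x] contains a norm ball. *)
    pose F : set_system G := filter_from [set e : rat | 0 < e]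
      (fun e => [set y | prod_norm (y - x) < e]).
    have FF : Filter F.
      apply: filter_from_filter; first by exists 1 => /=.
      move=> e d /= e0 d0; exists (Num.min e d); first by rewrite /= lt_min e0.
      by move=> y /=; rewrite lt_min => /andP[].
    have Fx : F --> x.
      apply/cvg_sup => i B [_ [[C oC <-] Cx] CB].
      have /(un_nbhs (Nfu i))[e e0 eC] : nbhs (x i) C by exact: open_nbhs_nbhs.
      exists e => // y /= ye; apply: CB; apply: eC.
      exact: le_lt_trans (le_prod_norm (y - x) i) ye.
    by have [e e0 h] := Fx _ xA; exists e.
  have H : nbhs x [set y : G | forall i, Nf (y i - x i) < e].
    have h i : nbhs x [set y : G | Nf (y i - x i) < e].
      exact: (@proj_continuous {classic 'I_n} V i x _ (un_nbhs_lt (Nfu i) (x i) e0)).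
    exact: (@filter_forall G 'I_n (fun i => [set y : G | Nf (y i - x i) < e]) (nbhs x) _ h).
  by apply: filterS H => y /= h; apply: eA; apply: max_norm_lt.
- move=> r; rewrite compact_ultra => F FU Fr.
  have ex : forall i, exists l : V i, Nf l <= r /\ (fun x : G => x i) @ F --> l.
    move=> i; have := @un_compact _ _ (Nfu i) r; rewrite compact_ultra.
    move=> /(_ _ (ultra_fmap (fun x : G => x i) FU)).
    case; last by move=> l [lr Fl]; exists l.
    change (F ((fun x : G => x i) @^-1` [set y | Nf y <= r])).
    by apply: filterS Fr => x /= xr; apply: le_trans xr; exact: le_prod_norm.
  pose l i := projT1 (cid (ex i)); have hl i := projT2 (cid (ex i)).
  exists l; split.
    have /filter_ex[x /= xr] := Fr.
    apply: max_norm_le => [|j]; last by have [] := hl j.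
    exact: le_trans (max_norm_ge0 _) xr.
  apply/cvg_sup => i B [_ [[C oC <-] Cx] CB].
  apply: filterS CB _; have [_] := hl i; apply; exact: open_nbhs_nbhs.
Qed.

End ProductInstance.

(** * Orbits of automorphisms *)

Section HomeoIter.
Variables (X : topologicalType) (f : homeo X).
Local Notation "f ^[ k ]" := (homeo_iter f k) (at level 2, format "f ^[ k ]").

Lemma homeo_iterS k x : f^[k + 1] x = f (f^[k] x).
Proof.
case: k => [k|[|k]]; first by rewrite -PoszD addn1.
- by rewrite /= homeoVK.
- by rewrite (_ : Negz k.+1 + 1 = Negz k) /= ?homeoVK //; lia.
Qed.

Lemma homeo_iterP k x : f^[k - 1] x = homeo_inv f (f^[k] x).
Proof. by rewrite -[in RHS](subrK 1 k) homeo_iterS homeoK. Qed.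

Lemma homeo_iterD j k x : f^[j + k] x = f^[j] (f^[k] x).
Proof.
elim/int_rec: j => [|j IH|j IH]; first by rewrite add0r.
- have -> : j.+1%:Z + k = (j%:Z + k) + 1 by lia.
  by rewrite homeo_iterS IH.
- have -> : - j.+1%:Z + k = (- j%:Z + k) - 1 by lia.
  have -> : - j.+1%:Z = - j%:Z - 1 by lia.
  by rewrite !homeo_iterP IH.
Qed.

Lemma homeo_iterK k : cancel f^[k] f^[- k].
Proof. by move=> x; rewrite -homeo_iterD addNr. Qed.

Lemma homeo_iterNK k : cancel f^[- k] f^[k].
Proof. by move=> x; rewrite -homeo_iterD subrr. Qed.

Lemma homeo_iter_continuous k : continuous f^[k].
Proof.
elim/int_rec: k => [|k IH|k IH]; first by move=> x; exact: cvg_id.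
- have -> : homeo_iter f k.+1 = f \o homeo_iter f k by [].
  by move=> x; apply: continuous_comp; [exact: IH|exact: homeo_continuous].
- have -> : homeo_iter f (- k.+1%:Z) = homeo_inv f \o homeo_iter f (- k%:Z).
    apply/funext => x; have -> : - k.+1%:Z = - k%:Z - 1 by lia.
    by rewrite homeo_iterP.
  by move=> x; apply: continuous_comp; [exact: IH|exact: homeoV_continuous].
Qed.

Lemma homeo_iter_sym k x : homeo_iter (homeo_sym f) k x = f^[- k] x.
Proof.
elim/int_rec: k => [|k IH|k IH] //.
Qed.

End HomeoIter.

Lemma autV_iter (G : topologicalZmodType) (T : top_aut G) k x :
  homeo_iter (autV T) k x = homeo_iter T (- k) x.
Proof. exact: homeo_iter_sym. Qed.

Lemma homeo_iter_zmod_morphism (G : topologicalZmodType) (T : top_aut G) k :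
  zmod_morphism (homeo_iter T k).
Proof.
elim/int_rec: k => [|k IH|k IH] x y; first by [].
- by rewrite [LHS]/= -[iter k T (x - y)]/(homeo_iter T k (x - y)) IH aut_zmod_morphism.
- have E z : homeo_iter T (- k.+1%:Z) z = autV T (homeo_iter T (- k%:Z) z).
    have -> : - k.+1%:Z = - k%:Z - 1 by lia.
    by rewrite homeo_iterP.
  by rewrite !E IH (aut_zmod_morphism (autV T)).
Qed.

Section ZmodMorphism.
Variables (G H : zmodType) (f : G -> H).
Hypothesis fB : zmod_morphism f.

Lemma zmod_morph0 : f 0 = 0.
Proof. by have := fB 0 0; rewrite !subrr. Qed.

Lemma zmod_morphN x : f (- x) = - f x.
Proof. by rewrite -[- x]sub0r fB zmod_morph0 sub0r. Qed.

Lemma zmod_morphD x y : f (x + y) = f x + f y.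
Proof. by rewrite -{1}[y]opprK fB zmod_morphN opprK. Qed.

Lemma zmod_morphMn x k : f (x *+ k) = f x *+ k.
Proof.
by elim: k => [|k IH]; rewrite ?mulr0n ?zmod_morph0 // !mulrS zmod_morphD IH.
Qed.

End ZmodMorphism.

(** Cantor's intersection theorem, the form in which the orbit arguments use compactness. *)
Lemma nested_compact (G : topologicalType) (C : set G) (X : nat -> set G) :
  compact C -> (forall j, closed (X j)) -> (forall j, X j.+1 `<=` X j) ->
  (forall j, X j !=set0) -> X 0%N `<=` C -> exists x, forall j, X j x.
Proof.
move=> Cc Xc Xs Xn XC.
have Xle i j : (i <= j)%N -> X j `<=` X i.
  elim: j => [|j IH]; first by rewrite leqn0 => /eqP->.
  by rewrite leq_eqVlt => /orP[/eqP->//|/IH h]; exact: subset_trans (Xs _) h.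
pose F := filter_from [set: nat] X.
have FF : ProperFilter F.
  apply: filter_from_proper => //; apply: filter_from_filter; first by exists 0%N.
  move=> i j _ _; exists (maxn i j) => // x Xx.
  by split; apply: Xle Xx; rewrite ?leq_maxl ?leq_maxr.
have FC : F C by exists 0%N.
have [x [_ clx]] := Cc _ FF FC; exists x => j; apply: Xc => B xB.
by apply: clx => //; exists j.
Qed.

(** * Willis' tidying argument for the unit ball *)

Section Tidy.
Variables (G : topologicalZmodType) (N : G -> rat) (T : top_aut G).
Hypothesis Nu : unorm N.
Local Notation T_ k := (homeo_iter T k).

(** With L the unit ball, a compact open subgroup, this is the intersection of the T^-k L over the
    times k in [P]; the two half-lines of times give the L_+ and L_- of Willis' theory. *)
Definition bounded_on (P : int -> Prop) : set G :=
  [set x | forall k, P k -> N (T_ k x) <= 1].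

Lemma bounded_on0 P : bounded_on P 0.
Proof.
by move=> k _; rewrite (zmod_morph0 (homeo_iter_zmod_morphism T k)) un_0.
Qed.

Lemma bounded_onB P x y : bounded_on P x -> bounded_on P y -> bounded_on P (x - y).
Proof.
by move=> hx hy k Pk; rewrite homeo_iter_zmod_morphism un_leB // ?hx ?hy.
Qed.

Lemma bounded_onD P x y : bounded_on P x -> bounded_on P y -> bounded_on P (x + y).
Proof.
move=> hx hy; rewrite -[y]opprK; apply: bounded_onB => //.
by rewrite -[- y]sub0r; apply: bounded_onB => //; exact: bounded_on0.
Qed.

Lemma bounded_on_sub (P Q : int -> Prop) : (forall k, Q k -> P k) ->
  bounded_on P `<=` bounded_on Q.
Proof. by move=> QP x h k /QP; exact: h. Qed.

Lemma homeo_iter_un k e : 0 < e ->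
  exists2 d : rat, 0 < d & forall x, N x < d -> N (T_ k x) < e.
Proof.
move=> e0; have := @homeo_iter_continuous _ T k.
move=> /(un_continuousP Nu Nu (homeo_iter_zmod_morphism T k)).
exact.
Qed.

Lemma bounded_on_closed P : closed (bounded_on P).
Proof.
apply/(un_closedP Nu) => x h k Pk.
have [d d0 hd] := homeo_iter_un k ltr01; have [y yP yx] := h _ d0.
rewrite -[x](subKr y) homeo_iter_zmod_morphism un_leB //; first exact: yP.
by rewrite ltW // hd.
Qed.

Lemma bounded_on_shift (P Q : int -> Prop) j x : (forall k, Q k -> P (k + j)) ->
  bounded_on P x -> bounded_on Q (T_ j x).
Proof. by move=> QP xP k /QP; rewrite -homeo_iterD; exact: xP. Qed.

Lemma bounded_on_nbhs (n : nat) : exists2 e : rat, 0 < e &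
  forall x, N x < e -> bounded_on (fun k => - n%:Z <= k <= 0) x.
Proof.
elim: n => [|n [e e0 he]].
  exists 1 => // x x1 k; rewrite oppr0 -eq_le => /eqP <-; exact: ltW.
have [d d0 hd] := homeo_iter_un (- n.+1%:Z) ltr01.
exists (Num.min e d); first by rewrite lt_min e0.
move=> x; rewrite lt_min => /andP[xe xd] k /andP[k1 k2].
have [->|kn] := eqVneq k (- n.+1%:Z); first by rewrite ltW // hd.
by apply: he => //; apply/andP; split=> //; lia.
Qed.

(* Writing [L I] for [bounded_on I], the sum [J] of [L ]-oo, 0]] and [L [0, 1]]
   is open, so by compactness the decreasing sequence [L [-n, 0]], whose
   intersection [L ]-oo, 0]] lies in [J], is eventually contained in [J]. *)
Lemma bounded_on_split1 : exists n0 : nat, forall (n : nat) x, (n0 <= n)%N ->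
  bounded_on (fun k => - n%:Z <= k <= 0) x -> exists y z, [/\ x = y + z,
    bounded_on (fun k => k <= 0) y & bounded_on (fun k => - n%:Z <= k <= 1) z].
Proof.
pose J := [set x | exists y z, [/\ x = y + z,
    bounded_on (fun k => k <= 0) y & bounded_on (fun k => 0 <= k <= 1) z]].
have [e e0 he] : exists2 e : rat, 0 < e &
    forall x, N x < e -> bounded_on (fun k => 0 <= k <= 1) x.
  have [d d0 hd] := homeo_iter_un 1 ltr01; exists (Num.min 1 d).
    by rewrite lt_min ltr01.
  move=> x; rewrite lt_min => /andP[x1 xd] k /andP[k0 k1].
  have [->|->] : k = 0 \/ k = 1 by lia.
    exact: ltW.
  by rewrite ltW // hd.
(* [J] is a union of cosets of L [0, 1], and this subgroup contains a ball. *)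
have Jo : open J.
  apply/(un_openP Nu) => x [y [z [-> yP zP]]]; exists e => // x' hx'.
  exists y, (x' - y); split=> //; first by rewrite addrC subrK.
  have -> : x' - y = z + (x' - (y + z)) by rewrite [RHS]addrC opprD addrA subrK.
  by apply: bounded_onD => //; exact: he.
have [n0 hn0] : exists n0 : nat, forall x, bounded_on (fun k => - n0%:Z <= k <= 0) x -> J x.
  apply: contrapT => /forallNP nJ.
  have [|||j||x hx] := @nested_compact G [set x | N x <= 1]
    (fun n => bounded_on (fun k => - n%:Z <= k <= 0) `\` J).
  - exact: un_compact.
  - move=> j; rewrite setDE; apply: closedI; first exact: bounded_on_closed.
    exact: open_closedC.
  - move=> j x [hx nx]; split=> //; apply: bounded_on_sub hx => k /andP[k1 k2].
    by apply/andP; split=> //; lia.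
  - by have /existsNP[x /not_implyP[h1 h2]] := nJ j; exists x.
  - by move=> x [hx _] /=; exact: (hx 0).
  have [_] := hx 0%N; apply; exists x, 0; split; rewrite ?addr0 //; last exact: bounded_on0.
  move=> k k0; have [h _] := hx `|k|%N; apply: h; lia.
exists n0 => n x n0n hx.
have [|y [z [xyz yP zP]]] := hn0 x.
  by apply: bounded_on_sub hx => k /andP[k1 k2]; apply/andP; split=> //; lia.
(* So far [z] is controlled at the times 0 and 1 only; at negative times it is the difference of [x]
   and [y], both controlled there. *)
exists y, z; split=> // k /andP[k1 k2].
have [k0|k0] := leP 0 k; first by apply: zP; rewrite k0.
have -> : z = x - y by rewrite xyz addrC addKr.
have {k2 zP}k0 := ltW k0.
apply: (bounded_onB (P := fun k => - n%:Z <= k <= 0)) => //; last by rewrite k1.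
by move=> i /andP[_]; exact: yP.
Qed.

(** The time interval of [z] grows to the right by one step at a time: the one-step splitting is
    applied to T^j z with n + j in place of n, which is why it had to hold for all large n with the
    same threshold. The summands change with j; compactness supplies a [z] that is good for all
    j. *)
Lemma bounded_on_split : exists n : nat, forall x,
  bounded_on (fun k => - n%:Z <= k <= 0) x -> exists y z, [/\ x = y + z,
    bounded_on (fun k => k <= 0) y & bounded_on (fun k => - n%:Z <= k) z].
Proof.
have [n hn] := bounded_on_split1; exists n => x xn.
have step j : exists y z, [/\ x = y + z,
    bounded_on (fun k => k <= 0) y & bounded_on (fun k => - n%:Z <= k <= j%:Z) z].
  elim: j => [|j [y [z [xyz yP zP]]]].
    by exists 0, x; split; rewrite ?add0r //; exact: bounded_on0.
  have [||y' [z' [E yP' zP']]] := hn (n + j)%N (T_ j z) _ _; first exact: leq_addr.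
    by apply: bounded_on_shift zP => k /andP[k1 k2]; apply/andP; split; lia.
  exists (y + T_ (- j%:Z) y'), (T_ (- j%:Z) z'); split.
  - rewrite -addrA -(zmod_morphD (homeo_iter_zmod_morphism T _)) -E homeo_iterK.
    exact: xyz.
  - apply: bounded_onD => //; apply: bounded_on_shift yP' => k; lia.
  - by apply: bounded_on_shift zP' => k /andP[k1 k2]; apply/andP; split; lia.
have [|||j||z hz] := @nested_compact G [set x | N x <= 1]
    (fun j => bounded_on (fun k => - n%:Z <= k <= j%:Z) `&`
      [set z | bounded_on (fun k => k <= 0) (x - z)]).
- exact: un_compact.
- move=> j; apply: closedI; first exact: bounded_on_closed.
  apply/(un_closedP Nu) => z h /=; move: (@bounded_on_closed (fun k => k <= 0)).
  move=> /(un_closedP Nu); apply => e /h[y /= hy yz]; exists (x - y) => //.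
  by rewrite opprB addrC addrA subrK un_dist.
- move=> j z [z1 z2]; split=> //; apply: bounded_on_sub z1 => k /andP[k1 k2].
  by rewrite k1 /=; lia.
- have [y [z [E yP zP]]] := step j; exists z; split=> //=.
  by rewrite E addrK.
- by move=> z [h _]; apply: (h 0); rewrite lexx andbT; lia.
exists (x - z), z; split; first by rewrite subrK.
  by have [_] := hz 0%N.
by move=> k k1; have [h _] := hz `|k|%N; apply: h; rewrite k1 /=; lia.
Qed.

Lemma tidy_split : exists2 e : rat, 0 < e & forall x, N x < e ->
  exists y z, [/\ x = y + z, bounded_on (fun k => k <= 0) y
                & bounded_on (fun k => 0 <= k) z].
Proof.
have [n hn] := bounded_on_split; have [e e0 he] := bounded_on_nbhs n.
exists e => // x /he/hn[y [z [E yP zP]]]; exists y, z; split=> //.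
by apply: bounded_on_sub zP => k; lia.
Qed.

End Tidy.

(** * The Chabauty topology *)

Section Chabauty.
Variables (G : topologicalZmodType) (N : G -> rat).
Hypothesis Nu : unorm N.
Local Notation X := (closed_subgroup G).
Implicit Types A B C : X.

Lemma chabauty_cvg (F : set_system X) A : Filter F ->
  (forall S, chabauty_subbase S -> S A -> F S) -> F --> A.
Proof.
move=> FF h S [_ [[D sD <-] [C DC CA] CS]].
have [E sE EC] := sD _ DC; subst C.
apply: (@filterS _ F _ (\bigcap_(i in [set` E]) i)).
  by move=> B EB; apply: CS; exists (\bigcap_(i in [set` E]) i).
apply: filter_bigI => U EU; apply: h; last exact: CA.
exact/set_mem/sE.
Qed.

(** One parameter gives both the radius of the window and, inverted, the precision. *)
Definition sub_close (n : nat) (A B : set G) :=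
  forall x, A x -> N x <= n.+1%:R -> exists2 y, B y & N (y - x) <= n.+1%:R^-1.

(* The entourages of the Chabauty uniformity. *)
Definition near_sub (n : nat) (A B : set G) := sub_close n A B /\ sub_close n B A.

Let inv_le (n : nat) : n.+1%:R^-1 <= n.+1%:R :> rat.
Proof. by rewrite (@le_trans _ _ 1) ?invf_le1 ?ler1n. Qed.

Lemma near_sub_refl n (A : set G) : near_sub n A A.
Proof. by split=> x Ax _; exists x => //; rewrite subrr un_0 // invr_ge0. Qed.

Lemma near_sub_sym n (A B : set G) : near_sub n A B -> near_sub n B A.
Proof. by case. Qed.

(** There is no loss in [n]: the norm is ultrametric, and a move by at most 1/(n+1) does not leave
    the ball of radius n+1. So each [near_sub n] is an equivalence relation. *)
Lemma near_sub_trans n (A B C : set G) : near_sub n A B -> near_sub n B C -> near_sub n A C.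
Proof.
have th (A' B' C' : set G) : sub_close n A' B' -> sub_close n B' C' -> sub_close n A' C'.
  move=> h1 h2 x Ax xn; have [y By yx] := h1 x Ax xn.
  have [|z Cz zy] := h2 y By.
    by rewrite -(subrK x y) un_leD // (le_trans yx (inv_le n)).
  by exists z => //; rewrite -(subrK y z) -addrA un_leD.
by move=> [h1 h2] [h3 h4]; split; [exact: th h1 h3|exact: th h4 h2].
Qed.

Lemma near_sub_le m n (A B : set G) : (m <= n)%N -> near_sub n A B -> near_sub m A B.
Proof.
move=> mn; have th (A' B' : set G) : sub_close n A' B' -> sub_close m A' B'.
  move=> h x Ax xm; have [|y By yx] := h x Ax.
    by rewrite (le_trans xm) // ler_nat.
  by exists y => //; rewrite (le_trans yx) // lef_pV2 ?posrE // ler_nat.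
by move=> [h1 h2]; split; exact: th.
Qed.

Lemma near_sub_eq A B : (forall n, near_sub n A B) -> A = B.
Proof.
have th (A' B' : X) : (forall n, sub_close n A' B') -> A' `<=` B'.
  move=> h x Ax; have /(un_closedP Nu) := @csub_closed G B'; apply => e e0.
  have [n hn] := archi_inv e0; pose k := maxn n (Num.bound (N x)).
  have [|y By yx] := h k x Ax.
    rewrite ltW // (lt_le_trans (archi_boundP (un_ge0 Nu x))) // ler_nat.
    by rewrite (leq_trans (leq_maxr _ _) (leqnSn _)).
  exists y => //; apply: le_lt_trans yx _; apply: le_lt_trans hn.
  by rewrite lef_pV2 ?posrE // ler_nat ltnS leq_maxl.
move=> h; apply: csub_inj; apply/seteqP; split; apply: th => n; by have [] := h n.
Qed.

Lemma chabauty_meet_nbhs A (U : set G) : open U -> (A : set G) `&` U !=set0 ->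
  nbhs A [set B : X | (B : set G) `&` U !=set0].
Proof. by move=> oU AU; apply: chabauty_subbase_nbhs => //; right; exists U. Qed.

Lemma chabauty_miss_nbhs A (K : set G) : compact K -> (A : set G) `&` K = set0 ->
  nbhs A [set B : X | (B : set G) `&` K = set0].
Proof. by move=> cK AK; apply: chabauty_subbase_nbhs => //; left; exists K. Qed.

Lemma un_ball_open (x : G) (r : rat) : open [set y | N (y - x) < r].
Proof.
apply/(un_openP Nu) => y /= yr; exists r => [|z zy].
  exact: le_lt_trans (un_ge0 Nu _) yr.
by rewrite -(subrK y z) -addrA un_ltD.
Qed.

(** The ball of radius n+1 is compact, so conditions near each of its points suffice. At a point of
    [A], B has to meet a small open ball; at a point far from [A], B has to miss a compact ball.
    Both are subbasic. *)
Lemma near_sub_nbhs n A : nbhs A [set B : X | near_sub n A B].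
Proof.
have /compact_near_coveringP Kc : compact [set x | N x <= n.+1%:R] by exact: un_compact.
have e0 : 0 < n.+1%:R^-1 :> rat by rewrite invr_gt0.
have near_le (x : G) : \forall y \near x, N (y - x) <= n.+1%:R^-1.
  by apply: filterS (un_nbhs_lt Nu x e0) => y /= /ltW.
have h1 : nbhs A [set B : X | sub_close n A B].
  pose P (B : X) x := (A : set G) x -> exists2 y, (B : set G) y & N (y - x) <= n.+1%:R^-1.
  have : \forall B \near A, [set x | N x <= n.+1%:R] `<=` P B.
    apply: (Kc X (nbhs A) P) => x _; have [Ax|nAx] := pselect ((A : set G) x).
      exists ([set y | N (y - x) <= n.+1%:R^-1],
              [set B : X | (B : set G) `&` [set y | N (y - x) < n.+1%:R^-1] !=set0]).
        split=> /=; first exact: near_le.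
        apply: chabauty_meet_nbhs; first exact: un_ball_open.
        by exists x; split=> //=; rewrite subrr un_0.
      move=> [x' B] /= [x'x [y [By yx]]] _; exists y => //.
      by rewrite -(subrK x y) -addrA un_leD ?(ltW yx) // un_dist.
    exists (~` (A : set G), setT).
      split; last exact: filterT.
      by apply: open_nbhs_nbhs; split=> //; apply: closed_openC; exact: csub_closed.
    by move=> [x' B] /= [nA _] Ax'; case: nA.
  by apply: filterS => B h x Ax xn; exact: h.
have h2 : nbhs A [set B : X | sub_close n B A].
  pose P (B : X) x := (B : set G) x -> exists2 y, (A : set G) y & N (y - x) <= n.+1%:R^-1.
  have : \forall B \near A, [set x | N x <= n.+1%:R] `<=` P B.
    apply: (Kc X (nbhs A) P) => x _.
    have [[y Ay yx]|nA] := pselect (exists2 y, (A : set G) y & N (y - x) <= n.+1%:R^-1).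
      exists ([set x' | N (x' - x) <= n.+1%:R^-1], setT).
        by split; [exact: near_le|exact: filterT].
      move=> [x' B] /= [x'x _] _; exists y => //.
      by rewrite -(subrK x y) -addrA un_leD // un_dist.
    exists ([set x' | N (x' - x) <= n.+1%:R^-1],
            [set B : X | (B : set G) `&` [set y | N (y - x) <= n.+1%:R^-1] = set0]).
      split=> /=; first exact: near_le.
      apply: chabauty_miss_nbhs; first exact: un_ball_compact.
      by apply/seteqP; split=> // y [Ay yx]; apply: nA; exists y.
    move=> [x' B] /= [x'x B0] Bx'.
    by have : ((B : set G) `&` [set y | N (y - x) <= n.+1%:R^-1]) x' by []; rewrite B0.
  by apply: filterS => B h x Ax xn; exact: h.
exact: filterI h1 h2.
Qed.

Lemma near_sub_base A (S : set X) :
  nbhs A S <-> exists n, forall B, near_sub n A B -> S B.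
Proof.
split=> [|[n h]]; last by apply: filterS (near_sub_nbhs n A).
pose F : set_system X := filter_from [set: nat] (fun n => [set B : X | near_sub n A B]).
have FF : Filter F.
  apply: filter_from_filter; first by exists 0%N.
  move=> i j _ _; exists (maxn i j) => // B h.
  by split; apply: near_sub_le h; rewrite ?leq_maxl ?leq_maxr.
suff FA : F --> A by move=> /FA[n _ h]; exists n.
apply: chabauty_cvg => U [[K cK ->]|[U' oU ->]] /=.
  move=> AK0.
  (* A compact set disjoint from [A] has positive distance from it and is bounded; an index beyond
     both bounds keeps it disjoint from every subgroup near [A]. *)
  have [e e0 he] : exists2 e : rat, 0 < e &
      forall x y, K x -> (A : set G) y -> e <= N (y - x).
    have /compact_near_coveringP Kc := cK.
    have : \forall n \near \oo, K `<=` [set x | forall y, (A : set G) y -> n.+1%:R^-1 <= N (y - x)].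
      apply: Kc => x Kx.
      have nAx : ~ (A : set G) x.
        by move=> Ax; have : ((A : set G) `&` K) x by []; rewrite AK0.
      have /(un_openP Nu)/(_ x nAx)[e e0 he] : open (~` (A : set G)).
        by apply: closed_openC; exact: csub_closed.
      have [n0 hn0] := archi_inv e0.
      exists ([set x' | N (x' - x) < e], [set n | (n0 <= n)%N]).
        by split; [exact: un_nbhs_lt|exists n0].
      move=> [x' n] /= [x'x n0n] y Ay; rewrite leNgt; apply/negP => yx'.
      apply: (he y) => //; rewrite -(subrK x' y) -addrA un_ltD //.
      apply: lt_trans yx' _; apply: le_lt_trans hn0.
      by rewrite lef_pV2 ?posrE // ler_nat ltnS.
    move=> [n _ /(_ n (leqnn n)) h]; exists n.+1%:R^-1; first by rewrite invr_gt0.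
    by move=> x y Kx; exact: h.
  have [M hM] : exists M : nat, forall x, K x -> N x <= M%:R.
    have /compact_near_coveringP Kc := cK.
    have : \forall n \near \oo, K `<=` [set x | N x <= n%:R].
      apply: Kc => x Kx.
      exists ([set x' | N (x' - x) < 1], [set n | (Num.bound (N x) + 1 <= n)%N]).
        by split; [exact: un_nbhs_lt|exists (Num.bound (N x) + 1)%N].
      move=> [x' n] /= [x'x nx]; rewrite -(subrK x x') un_leD //.
        by rewrite ltW // (lt_le_trans x'x) // ler1n (leq_trans _ nx) // addn1.
      rewrite ltW // (lt_le_trans (archi_boundP (un_ge0 Nu x))) // ler_nat.
      by rewrite (leq_trans _ nx) // leq_addr.
    by move=> [n _ /(_ n (leqnn n)) h]; exists n.
  have [n hn] := archi_inv e0; exists (maxn n M) => // B [_ BA] /=.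
  apply/seteqP; split=> // x [Bx Kx].
  have [|y Ay yx] := BA x Bx.
    by rewrite (le_trans (hM x Kx)) // ler_nat (leq_trans (leq_maxr n M)).
  have := le_trans (he x y Kx Ay) yx; apply/negP; rewrite -ltNge.
  by apply: le_lt_trans hn; rewrite lef_pV2 ?posrE // ler_nat ltnS leq_maxl.
move=> [x [Ax Ux]]; have [e e0 he] := (un_openP Nu U').1 oU x Ux.
have [n hn] := archi_inv e0; pose k := maxn n (Num.bound (N x)).
exists k => // B [AB _] /=; have [|y By yx] := AB x Ax.
  rewrite ltW // (lt_le_trans (archi_boundP (un_ge0 Nu x))) // ler_nat.
  by rewrite (leq_trans (leq_maxr _ _) (leqnSn _)).
exists y; split=> //; apply: he; apply: le_lt_trans yx _; apply: le_lt_trans hn.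
by rewrite lef_pV2 ?posrE // ler_nat ltnS leq_maxl.
Qed.

(** The limit of an ultrafilter of subgroups is the set of points that its members approach. A
    compact set that misses the limit is missed by almost all members, by a covering argument. *)
Lemma chabauty_compact : compact [set: X].
Proof.
rewrite compact_ultra => F FU _.
pose L : set G := [set x | forall e : rat, 0 < e ->
  F [set B : X | exists2 y, (B : set G) y & N (y - x) < e]].
have Lc : closed L.
  apply/(un_closedP Nu) => x h e e0; have [y Ly yx] := h e e0.
  apply: filterS (Ly e e0) => B [z Bz zy]; exists z => //.
  by rewrite -(subrK y z) -addrA un_ltD.
have Ls : subgroup L.
  split=> [e e0|x y Lx Ly e e0].
    apply: filterS filterT => B _; exists 0; first by have [] := csub_subgroup B.
    by rewrite subrr un_0.
  apply: filterS (filterI (Lx e e0) (Ly e e0)) => B [[x' Bx xx] [y' By yy]].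
  exists (x' - y'); first by have [_] := csub_subgroup B; exact.
  have -> : x' - y' - (x - y) = (x' - x) - (y' - y)
    by rewrite !opprB addrACA [- y' + _]addrC addrACA.
  exact: un_ltB.
exists (ClosedSubgroup Lc Ls); split=> //.
apply: chabauty_cvg => U [[K cK ->]|[U' oU ->]] /=.
  move=> LK; have /compact_near_coveringP Kc := cK.
  have : F [set B : X | K `<=` [set x | ~ (B : set G) x]].
    apply: (Kc X F (fun B x => ~ (B : set G) x)) => x Kx.
    have /existsNP[e /not_implyP[e0 nF]] : ~ L x.
      by move=> Lx; have : (L `&` K) x by []; rewrite LK.
    exists ([set x' | N (x' - x) < e],
            ~` [set B : X | exists2 y, (B : set G) y & N (y - x) < e]).
      split; first exact: un_nbhs_lt.
      by have [] := in_ultra_setVsetC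
        [set B : X | exists2 y, (B : set G) y & N (y - x) < e] FU.
    by move=> [x' B] /= [x'x h] Bx'; apply: h; exists x'.
  by apply: filterS => B h; apply/seteqP; split=> // x [Bx /h].
move=> [x [Lx Ux]]; have [e e0 he] := (un_openP Nu U').1 oU x Ux.
by apply: filterS (Lx e e0) => B [y By yx]; exists y; split=> //; exact: he.
Qed.

End Chabauty.

(** * The metric of a decreasing sequence of equivalence relations *)

Section FiltrationMetric.
Variables (R : realType) (X : topologicalType) (E : nat -> X -> X -> Prop).
Hypotheses (Exx : forall n x, E n x x) (Esym : forall n x y, E n x y -> E n y x)
  (Etrans : forall n x y z, E n x y -> E n y z -> E n x z)
  (Ele : forall m n x y, (m <= n)%N -> E n x y -> E m x y)
  (Eeq : forall x y, (forall n, E n x y) -> x = y)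
  (Enbhs : forall x (S : set X), nbhs x S <-> exists n, forall y, E n x y -> S y).

Let sepP x y : ~ (forall n, E n x y) -> exists n, ~~ `[< E n x y >].
Proof. by move=> /existsNP[n h]; exists n; apply/asboolPn. Qed.

(** The value is 1/(k+1) for the first k at which [E k] separates the points, so being below 1/(n+1)
    means exactly [E n], and transitivity of the relations yields the triangle inequality. *)
Definition filtration_dist x y : R :=
  if pselect (forall n, E n x y) is right h then (ex_minn (sepP h)).+1%:R^-1 else 0.

Lemma filtration_dist_lt n x y : (filtration_dist x y < n.+1%:R^-1) <-> E n x y.
Proof.
rewrite /filtration_dist; case: pselect => [h|h].
  by split=> // _; rewrite invr_gt0.
case: ex_minnP => k /asboolPn nE kmin; rewrite ltf_pV2 ?posrE // ltr_nat ltnS.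
split=> [nk|En]; last first.
  by rewrite ltnNge; apply/negP => kn; apply: nE; exact: Ele En.
by apply: contrapT => /asboolPn /kmin; rewrite leqNgt nk.
Qed.

Lemma filtration_dist_ge0 x y : 0 <= filtration_dist x y.
Proof. by rewrite /filtration_dist; case: pselect => // h; rewrite invr_ge0. Qed.

Lemma filtration_dist_val x y : filtration_dist x y = 0 \/
  exists n, filtration_dist x y = n.+1%:R^-1.
Proof.
by rewrite /filtration_dist; case: pselect => h; [left|right; exists (ex_minn (sepP h))].
Qed.

Lemma filtration_dist_le x y z w :
  (forall n, E n z w -> E n x y) -> filtration_dist x y <= filtration_dist z w.
Proof.
move=> h; have [->|[n En]] := filtration_dist_val x y; first exact: filtration_dist_ge0.
rewrite leNgt; apply/negP; rewrite En => /filtration_dist_lt/h/filtration_dist_lt.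
by rewrite En ltxx.
Qed.

Lemma filtration_dist_metric : is_metric filtration_dist.
Proof.
split=> [x y|x y|x y z].
- split=> [d0|->]; last by rewrite /filtration_dist; case: pselect.
  by apply: Eeq => n; apply/filtration_dist_lt; rewrite d0 invr_gt0.
- by apply/eqP; rewrite eq_le; apply/andP; split; apply: filtration_dist_le => n; exact: Esym.
- apply: (@le_trans _ _ (Num.max (filtration_dist x y) (filtration_dist y z))).
    have [->|[n En]] := filtration_dist_val x z.
      by rewrite le_max filtration_dist_ge0.
    rewrite leNgt gt_max; apply/negP; rewrite En.
    move=> /andP[/filtration_dist_lt xy /filtration_dist_lt yz].
    by have /filtration_dist_lt := Etrans xy yz; rewrite En ltxx.
  by rewrite ge_max lerDl lerDr !filtration_dist_ge0.
Qed.

Lemma filtration_dist_topology : induces_topology filtration_dist.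
Proof.
move=> x; apply/seteqP; split=> S.
  move=> /Enbhs[n h]; exists n.+1%:R^-1 => /=; first by rewrite invr_gt0.
  by move=> y /filtration_dist_lt; exact: h.
move=> [e /= e0 h]; apply/Enbhs.
pose n := Num.bound e^-1; exists n => y /filtration_dist_lt xy; apply: h => /=.
apply: lt_trans xy _; rewrite -[X in _ < X]invrK ltf_pV2 ?posrE ?invr_gt0 //.
by rewrite (lt_le_trans (archi_boundP _)) ?invr_ge0 ?ltW // ltr_nat.
Qed.

(** A Lebesgue number argument: on a compact space the filtration controls every compatible metric
    uniformly, which allows an arbitrary metric to be discarded. *)
Lemma filtration_uniform (d : X -> X -> R) (e : R) : compact [set: X] ->
  is_metric d -> induces_topology d -> 0 < e ->
  exists n, forall x y, E n x y -> d x y < e.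
Proof.
move=> /compact_near_coveringP Xc [_ dsym dtri] dtop e0.
have e2 : 0 < e / 2 by rewrite divr_gt0.
have : \forall n \near \oo, [set: X] `<=` [set x | forall y, E n x y -> d x y < e].
  apply: (Xc nat \oo (fun n x => forall y, E n x y -> d x y < e)) => x _.
  have : nbhs x [set y | d x y < e / 2] by rewrite dtop; exists (e / 2).
  move=> /Enbhs[n0 h].
  exists ([set x' | E n0 x x'], [set n | (n0 <= n)%N]) => /=.
    by split; [apply/Enbhs; exists n0|exists n0].
  move=> [x' n] /= [xx' n0n] y x'y; apply: le_lt_trans (dtri x' x y) _.
  have xy : E n0 x y by apply: Etrans xx' _; exact: Ele x'y.
  by rewrite [e]splitr ltrD // ?h // dsym h.
by move=> [n _ /(_ n (leqnn n)) h]; exists n => x y; exact: h.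
Qed.

End FiltrationMetric.

(** * Expansiveness on Sub_G without a metric *)

Section ExpansiveSub.
Variables (R : realType) (G : topologicalZmodType) (N : G -> rat) (T : top_aut G).
Hypothesis Nu : unorm N.
Local Notation X := (closed_subgroup G).
Local Notation T_ k := (homeo_iter T k).

Lemma sub_actionE k (A : X) : (homeo_iter (sub_action T) k A : set G) = T_ k @` (A : set G).
Proof.
elim/int_rec: k => [|k IH|k IH]; first by rewrite image_id.
- have -> : k.+1%:Z = k%:Z + 1 by lia.
  rewrite homeo_iterS.
  change (T @` (homeo_iter (sub_action T) k A : set G) = T_ (k%:Z + 1) @` (A : set G)).
  rewrite IH image_comp; congr (_ @` _); apply/funext => x.
  exact: esym (homeo_iterS T k x).
- have -> : - k.+1%:Z = - k%:Z - 1 by lia.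
  rewrite homeo_iterP.
  change (autV T @` (homeo_iter (sub_action T) (- k%:Z) A : set G) =
    T_ (- k%:Z - 1) @` (A : set G)).
  rewrite IH image_comp; congr (_ @` _); apply/funext => x.
  exact: esym (homeo_iterP T (- k%:Z) x).
Qed.

Lemma expansive_sub_actionP : expansive_homeo R (sub_action T) <->
  exists n, forall A B : X, A <> B ->
    exists k, ~ near_sub N n (T_ k @` (A : set G)) (T_ k @` (B : set G)).
Proof.
pose E n (A B : X) := near_sub N n A B.
have Exx n A : E n A A := near_sub_refl Nu n A.
have Esym n A B (h : E n A B) : E n B A := near_sub_sym h.
have Etrans n A B C (h1 : E n A B) (h2 : E n B C) : E n A C := near_sub_trans Nu h1 h2.
have Ele m n A B (mn : (m <= n)%N) (h : E n A B) : E m A B := near_sub_le mn h.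
have Eeq A B : (forall n, E n A B) -> A = B := @near_sub_eq G N Nu A B.
have Enbhs A S : nbhs A S <-> exists n, forall B, E n A B -> S B := near_sub_base Nu A S.
split=> [[d [dm dt [e e0 h]]]|[n h]].
  have [n hn] := filtration_uniform Etrans Ele Enbhs (chabauty_compact Nu) dm dt e0.
  exists n => A B /h[k]; rewrite ltNge => /negP hk; exists k => nAB; apply: hk.
  by apply/ltW/hn; rewrite /E !sub_actionE.
exists (@filtration_dist R X E); split.
- exact: filtration_dist_metric.
- exact: filtration_dist_topology.
(* Failure of [near_sub n] gives a distance of at least 1/(n+1); the definition wants a strict
   inequality, hence 1/(n+2). *)
exists n.+2%:R^-1; first by rewrite invr_gt0.
move=> A B /h[k hk]; exists k; rewrite ltNge; apply/negP => le; apply: hk.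
rewrite -!sub_actionE; apply/(filtration_dist_lt R Ele).
by apply: le_lt_trans le _; rewrite ltf_pV2 ?posrE // ltr_nat.
Qed.

End ExpansiveSub.

(** * Contraction groups *)

Section ContractionSplit.
Variables (G : topologicalZmodType) (N : G -> rat) (P : nat).
Hypotheses (Nu : unorm N) (P_le : forall x, N (x *+ P) <= 2^-1 * N x)
  (P_gt0 : (0 < P)%N) (P_ge : forall x, N x <= P%:R * N (x *+ P))
  (P_div : forall x : G, exists y : G, y *+ P = x).

(** In the application [P] is p_1 ... p_n. Its powers contract [G], commute with automorphisms and
    can be undone at a controlled cost, and so replace scalars. *)
Lemma mulrnX_le M x : N (x *+ P ^ M) <= 2^-1 ^+ M * N x.
Proof.
elim: M => [|M IH]; first by rewrite expn0 mulr1n expr0 mul1r.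
rewrite expnSr mulrnA exprS -mulrA; apply: le_trans (P_le _) _.
by rewrite ler_wpM2l // invr_ge0.
Qed.

Lemma mulrnX_ge M x : N x <= P%:R ^+ M * N (x *+ P ^ M).
Proof.
elim: M => [|M IH]; first by rewrite expn0 mulr1n expr0 mul1r.
apply: le_trans IH _; rewrite expnSr mulrnA exprSr -mulrA.
by rewrite ler_wpM2l // exprn_ge0.
Qed.

Lemma mulrnX_div M (x : G) : exists y : G, y *+ P ^ M = x.
Proof.
elim: M x => [|M IH] x; first by exists x; rewrite expn0 mulr1n.
have [y <-] := P_div x; have [z <-] := IH y.
by exists z; rewrite expnSr mulrnA.
Qed.

Lemma mulrnX_inj M : injective (fun x : G => x *+ P ^ M).
Proof.
move=> x y /= /eqP; rewrite -subr_eq0 -mulrnBl => /eqP xy; apply/eqP.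
rewrite -subr_eq0; apply/eqP/(un_eq0 Nu)/eqP; rewrite eq_le un_ge0 // andbT.
by rewrite (le_trans (mulrnX_ge M _)) // xy un_0 // mulr0.
Qed.

Lemma mulrnX_lt (C e : rat) : 0 < e -> exists M, 2^-1 ^+ M * C < e.
Proof.
move=> e0; have C0 : 0 < `|C| + 1 by rewrite ltr_wpDl.
have [M hM] := @archi_exp 2^-1 (e / (`|C| + 1)) isT (divr_gt0 e0 C0); exists M.
rewrite ltr_pdivlMr // in hM; apply: le_lt_trans hM.
by rewrite ler_wpM2l ?exprn_ge0 ?invr_ge0 // (le_trans (ler_norm _)) // lerDl.
Qed.

Section Aut.
Variable T : top_aut G.
Local Notation T_ k := (homeo_iter T k).
Local Notation C_ T := (contraction_group T).

(** A power of [P] moves the bounded orbit into the neighbourhood [U], and multiplication by it is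
    injective. *)
Lemma expansive_bounded : expansive_aut T ->
  forall C x, (forall k, N (T_ k x) <= C) -> x = 0.
Proof.
move=> [U /(un_nbhs0 Nu)[e e0 eU] UT] C x xC.
have [M hM] := mulrnX_lt C e0; apply: (@mulrnX_inj M); rewrite mul0rn.
suff : [set 0] (x *+ P ^ M) by [].
rewrite -UT => k _; exists (T_ (- k) (x *+ P ^ M)); last exact: homeo_iterNK.
apply: eU; rewrite (zmod_morphMn (homeo_iter_zmod_morphism T _)).
apply: le_lt_trans (mulrnX_le _ _) _; apply: le_lt_trans hM.
by rewrite ler_wpM2l // exprn_ge0 // invr_ge0.
Qed.

Lemma contractionP x : C_ T x <->
  forall e : rat, 0 < e -> exists M, forall k : nat, (M <= k)%N -> N (T_ k x) < e.
Proof. exact: un_cvg0P. Qed.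

Lemma contraction_subgroup : subgroup (C_ T).
Proof.
split=> [|x y /contractionP xC /contractionP yC].
  apply/contractionP => e e0; exists 0%N => k _.
  by rewrite (zmod_morph0 (homeo_iter_zmod_morphism T k)) un_0.
apply/contractionP => e e0; have [M1 h1] := xC e e0; have [M2 h2] := yC e e0.
exists (maxn M1 M2) => k; rewrite geq_max => /andP[k1 k2].
by rewrite homeo_iter_zmod_morphism un_ltB // ?h1 ?h2.
Qed.

Lemma contraction_bounded x : C_ T x -> exists C, forall k : nat, N (T_ k x) <= C.
Proof.
move=> /contractionP/(_ 1 ltr01)[M hM].
exists (1 + \sum_(k < M) N (T_ k x)) => k.
have S0 : 0 <= \sum_(k < M) N (T_ k x) by apply: sumr_ge0 => i _; exact: un_ge0.
have [Mk|kM] := leqP M k; first by rewrite (le_trans (ltW (hM k Mk))) // lerDl.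
rewrite (bigD1 (Ordinal kM)) //= addrCA lerDl addr_ge0 // sumr_ge0 // => i _.
exact: un_ge0.
Qed.

Lemma contraction_div M x : C_ T (x *+ P ^ M) -> C_ T x.
Proof.
move=> /contractionP xC; apply/contractionP => e e0.
have P0 : 0 < P%:R :> rat by rewrite ltr0n.
have PM : 0 < P%:R ^+ M :> rat by rewrite exprn_gt0.
have [m hm] := xC (e / P%:R ^+ M) (divr_gt0 e0 PM).
exists m => k /hm; rewrite (zmod_morphMn (homeo_iter_zmod_morphism T _)).
rewrite ltr_pdivlMr // mulrC; apply: le_lt_trans; exact: mulrnX_ge.
Qed.

(** If the sets L [-j, oo[ did not shrink to 0, compactness would give a nonzero point whose whole
    orbit lies in L. For k >= j the point T^k x belongs to L [-j, oo[. *)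
Lemma bounded_contraction : (forall x, (forall k, N (T_ k x) <= 1) -> x = 0) ->
  bounded_on N T (fun k => 0 <= k) `<=` C_ T.
Proof.
move=> T0 x xP; apply/contractionP => e e0.
have [j hj] : exists j : nat, forall x, bounded_on N T (fun k => - j%:Z <= k) x -> N x < e.
  apply: contrapT => /forallNP nJ.
  have [|||j||z hz] := @nested_compact G [set x | N x <= 1]
    (fun j => bounded_on N T (fun k => - j%:Z <= k) `&` [set x | e <= N x]).
  - exact: un_compact.
  - move=> j; apply: closedI; first exact: bounded_on_closed.
    apply/(un_closedP Nu) => z h /=; have [y /= ey yz] := h e e0.
    rewrite leNgt; apply/negP => ze; have := un_ltD Nu yz ze.
    by rewrite subrK ltNge ey.
  - move=> j z [z1 z2]; split=> //; apply: bounded_on_sub z1 => k; lia.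
  - have /existsNP[z /not_implyP[z1 /negP z2]] := nJ j; exists z; split=> //=.
    by rewrite leNgt.
  - by move=> z [z1 _] /=; apply: (z1 0).
  have z0 : z = 0.
    apply: T0 => k; have [h _] := hz `|k|%N; apply: h; lia.
  by have [_ /=] := hz 0%N; rewrite z0 un_0 // leNgt e0.
exists j => k jk; apply: hj; apply: bounded_on_shift xP => i; lia.
Qed.

End Aut.

Variable T : top_aut G.
Hypothesis T_exp : expansive_aut T.
Local Notation T_ k := (homeo_iter T k).
Local Notation C_ T := (contraction_group T).

(** The two-sided orbit of a common point is bounded. *)
Lemma contraction_meet x : C_ T x -> C_ (autV T) x -> x = 0.
Proof.
move=> /contraction_bounded[C1 h1] /contraction_bounded[C2 h2].
apply: (expansive_bounded T_exp (C := Num.max C1 C2)) => k; rewrite le_max.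
have [k0|k0] := leP 0 k.
  by have -> : k = `|k|%N; [lia|rewrite h1].
have := h2 `|k|%N; rewrite autV_iter (_ : - `|k|%N%:Z = k); last by lia.
by move=> ->; rewrite orbT.
Qed.

Lemma expansive_autV_bounded x : (forall k, N (homeo_iter (autV T) k x) <= 1) -> x = 0.
Proof.
move=> h; apply: (expansive_bounded T_exp (C := 1)) => k.
by rewrite -[k]opprK -autV_iter.
Qed.

Lemma tidy_contraction : exists2 e : rat, 0 < e & forall x, N x < e ->
  exists y z, [/\ x = y + z, C_ T y /\ N y <= 1 & C_ (autV T) z /\ N z <= 1].
Proof.
have [e e0 he] := tidy_split T Nu; exists e => // x /he[z [y [-> zP yP]]].
exists y, z; split; first by rewrite addrC.
  split; last exact: (yP 0).
  apply: bounded_contraction => // x'; exact: (expansive_bounded T_exp).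
split; last exact: (zP 0).
apply: bounded_contraction; first exact: expansive_autV_bounded.
by move=> k k0; rewrite autV_iter; apply: zP; rewrite oppr_le0.
Qed.

Lemma contraction_sum x : exists y z, [/\ C_ T y, C_ (autV T) z & x = y + z].
Proof.
have [e e0 he] := tidy_contraction; have [M hM] := mulrnX_lt (N x) e0.
have [y [z [E [yC _] [zC _]]]] := he _ (le_lt_trans (mulrnX_le M x) hM).
have [y' yE] := mulrnX_div M y; have [z' zE] := mulrnX_div M z.
exists y', z'; split.
- by apply: (contraction_div (M := M)); rewrite yE.
- by apply: (contraction_div (M := M)); rewrite zE.
- by apply: (@mulrnX_inj M); rewrite mulrnDl yE zE.
Qed.

Lemma contraction_uniq y z y' z' : C_ T y -> C_ (autV T) z ->
  C_ T y' -> C_ (autV T) z' -> y + z = y' + z' -> y = y' /\ z = z'.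
Proof.
move=> yC zC yC' zC' E; have E' : y - y' = z' - z.
  by rewrite -[y](addrK z) E addrAC [y' + z']addrC addrK.
have y0 : y - y' = 0.
  apply: contraction_meet; first by have [_] := contraction_subgroup T; exact.
  by rewrite E'; have [_] := contraction_subgroup (autV T); exact.
by split; apply/eqP; rewrite -subr_eq0 ?y0 // -opprB -E' y0 oppr0.
Qed.

(** Continuity at 0 of both projections. Write y + z = P^M g. If y + z is small enough, g splits
    into components of norm at most 1; by uniqueness [y] and [z] are their multiples by P^M, which
    have norm below [e]. *)
Lemma contraction_split_small (e : rat) : 0 < e -> exists2 d : rat, 0 < d &
  forall y z, C_ T y -> C_ (autV T) z -> N (y + z) < d -> N y < e /\ N z < e.
Proof.
move=> e0; have [r r0 hr] := tidy_contraction; have [M hM] := mulrnX_lt 1 e0.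
have PM : 0 < P%:R ^+ M :> rat by rewrite exprn_gt0 // ltr0n.
(* Division by P^M increases norms by a factor of at most P^M, so [g] has norm below [r]. *)
exists (r / P%:R ^+ M); first by rewrite divr_gt0.
move=> y z yC zC; have [g gE] := mulrnX_div M (y + z); rewrite -gE => hg.
have [|y' [z' [E [yC' y1] [zC' z1]]]] := hr g.
  by apply: le_lt_trans (mulrnX_ge M g) _; rewrite mulrC -ltr_pdivlMr.
have Cmul (T' : top_aut G) x k : C_ T' x -> C_ T' (x *+ k).
  move=> xC; elim: k => [|k IH]; first by have [] := contraction_subgroup T'.
  have [C0 CB] := contraction_subgroup T'.
  rewrite mulrSr -[x in _ + x]opprK; apply: (CB) => //.
  by rewrite -[- x]sub0r; exact: CB.
have [-> ->] : y = y' *+ P ^ M /\ z = z' *+ P ^ M.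
  by apply: contraction_uniq => //; [exact: Cmul|exact: Cmul|rewrite -mulrnDl -E].
have le1 x : N x <= 1 -> N (x *+ P ^ M) < e.
  move=> x1; apply: le_lt_trans (mulrnX_le _ _) _; apply: le_lt_trans hM.
  by rewrite ler_wpM2l // exprn_ge0 // invr_ge0.
by split; exact: le1.
Qed.

Lemma contraction_direct_product : internal_direct_product (C_ T) (C_ (autV T)).
Proof.
split; [exact: contraction_subgroup|exact: contraction_subgroup|].
have /choice[pr prK] : forall g : G, exists ab : (C_ T) * (C_ (autV T)),
    set_val ab.1 + set_val ab.2 = g.
  move=> g; have [y [z [/mem_set yC /mem_set zC ->]]] := contraction_sum g.
  by exists (exist _ y yC, exist _ z zC).
have inC1 (a : C_ T) : C_ T (set_val a) by exact: set_mem (svalP a).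
have inC2 (a : C_ (autV T)) : C_ (autV T) (set_val a) by exact: set_mem (svalP a).
have uniq (ab ab' : (C_ T) * (C_ (autV T))) :
    set_val ab.1 + set_val ab.2 = set_val ab'.1 + set_val ab'.2 -> ab = ab'.
  move=> /contraction_uniq[] // E1 E2; case: ab ab' E1 E2 => [a b] [a' b'] /= E1 E2.
  by congr (_, _); exact: val_inj.
exists pr; split=> [//|ab|]; first by apply: uniq; rewrite prK.
have prB x y : set_val (pr (x - y)).1 = set_val (pr x).1 - set_val (pr y).1 /\
               set_val (pr (x - y)).2 = set_val (pr x).2 - set_val (pr y).2.
  have [_ B1] := contraction_subgroup T; have [_ B2] := contraction_subgroup (autV T).
  apply: contraction_uniq => //; [exact: B1|exact: B2|].
  by rewrite prK addrACA -opprD !prK.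
have c1 : continuous (fun x => set_val (pr x).1).
  apply/(un_continuousP Nu Nu) => [x y|e e0]; first by have [] := prB x y.
  have [d d0 hd] := contraction_split_small e0; exists d => // x xd.
  by have [] := hd (set_val (pr x).1) (set_val (pr x).2); rewrite // prK.
have c2 : continuous (fun x => set_val (pr x).2).
  apply/(un_continuousP Nu Nu) => [x y|e e0]; first by have [] := prB x y.
  have [d d0 hd] := contraction_split_small e0; exists d => // x xd.
  by have [] := hd (set_val (pr x).1) (set_val (pr x).2); rewrite // prK.
(* The contraction groups carry the topology induced by [set_val]. *)
have c1' := @continuous_comp_initial _ _ _ set_val (fun x => (pr x).1) c1.
have c2' := @continuous_comp_initial _ _ _ set_val (fun x => (pr x).2) c2.
move=> x A [[U V] [/= xU xV] UVA].
have h1 : nbhs x ((fun x => (pr x).1) @^-1` U) := c1' x U xU.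
have h2 : nbhs x ((fun x => (pr x).2) @^-1` V) := c2' x V xV.
change (nbhs x (pr @^-1` A)).
by apply: filterS (filterI h1 h2) => y /= [yU yV]; exact: UVA.
Qed.

End ContractionSplit.

(** * Products over distinct primes *)

Lemma rat_pnorm_dvd_le (p k : nat) : prime p -> (p %| k)%N -> rat_pnorm p k%:R <= 2^-1.
Proof.
move=> p_pr /dvdnP[q ->]; rewrite natrM rat_pnormM // rat_pnorm_p //.
apply: le_trans (_ : 1 * p%:R^-1 <= _).
  by rewrite ler_wpM2r ?invr_ge0 // rat_pnorm_nat_le1.
by rewrite mul1r lef_pV2 ?posrE ?ltr0n ?prime_gt0 // (ler_nat _ 2) prime_gt1.
Qed.

Section PadicProduct.
Variables (n : nat) (p : 'I_n -> nat) (V : 'I_n -> topologicalZmodType)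
  (Nf : forall i, V i -> rat).
Hypotheses (p_pr : forall i, prime (p i)) (p_inj : injective p)
  (Nfp : forall i, padic_normed (p i) (@Nf i)).
Local Notation G := (prod_topology V).
Local Notation N := (prod_norm Nf).

Let Nu : unorm N.
Proof. by apply: prod_norm_unorm => i; exact: Nfp. Qed.

Lemma prod_mulrn (x : G) k i : (x *+ k) i = x i *+ k.
Proof. by elim: k => [|k IH] //; rewrite !mulrS -IH. Qed.

Definition inj_factor i (v : V i) : G := dfwith (fun k => 0 : V k) i v.

Lemma inj_factor_id i v : @inj_factor i v i = v.
Proof. exact: dfwithin. Qed.

Lemma inj_factor_out i (v : V i) j : j <> i -> inj_factor v j = 0.
Proof. by move=> /eqP ji; rewrite /inj_factor dfwithout // eq_sym. Qed.

Lemma eq_inj_factor (x : G) i : (forall j, j <> i -> x j = 0) -> x = inj_factor (x i).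
Proof.
move=> h; apply: functional_extensionality_dep => j.
have [->|/eqP ji] := eqVneq j i; first by rewrite inj_factor_id.
by rewrite inj_factor_out // h.
Qed.

Lemma inj_factorB i : zmod_morphism (@inj_factor i).
Proof.
move=> u v; rewrite [RHS](@eq_inj_factor _ i).
  by congr inj_factor; rewrite -[LHS](inj_factor_id (u - v)) inj_factor_id
    -[in LHS](inj_factor_id u) -[in LHS](inj_factor_id v).
move=> j ji; change (inj_factor u j - inj_factor v j = 0).
by rewrite !inj_factor_out // subrr.
Qed.

Lemma prod_norm_inj i (v : V i) : N (inj_factor v) = Nf v.
Proof.
apply/eqP; rewrite eq_le; apply/andP; split; last by rewrite -{1}(inj_factor_id v) le_prod_norm.
apply: max_norm_le => [|j]; first exact: un_ge0 (Nfp i) _.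
have [->|/eqP ji] := eqVneq j i; first by rewrite inj_factor_id.
by rewrite inj_factor_out // (un_0 (Nfp j)) (un_ge0 (Nfp i)).
Qed.

Lemma Nf_mulrnX i (v : V i) Q k : Nf (v *+ Q ^ k) = rat_pnorm (p i) Q%:R ^+ k * Nf v.
Proof. by rewrite (pn_mulrn (Nfp i)) natrX rat_pnormX. Qed.

(** The j-th coordinate of Q^k x has norm |Q|^k |x_j| for the p_j-adic |Q|, which is at most 1/2 if
    p_j divides [Q] and 1 otherwise. As automorphisms preserve the convergence, they preserve each
    such partial product of factors. *)
Lemma torsion_cvgP (x : G) (Q : nat) :
  (fun k => x *+ Q ^ k) @ \oo --> (0 : G) <-> forall j, ~~ (p j %| Q)%N -> x j = 0.
Proof.
rewrite (un_cvg0P Nu); split=> [h j jQ|h e e0].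
  apply: contrapT => /(un_gt0 (Nfp j)) xj.
  have [M /(_ M (leqnn M))] := h _ xj; rewrite ltNge => /negP; apply.
  apply: le_trans (le_prod_norm _ _ j); rewrite prod_mulrn Nf_mulrnX.
  by rewrite rat_pnorm_coprime // expr1n mul1r.
have e1 : 0 < e / (N x + 1) by rewrite divr_gt0 // ltr_wpDl // un_ge0.
have [M hM] := @archi_exp 2^-1 _ isT e1; exists M => k Mk.
apply: max_norm_lt => // j; rewrite prod_mulrn Nf_mulrnX.
have [jQ|/h xj] := boolP (p j %| Q)%N; last first.
  by rewrite (_ : Nf (x j) = 0) ?mulr0 // xj (un_0 (Nfp j)).
have r0 := rat_pnorm_ge0 (p_pr j) Q%:R.
have r2 := rat_pnorm_dvd_le (p_pr j) jQ.
have xe : N x < N x + 1 by rewrite ltrDl.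
have x1 : 0 < N x + 1 by rewrite ltr_wpDl // un_ge0.
rewrite ltr_pdivlMr // in hM; apply: le_lt_trans hM.
apply: ler_pM; rewrite ?exprn_ge0 // ?un_ge0 //; first exact: Nfp.
  apply: le_trans (_ : 2^-1 ^+ k <= _); first by rewrite lerXn2r ?nnegrE.
  by rewrite ler_wiXn2l ?invr_ge0 // invf_le1 ?ler1n.
by rewrite (le_trans _ (ltW xe)) // le_prod_norm.
Qed.

Section Aut.
Variable T : top_aut G.

Lemma aut_torsion (S : top_aut G) (x : G) (Q : nat) :
  (forall j, ~~ (p j %| Q)%N -> x j = 0) -> forall j, ~~ (p j %| Q)%N -> S x j = 0.
Proof.
move=> /torsion_cvgP xQ; apply/torsion_cvgP.
have SB := aut_zmod_morphism S.
have -> : (fun k => S x *+ Q ^ k) = S \o (fun k => x *+ Q ^ k).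
  by apply/funext => k; rewrite /= (zmod_morphMn SB).
rewrite -(zmod_morph0 SB); apply: cvg_comp xQ _.
exact: (@homeo_continuous _ S).
Qed.

Lemma aut_factor (S : top_aut G) i (x : G) :
  (forall j, j <> i -> x j = 0) -> forall j, j <> i -> S x j = 0.
Proof.
have E j : j <> i <-> ~~ (p j %| p i)%N.
  rewrite dvdn_prime2 //; split=> [ji|/eqP h ji]; last by apply: h; rewrite ji.
  by apply/eqP => /p_inj.
by move=> xi j /E; apply: aut_torsion => k /E; exact: xi.
Qed.

(** With this [Q], [torsion_cvgP] describes the complement of the i-th factor; in
    [closed_subgroup_factor] its powers suppress all the other coordinates. *)
Lemma coprime_index i : exists Q, forall j, ~~ (p j %| Q)%N <-> j = i.
Proof.
exists (\prod_(j < n | j != i) p j)%N => j.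
  rewrite Euclid_dvd_prod // big_has_cond; split=> [h|->].
    apply/eqP; apply: contraNT h => ji; apply/hasP; exists j => //.
    by rewrite /= dvdnn andbT.
  apply/hasP => -[k _ /andP[ki]]; rewrite dvdn_prime2 // => /eqP/p_inj ik.
  by rewrite ik eqxx in ki.
Qed.

Lemma aut_cofactor (S : top_aut G) i (x : G) : x i = 0 -> S x i = 0.
Proof.
have [Q E] := coprime_index i.
by move=> xi; apply: (@aut_torsion S x Q) => [j /E ->|] //; exact/E.
Qed.

Lemma homeo_iter_factor k i (x : G) : (forall j, j <> i -> x j = 0) ->
  forall j, j <> i -> homeo_iter T k x j = 0.
Proof.
move=> xi; elim/int_rec: k => [|k IH|k IH]; first by [].
- have -> : k.+1%:Z = k%:Z + 1 by lia.
  rewrite homeo_iterS; exact: aut_factor.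
- have -> : - k.+1%:Z = - k%:Z - 1 by lia.
  rewrite homeo_iterP; exact: (@aut_factor (autV T)).
Qed.

Lemma aut_direct_factor i : T @` direct_factor i = direct_factor i.
Proof.
apply/seteqP; split=> [_ [x xi <-]|x xi] /=; first exact: aut_factor.
by exists (autV T x); [exact: aut_factor|rewrite /= homeoVK].
Qed.

Lemma padic_product_contraction : expansive_aut T ->
  internal_direct_product (contraction_group T) (contraction_group (autV T)).
Proof.
pose P := (\prod_(i < n) p i)%N.
have rP i : rat_pnorm (p i) P%:R = (p i)%:R^-1.
  rewrite /P (bigD1 i) //= natrM rat_pnormM // rat_pnorm_p // rat_pnorm_coprime ?mulr1 //.
  rewrite Euclid_dvd_prod // big_has_cond; apply/hasP => -[k _ /andP[ki]].
  by rewrite dvdn_prime2 // => /eqP/p_inj ik; rewrite ik eqxx in ki.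
have P0 : (0 < P)%N by rewrite prodn_gt0 // => i; exact: prime_gt0.
move=> Te; apply: (@contraction_direct_product _ N P) => //.
- move=> x; apply: max_norm_le => [|i].
    by rewrite mulr_ge0 ?invr_ge0 // un_ge0.
  rewrite prod_mulrn (pn_mulrn (Nfp i)) rP.
  apply: ler_pM; rewrite ?invr_ge0 ?le_prod_norm //; first exact: un_ge0 (Nfp i) _.
  by rewrite lef_pV2 ?posrE ?ltr0n ?prime_gt0 // (ler_nat _ 2) prime_gt1.
- move=> x; apply: max_norm_le => [|i]; first by rewrite mulr_ge0 // un_ge0.
  have := le_prod_norm Nf (x *+ P) i; rewrite prod_mulrn (pn_mulrn (Nfp i)) rP => h.
  apply: le_trans (ler_wpM2l _ h); last by [].
  have pi0 : 0 < (p i)%:R :> rat by rewrite ltr0n prime_gt0.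
  rewrite mulrA ler_peMl ?(un_ge0 (Nfp i)) // ler_pdivlMr // mul1r ler_nat.
  by rewrite /P (bigD1 i) //= leq_pmulr // prodn_gt0 // => j; exact: prime_gt0.
- move=> x; have ex i : exists w, w *+ P = x i by exact: (pn_div (Nfp i)).
  exists (fun i => projT1 (cid (ex i))); apply: functional_extensionality_dep => i.
  by rewrite prod_mulrn; exact: projT2 (cid (ex i)).
Qed.

End Aut.
End PadicProduct.

(** * Rank one factors *)

Section PadicLinear.
Variables (p : nat) (p_pr : prime p) (W : topologicalZmodType) (M : W -> rat).
Hypothesis Mp : padic_normed p M.
Local Notation K := (padic p_pr).
Local Notation N := (@padic_norm p p_pr).

(** The map vanishes on the naturals, by density on Z_p, and then everywhere: p^k t lies in Z_p for
    large k, and multiplication by p^k is injective on [W]. This is what makes continuous additive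
    maps linear over Q_p. *)
Lemma padic_morph_eq0 (f : K -> W) : zmod_morphism f ->
  (forall e : rat, 0 < e -> exists2 d : rat, 0 < d & forall x, N x < d -> M (f x) < e) ->
  f 1 = 0 -> forall t, f t = 0.
Proof.
move=> fB fc f1.
have fnat c : f c%:R = 0 by rewrite (zmod_morphMn fB) f1 mul0rn.
have fint t : N t <= 1 -> f t = 0.
  move=> t1; apply: contrapT => /(un_gt0 Mp) ft.
  have [d d0 hd] := fc _ ft; have [c /hd] := padic_nat_dense t1 d0.
  by rewrite fB fnat subr0 ltxx.
move=> t; have pV1 := prime_inv_itv p_pr.
have t1 : 0 < (N t + 1)^-1 by rewrite invr_gt0 ltr_wpDl // padic_norm_ge0.
have [k hk] := archi_exp pV1 t1.
have : f (t *+ p ^ k) = 0.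
  apply: fint; rewrite padic_norm_mulrn natrX rat_pnormX // rat_pnorm_p //.
  have N1 : 0 < N t + 1 by rewrite ltr_wpDl // padic_norm_ge0.
  rewrite -(ltr_pM2r N1) mulVf ?gt_eqF // in hk.
  apply: le_trans (ltW hk); rewrite ler_wpM2l ?exprn_ge0 ?lerDl //.
  by case/andP: pV1.
rewrite (zmod_morphMn fB) => fk; apply: (un_eq0 Mp); apply/eqP.
have : M (f t *+ p ^ k) = 0 by rewrite fk (un_0 Mp).
rewrite (pn_mulrn Mp) => /eqP; rewrite mulf_eq0 rat_pnorm_eq0 //.
by rewrite pnatr_eq0 gtn_eqF //= expn_gt0 prime_gt0.
Qed.

Lemma padic_morph_eq (f g : K -> W) : zmod_morphism f -> zmod_morphism g ->
  (forall e : rat, 0 < e -> exists2 d : rat, 0 < d & forall x, N x < d -> M (f x) < e) ->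
  (forall e : rat, 0 < e -> exists2 d : rat, 0 < d & forall x, N x < d -> M (g x) < e) ->
  f 1 = g 1 -> f =1 g.
Proof.
move=> fB gB fc gc fg1 t; apply/eqP; rewrite -subr_eq0; apply/eqP.
apply: (@padic_morph_eq0 (fun t => f t - g t)); last by rewrite fg1 subrr.
  by move=> x y; rewrite fB gB !opprB addrACA [RHS]addrACA [- f y + _]addrC.
move=> e e0; have [d d0 hd] := fc e e0; have [d' d'0 hd'] := gc e e0.
exists (Num.min d d'); first by rewrite lt_min d0.
by move=> x; rewrite lt_min => /andP[xd xd']; rewrite (un_ltB Mp) ?hd ?hd'.
Qed.

End PadicLinear.

(** Multiplication by [a] moves by a constant ratio and cannot jump over the window. The upper end
    does not depend on [y], which will make the constant of expansiveness uniform. *)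
Lemma expz_window (a y : rat) : 0 < a -> a != 1 -> 0 < y ->
  exists k : int, 1 <= a ^ k * y <= Num.max a a^-1.
Proof.
have th (b z : rat) : 1 < b -> 0 < z -> exists k : int, 1 <= b ^ k * z <= b.
  move=> b1 z0; have b0 : 0 < b by rewrite (lt_trans ltr01).
  have bV : 0 <= b^-1 < 1 by apply/andP; split; [rewrite invr_ge0 ltW|rewrite invf_lt1].
  have zV : 0 < z^-1 by rewrite invr_gt0.
  have [M hM] := archi_exp bV zV.
  have bz0 k : 0 < b ^ k * z by rewrite mulr_gt0 // exprz_gt0.
  have ex : exists j : nat, 1 <= b ^ (j%:Z - M%:Z) * z.
    have [j hj] := archi_exp bV (bz0 (- M%:Z)); exists j.
    rewrite expfzDr ?gt_eqF // -mulrA -exprnP -[b ^+ j]invrK -exprVn.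
    by rewrite mulrC ler_pdivlMr ?mul1r ?ltW // exprn_gt0 // invr_gt0.
  (* By the choice of [M] the least exponent index is not 0, so its predecessor exists and gives a
     value below 1. *)
  case: (ex_minnP ex) => -[|j] hj jmin.
    move: hj; rewrite sub0r -exprz_inv -exprnP leNgt.
    by rewrite -ltr_pdivlMr // mul1r hM.
  exists (j.+1%:Z - M%:Z); rewrite hj /=.
  have -> : j.+1%:Z - M%:Z = 1 + (j%:Z - M%:Z) by lia.
  rewrite expfzDr ?gt_eqF // expr1z -mulrA ger_pMr // leNgt; apply/negP => /ltW.
  by move=> /jmin; rewrite ltnn.
move=> a0 a1 y0; have [la|la] := ltP 1 a.
  by have [k /andP[k1 k2]] := th a y la y0; exists k; rewrite k1 le_max k2.
have aV : 1 < a^-1 by rewrite invf_gt1 // lt_neqAle a1.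
have [k /andP[k1 k2]] := th _ y aV y0; exists (- k).
by rewrite -exprz_inv k1 le_max k2 orbT.
Qed.

Section RankOne.
Variables (R : realType) (n : nat) (p : 'I_n -> nat)
  (p_pr : forall i, prime (p i)) (p_inj : injective p).
Local Notation V := (fun i : 'I_n => padic (p_pr i)).
Local Notation G := (prod_topology V).
Local Notation Nf := (fun i : 'I_n => @padic_norm (p i) (p_pr i)).
Local Notation N := (prod_norm Nf).

Local Notation inj_ i t := (@inj_factor _ V i t).

Let Nfp i : padic_normed (p i) (Nf i) := padic_padic_normed (p_pr i).

Let Nu : unorm N.
Proof. by apply: prod_norm_unorm => i; exact: Nfp. Qed.

Lemma sum_inj_factor (x : G) : x = \sum_(i < n) inj_ i (x i).
Proof.
apply: functional_extensionality_dep => j.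
have E (I : Type) (r : seq I) (F : I -> G) : (\sum_(i <- r) F i) j = \sum_(i <- r) F i j.
  by elim: r => [|i r IH]; rewrite ?big_nil // !big_cons -IH.
rewrite E (bigD1 j) //= inj_factor_id big1 ?addr0 // => i ij.
by rewrite inj_factor_out // => /esym/eqP; rewrite (negbTE ij).
Qed.

(** The point is a limit of multiples of [h]. With [Q] divisible by all the primes except p_i, the
    multiples by Q^M c are small off the i-th coordinate, and c is chosen so that Q^M c h_i
    approximates [t]. *)
Lemma closed_subgroup_factor (H : closed_subgroup G) (h : G) i (t : padic (p_pr i)) :
  (H : set G) h -> padic_norm t <= padic_norm (h i) -> (H : set G) (inj_ i t).
Proof.
move=> Hh th; have [H0 HB] := csub_subgroup H.
have Hmul c : (H : set G) (h *+ c).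
  elim: c => [//|c IH]; rewrite mulrSr -[h in _ + h]opprK; apply: (HB) => //.
  by rewrite -[- h]sub0r; exact: HB.
have [hi0|hi0] := eqVneq (h i) 0.
  have -> : t = 0.
    apply: (un_eq0 (Nfp i)); apply/eqP; rewrite eq_le padic_norm_ge0 andbT.
    by rewrite -(padic_norm0 (p_pr i)) -hi0.
  by rewrite (zmod_morph0 (@inj_factorB _ V i)).
have /(un_closedP Nu) := @csub_closed G H; apply => e e0.
have [Q QE] := coprime_index p_pr p_inj i.
have Qi : ~~ (p i %| Q)%N by apply/QE.
have e1 : 0 < e / (N h + 1) by rewrite divr_gt0 // ltr_wpDl // (un_ge0 Nu).
have [M hM] := @archi_exp 2^-1 _ isT e1.
have hM' : 2^-1 ^+ M * N h < e.
  have N1 : 0 < N h + 1 by rewrite ltr_wpDl // (un_ge0 Nu).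
  rewrite ltr_pdivlMr // in hM; apply: le_lt_trans hM.
  by rewrite ler_wpM2l ?exprn_ge0 // lerDl.
pose q : padic (p_pr i) := (Q ^ M)%:R.
have q1 : padic_norm q = 1.
  by rewrite padic_norm_nat natrX rat_pnormX // rat_pnorm_coprime // expr1n.
have q0 : q != 0 by rewrite -padic_norm_eq0 q1 oner_eq0.
have Nh0 : 0 < padic_norm (h i) by rewrite lt_neqAle padic_norm_ge0 eq_sym padic_norm_eq0 hi0.
(* [u] lies in Z_p, since [q] is a unit there and |t| <= |h_i|; so naturals approximate it. *)
pose u := t / (h i * q).
have [|c hc] := @padic_nat_dense _ (p_pr i) u (e / padic_norm (h i)) _ (divr_gt0 e0 Nh0).
  by rewrite padic_normM padic_normV padic_normM q1 mulr1 ler_pdivrMr // mul1r.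
exists (h *+ (Q ^ M * c)); first exact: Hmul.
apply: max_norm_lt => // j.
change (Nf j ((h *+ (Q ^ M * c)) j - inj_ i t j) < e); rewrite prod_mulrn.
have [E|ji] := pselect (j = i).
  subst j; rewrite inj_factor_id -(mulr_natl (h i)) natrM -/q.
  have -> : q * c%:R * h i - t = - (h i * q * (u - c%:R)).
    have : h i * q * u = t by rewrite /u mulrC divfK // mulf_neq0.
    by rewrite mulrBr => ->; ring.
  by rewrite padic_normN !padic_normM q1 mulr1 mulrC -ltr_pdivlMr.
rewrite inj_factor_out // subr0 mulrnA padic_norm_mulrn.
apply: le_lt_trans (_ : padic_norm (h j *+ Q ^ M) < e).
  by rewrite -[X in _ <= X]mul1r ler_wpM2r ?padic_norm_ge0 // rat_pnorm_nat_le1.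
rewrite padic_norm_mulrn natrX rat_pnormX //; apply: le_lt_trans hM'.
apply: ler_pM; rewrite ?exprn_ge0 ?rat_pnorm_ge0 ?padic_norm_ge0 ?(le_prod_norm Nf) //.
rewrite lerXn2r ?nnegrE ?rat_pnorm_ge0 // rat_pnorm_dvd_le //.
by apply: contrapT => /negP/QE.
Qed.

Section Aut.
Variable T : top_aut G.
Local Notation T_ k := (homeo_iter T k).

Definition factor_ratio (S : top_aut G) i : padic (p_pr i) := S (inj_ i 1) i.

(** [x] and its i-th component differ by an element vanishing at i, and so do their images by
    [aut_cofactor]; a continuous additive map of Q_p to itself is a multiplication. *)
Lemma aut_diagonal (S : top_aut G) (x : G) i : S x i = factor_ratio S i * x i.
Proof.
have SB := aut_zmod_morphism S.
have -> : S x i = S (inj_ i (x i)) i.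
  apply/eqP; rewrite -subr_eq0; apply/eqP.
  change ((S x - S (inj_ i (x i))) i = 0); rewrite -SB.
  apply: (aut_cofactor p_pr p_inj Nfp); change (x i - inj_ i (x i) i = 0).
  by rewrite inj_factor_id subrr.
apply: (@padic_morph_eq _ _ _ _ (Nfp i) (fun t => S (inj_ i t) i)
  (fun t => factor_ratio S i * t)).
- by move=> u v; rewrite inj_factorB SB.
- by move=> u v; rewrite mulrBr.
- move=> e e0; have /(un_continuousP Nu Nu SB)/(_ e e0)[d d0 hd] := @homeo_continuous _ S.
  exists d => // t td; apply: le_lt_trans (le_prod_norm Nf _ i) _; apply: hd.
  by rewrite (prod_norm_inj Nfp).
- move=> e e0; pose a := padic_norm (factor_ratio S i).
  have a1 : 0 < a + 1 by rewrite ltr_wpDl // padic_norm_ge0.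
  exists (e / (a + 1)); first by rewrite divr_gt0.
  move=> t; rewrite padic_normM -/a ltr_pdivlMr // mulrC; apply: le_lt_trans.
  by rewrite ler_wpM2r ?padic_norm_ge0 // lerDl.
- by rewrite mulr1.
Qed.

(* [|a_i|], where [T] is multiplication by [a_i] on the i-th factor. *)
Definition factor_scale i : rat := padic_norm (factor_ratio T i).

Lemma factor_scale_gt0 i : 0 < factor_scale i.
Proof.
rewrite lt_neqAle padic_norm_ge0 andbT eq_sym padic_norm_eq0; apply/eqP => a0.
have := congr1 (fun x : G => x i) (homeoVK T (inj_ i 1)).
by rewrite /= aut_diagonal a0 mul0r inj_factor_id => /eqP; rewrite eq_sym oner_eq0.
Qed.

Lemma homeo_iter_scale k (x : G) i :
  padic_norm (T_ k x i) = factor_scale i ^ k * padic_norm (x i).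
Proof.
have a0 := factor_scale_gt0 i.
elim/int_rec: k x => [|k IH|k IH] x; first by rewrite mul1r.
- have -> : k.+1%:Z = k%:Z + 1 by lia.
  by rewrite homeo_iterS aut_diagonal padic_normM IH expfzDr ?gt_eqF // expr1z
    mulrA [_ * _ ^ _]mulrC.
- have -> : - k.+1%:Z = - k%:Z - 1 by lia.
  rewrite homeo_iterP expfzDr ?gt_eqF // mulrAC -IH.
  rewrite -{2}[T_ (- k%:Z) x](homeoVK T) aut_diagonal padic_normM mulrC -/(factor_scale i).
  by rewrite exprN1 mulKf // gt_eqF.
Qed.

(** If |a_i| = 1, the i-th factor has arbitrarily small nonzero points whose orbits have constant
    norm. *)
Lemma expansive_aut_scale : expansive_aut T -> forall i, factor_scale i != 1.
Proof.
move=> [U /(un_nbhs0 Nu)[e e0 eU] UT] i; apply/eqP => a1.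
have pV1 := prime_inv_itv (p_pr i).
have [M hM] := archi_exp pV1 e0.
pose x : G := inj_ i ((p i)%:R ^+ M).
have : [set 0] x.
  rewrite -UT => k _; exists (T_ (- k) x); last exact: homeo_iterNK.
  apply: eU; apply: max_norm_lt => // j; have [E|ji] := pselect (j = i).
    subst j; rewrite homeo_iter_scale a1 exp1rz mul1r /x inj_factor_id.
    by rewrite padic_normX padic_norm_p.
  rewrite (_ : T_ (- k) x j = 0) ?padic_norm0 //.
  by apply: (homeo_iter_factor p_pr p_inj Nfp) ji => l li; exact: inj_factor_out.
move=> /= /(congr1 (fun x : G => x i)); rewrite /x inj_factor_id => /eqP.
by rewrite expf_eq0 (negbTE (padic_p_neq0 (p_pr i))) andbF.
Qed.

Lemma scale_expansive_aut : (forall i, factor_scale i != 1) -> expansive_aut T.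
Proof.
move=> a1; exists [set x | N x <= 1].
  by apply/(un_nbhs0 Nu); exists 1 => // y /= /ltW.
apply/seteqP; split=> [x xT /=|_ -> k _]; last first.
  have T0 := zmod_morph0 (homeo_iter_zmod_morphism T k).
  by exists 0 => //=; rewrite (un_0 Nu).
apply: functional_extensionality_dep => i; apply: contrapT => /(un_gt0 (Nfp i)) xi.
(* Because of the halving the window bound becomes |T^k x_i| >= 2, which leaves the unit ball. *)
have xi2 : 0 < Nf i (x i) / 2 by rewrite divr_gt0.
have [k /andP[hk _]] := expz_window (factor_scale_gt0 i) (a1 i) xi2.
have [y /= y1 yx] := xT (- k) I.
have : N (T_ k x) <= 1 by rewrite -yx homeo_iterNK.
move=> /(le_trans (le_prod_norm Nf (T_ k x) i)) /=; rewrite homeo_iter_scale.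
by move: hk; rewrite mulrA; move: (_ * padic_norm _) => z; lra.
Qed.

Lemma aut_image_mem k (A : set G) x : (T_ k @` A) x <-> A (T_ (- k) x).
Proof.
by split=> [[y Ay <-]|Ax]; [rewrite homeo_iterK|exists (T_ (- k) x) => //; rewrite homeo_iterNK].
Qed.

(** If |a_i| = 1, the balls of the i-th factor are invariant, and a small one is never told apart
    from the trivial subgroup. *)
Lemma expansive_sub_scale : expansive_homeo R (sub_action T) -> forall i, factor_scale i != 1.
Proof.
move=> /(expansive_sub_actionP R T Nu)[m hm] i; apply/eqP => a1.
have e0 : 0 < (m.+1%:R : rat)^-1 by rewrite invr_gt0.
pose B (c : rat) : set G := [set x | (forall j, j <> i -> x j = 0) /\ Nf i (x i) <= c].
have Bc c : closed (B c).
  apply/(un_closedP Nu) => x h; split=> [j ji|].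
    apply: contrapT => /(un_gt0 (Nfp j))/h[y [/(_ j ji) yj _]].
    apply/negP; rewrite -leNgt; apply: le_trans (le_prod_norm Nf _ j).
    by change (Nf j (x j) <= Nf j (y j - x j)); rewrite yj sub0r padic_normN.
  rewrite leNgt; apply/negP => cx; have xi0 : 0 < Nf i (x i).
    have [z [_ zc] _] := h 1 ltr01; apply: le_lt_trans cx.
    exact: le_trans (padic_norm_ge0 _) zc.
  have [y [_ yc]] := h _ xi0; apply/negP; rewrite -leNgt.
  apply: le_trans (le_prod_norm Nf _ i); change (Nf i (x i) <= Nf i (y i - x i)).
  have := un_leDl (Nfp i) (x i) (- y i); rewrite padic_normN le_max.
  by rewrite -(padic_normN (y i - x i)) opprB => /orP[//|]; rewrite leNgt (le_lt_trans yc cx).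
have Bs c : 0 <= c -> subgroup (B c).
  move=> c0; split=> [|x y [x1 x2] [y1 y2]].
    by split=> //; change (padic_norm (0 : padic (p_pr i)) <= c); rewrite padic_norm0.
  split=> [j ji|]; first by change (x j - y j = 0); rewrite x1 // y1 // subrr.
  exact: (un_leB (Nfp i)).
pose A := ClosedSubgroup (Bc 0) (Bs 0 (lexx 0)).
pose C := ClosedSubgroup (Bc m.+1%:R^-1) (Bs _ (ltW e0)).
have TB c k : T_ k @` (B c) = B c.
  have h k' x : B c x -> B c (T_ k' x).
    move=> [x1 x2]; split; first exact: (homeo_iter_factor p_pr p_inj Nfp).
    by rewrite /= homeo_iter_scale a1 exp1rz mul1r.
  apply/seteqP; split=> [_ [x Bx <-]|x Bx]; first exact: h.
  by apply/aut_image_mem; exact: h.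
have B00 : B 0 0 by have [] := Bs 0 (lexx 0).
have [|k] := hm A C.
  move=> AC; have pV1 := prime_inv_itv (p_pr i).
  have [M hM] := archi_exp pV1 e0.
  have : (C : set G) (inj_ i ((p i)%:R ^+ M)).
    split=> [j ji|]; first exact: inj_factor_out.
    by rewrite /= inj_factor_id padic_normX padic_norm_p ltW.
  rewrite -AC => -[_ /=]; rewrite inj_factor_id leNgt => /negP; apply.
  rewrite lt_neqAle padic_norm_ge0 andbT eq_sym padic_norm_eq0.
  by rewrite expf_eq0 (negbTE (padic_p_neq0 (p_pr i))) andbF.
apply; rewrite !TB; split=> x.
  move=> [x1 x2] _; exists x; last by rewrite subrr (un_0 Nu) ltW.
  by split=> //; rewrite (le_trans x2) // ltW.
move=> [x1 x2] _; exists 0 => //; rewrite sub0r (un_opp Nu).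
apply: max_norm_le => [|j]; first exact: ltW.
have [E|ji] := pselect (j = i); first by subst j.
by rewrite (x1 j ji) padic_norm0 ltW.
Qed.

(** Let x in A be missing from B. Some component x_i is missing too, and then all i-th coordinates
    in B have smaller norm than x_i. At a time k when |T^k x_i| is in the window, T^k B stays at
    distance at least 1 from that component. *)
Lemma scale_expansive_sub : (forall i, factor_scale i != 1) -> expansive_homeo R (sub_action T).
Proof.
move=> a1; apply/(expansive_sub_actionP R T Nu).
pose b := max_norm (fun i => Num.max (factor_scale i) (factor_scale i)^-1).
(* The ball of radius m + 1 has to contain the window; the successor ensures 1/(m+1) < 1. *)
pose m := (Num.bound b).+1; exists m.
have sep (A B : closed_subgroup G) x : (A : set G) x -> ~ (B : set G) x ->
    exists k, ~ near_sub N m (T_ k @` (A : set G)) (T_ k @` (B : set G)).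
  move=> Ax nBx.
  have [i nBi] : exists i, ~ (B : set G) (inj_ i (x i)).
    apply: contrapT => /forallNP h; apply: nBx; rewrite (sum_inj_factor x).
    have [B0 BB] := csub_subgroup B.
    elim/big_ind: _ => [//|u v Bu Bv|i _]; last exact: contrapT (h i).
    have BN : (B : set G) (- v) by rewrite -[- v]sub0r; exact: BB.
    by rewrite -[v]opprK; exact: BB.
  have Ai : (A : set G) (inj_ i (x i)) by exact: closed_subgroup_factor Ax _.
  have Bi h : (B : set G) h -> padic_norm (h i) < padic_norm (x i).
    by move=> Bh; rewrite ltNge; apply/negP => /(closed_subgroup_factor Bh).
  have xi0 : 0 < padic_norm (x i).
    by have [B0 _] := csub_subgroup B; exact: le_lt_trans (padic_norm_ge0 _) (Bi 0 B0).
  have [k /andP[k1 k2]] := expz_window (factor_scale_gt0 i) (a1 i) xi0.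
  exists k => -[AB _].
  have [||y /aut_image_mem By yx] := AB (T_ k (inj_ i (x i))); first by exists (inj_ i (x i)).
    apply: max_norm_le => // j; have [E|ji] := pselect (j = i).
      subst j; rewrite homeo_iter_scale inj_factor_id; apply: le_trans k2 _.
      apply: le_trans (_ : b <= _).
        exact: (le_max_norm (fun i => Num.max (factor_scale i) (factor_scale i)^-1) i).
      rewrite ltW // (lt_le_trans (archi_boundP (max_norm_ge0 _))) // ler_nat.
      by rewrite /m ltnW // ltnW.
    rewrite (_ : T_ k (inj_ i (x i)) j = 0) ?padic_norm0 //.
    by apply: (homeo_iter_factor p_pr p_inj Nfp) ji => l li; exact: inj_factor_out.
  have {yx} := le_trans (le_prod_norm Nf _ i) yx.
  change (padic_norm (y i - T_ k (inj_ i (x i)) i) <= m.+1%:R^-1 -> False) => yx.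
  have zE : padic_norm (T_ k (inj_ i (x i)) i) = factor_scale i ^ k * padic_norm (x i).
    by rewrite homeo_iter_scale inj_factor_id.
  have yE : padic_norm (y i) < factor_scale i ^ k * padic_norm (x i).
    rewrite -[y](homeo_iterNK T k) homeo_iter_scale ltr_pM2l ?exprz_gt0 ?factor_scale_gt0 //.
    exact: Bi.
  have := un_leDl (Nfp i) (T_ k (inj_ i (x i)) i) (- y i); rewrite padic_normN.
  rewrite -(padic_normN (_ - y i)) opprB zE le_max => /orP[h|]; last by rewrite leNgt yE.
  have := le_trans (le_trans k1 h) yx; rewrite leNgt invf_lt1 ?ltr0n // => /negP; apply.
  by rewrite ltr1n.
move=> A B AB; have [[x Ax nBx]|nAB] := pselect (exists2 x, (A : set G) x & ~ (B : set G) x).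
  exact: sep Ax nBx.
have [[x Bx nAx]|nBA] := pselect (exists2 x, (B : set G) x & ~ (A : set G) x).
  by have [k hk] := sep B A x Bx nAx; exists k => /near_sub_sym.
case: AB; apply: csub_inj; apply/seteqP; split=> x h; apply: contrapT => h'.
  by apply: nAB; exists x.
by apply: nBA; exists x.
Qed.

Theorem rank_one_expansive : expansive_aut T <-> expansive_homeo R (sub_action T).
Proof.
split=> [/expansive_aut_scale/scale_expansive_sub|] //.
by move=> /expansive_sub_scale/scale_expansive_aut.
Qed.

End Aut.
End RankOne.

(** * Orbits of p-adic matrices *)

(** A matrix of maximal rank among those with row space inside [W] works. It will turn the space of
    vectors with bounded orbit into the kernel of a matrix. *)
Lemma linear_set_mx (F : fieldType) (n : nat) (W : set 'rV[F]_n) : W 0 ->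
  (forall (a : F) x y, W x -> W y -> W (a *: x + y)) ->
  exists M : 'M[F]_n, forall x, W x <-> (x <= M)%MS.
Proof.
move=> W0 WL; pose P r := `[< exists2 M : 'M[F]_n, \rank M = r & forall x, (x <= M)%MS -> W x >].
have P0 : exists r, P r.
  exists 0%N; apply/asboolP; exists 0; first exact: mxrank0.
  by move=> x; rewrite submx0 => /eqP ->.
have Pn r : P r -> (r <= n)%N by move=> /asboolP[M <- _]; exact: rank_leq_row.
case: (ex_maxnP P0 Pn) => r /asboolP[M Mr MW] rmax.
exists M => x; split=> [Wx|]; last exact: MW.
have MxW y : (y <= M + x)%MS -> W y.
  move=> /sub_addsmxP[[u v] /= ->]; rewrite addrC.
  have -> : v *m x = v 0 0 *: x by rewrite -mul_scalar_mx -mx11_scalar.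
  by apply: WL => //; apply: MW; exact: submxMl.
have : P (\rank (M + x)%MS) by apply/asboolP; exists (M + x)%MS.
move=> /rmax; rewrite -Mr => rle.
have /mxrank_leqif_sup[_ E] := addsmxSl M x.
apply: submx_trans (addsmxSr M x) _; rewrite -E eqn_leq rle andbT.
by rewrite mxrankS // addsmxSl.
Qed.

Section PadicMatrix.
Variables (p : nat) (p_pr : prime p).
Local Notation K := (padic p_pr).
Local Notation Np := (@padic_norm p p_pr).
Local Notation N := (@vec_norm p p_pr _).

Lemma padic_norm_sum_le (I : Type) (r : seq I) (P : pred I) (F : I -> K) (e : rat) :
  0 <= e -> (forall i, P i -> Np (F i) <= e) -> Np (\sum_(i <- r | P i) F i) <= e.
Proof.
move=> e0 h; elim/big_ind: _ => [|x y xe ye|//]; first by rewrite padic_norm0.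
exact: (un_leD (padic_unorm p_pr)).
Qed.

Lemma vec_norm_ge0 n (x : 'rV[K]_n) : 0 <= N x.
Proof. exact: max_norm_ge0. Qed.

Lemma vec_norm_mulmx m n (A : 'M[K]_(m, n)) : exists2 c : rat, 1 <= c &
  forall x : 'rV[K]_m, N (x *m A) <= c * N x.
Proof.
(* The added 1 makes the constant positive and its powers nondecreasing, as [dominated_root]
   needs. *)
exists (1 + max_norm (fun i => max_norm (fun j => Np (A i j)))).
  by rewrite lerDl max_norm_ge0.
set c := max_norm _ => x.
have c0 : 0 <= c by exact: max_norm_ge0.
have x0 := vec_norm_ge0 x.
apply: le_trans (_ : c * N x <= _); last by rewrite ler_wpM2r // lerDr.
apply: max_norm_le => [|j]; first exact: mulr_ge0.
rewrite mxE; apply: padic_norm_sum_le => [|i _]; first exact: mulr_ge0.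
rewrite padic_normM mulrC; apply: ler_pM; rewrite ?padic_norm_ge0 //.
  apply: le_trans (le_max_norm (fun i => max_norm (fun j => Np (A i j))) i).
  exact: (le_max_norm (fun j => Np (A i j))).
exact: (le_max_norm (fun i => Np (x ord0 i))).
Qed.

Lemma padic_norm_prod_le n (F : 'I_n -> K) (c : rat) :
  (forall i, Np (F i) <= c) -> Np (\prod_(i < n) F i) <= c ^+ n.
Proof.
elim: n F => [|n IH] F h; first by rewrite big_ord0 padic_norm1 expr0.
rewrite big_ord_recl padic_normM exprS.
by apply: ler_pM; rewrite ?padic_norm_ge0 // IH.
Qed.

Lemma padic_norm_sign (b : bool) x : Np ((-1) ^+ b * x) = Np x.
Proof. by case: b; rewrite ?expr1 ?expr0 ?mulN1r ?padic_normN ?mul1r. Qed.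

Lemma padic_norm_det_le n (A : 'M[K]_n) (c : rat) : 0 <= c ->
  (forall i j, Np (A i j) <= c) -> Np (\det A) <= c ^+ n.
Proof.
move=> c0 h; apply: padic_norm_sum_le => [|s _]; first exact: exprn_ge0.
by rewrite padic_norm_sign padic_norm_prod_le.
Qed.

Lemma padic_norm_adj_le n (A : 'M[K]_n) (c : rat) : 0 <= c ->
  (forall i j, Np (A i j) <= c) -> forall i j, Np (\adj A i j) <= c ^+ n.-1.
Proof.
move=> c0 h i j; rewrite mxE /cofactor -signr_odd padic_norm_sign.
by apply: padic_norm_det_le => // k l; rewrite !mxE.
Qed.

Section Orbits.
Variable d : nat.
Local Notation V := (padic_space p_pr d.+2).
Local Notation M := 'M[K]_(d.+2).
Implicit Types (A B : M) (x y v w : 'rV[K]_(d.+2)).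

Lemma mx_expV (A A' : M) k : A * A' = 1 -> A ^+ k *m A' ^+ k = 1%:M.
Proof.
move=> AA; elim: k => [|k IH]; first by rewrite !expr0 mulmx1.
have -> : A ^+ k.+1 *m A' ^+ k.+1 = A ^+ k * (A * A') * A' ^+ k.
  by rewrite exprSr exprS -!mulmxE !mulmxA.
by rewrite AA mulr1.
Qed.

Lemma mulmx_expK (A A' : M) x k : A * A' = 1 -> x *m A ^+ k *m A' ^+ k = x.
Proof. by move=> AA; rewrite -mulmxA mx_expV // mulmx1. Qed.

Definition orbit_bounded A x := exists C, forall k : nat, N (x *m A ^+ k) <= C.

Lemma mulmx_continuous A : continuous (fun x : V => (x *m A : V)).
Proof.
have Vu := vec_norm_unorm p_pr d.+2.
apply/(un_continuousP Vu Vu) => [x y|e e0]; first exact: mulmxBl.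
have [c c1 hc] := vec_norm_mulmx A; have c0 : 0 < c by exact: lt_le_trans c1.
exists (e / c); first exact: divr_gt0.
by move=> x; rewrite ltr_pdivlMr // mulrC; apply: le_lt_trans; exact: hc.
Qed.

Lemma tidy_mx (A A' : M) : A * A' = 1 -> A' * A = 1 ->
  exists2 e : rat, 0 < e & forall x, N x < e ->
  exists y z, [/\ x = y + z, forall k : nat, N (y *m A ^+ k) <= 1
                & forall k : nat, N (z *m A' ^+ k) <= 1].
Proof.
move=> AA' A'A; pose f x := x *m A; pose g x := x *m A'.
have fK : cancel f g by move=> x; exact: (mulmx_expK x 1 AA').
have gK : cancel g f by move=> x; exact: (mulmx_expK x 1 A'A).
have fc := @mulmx_continuous A; have gc := @mulmx_continuous A'.
pose h : homeo V := Homeo fK gK fc gc.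
have hB : zmod_morphism h by move=> x y; exact: mulmxBl.
have fE k x : iter k f x = x *m A ^+ k.
  elim: k => [|k IH]; first by rewrite expr0 mulmx1.
  by rewrite iterS IH exprSr mulmxA.
have gE k x : iter k g x = x *m A' ^+ k.
  elim: k => [|k IH]; first by rewrite expr0 mulmx1.
  by rewrite iterS IH exprSr mulmxA.
(* [tidy_split] lists the summand with bounded backward orbit first, hence the exchange of the
   two. *)
have [e e0 he] := tidy_split (TopAut hB) (vec_norm_unorm p_pr d.+2).
exists e => // x /he[z [y [-> zP yP]]]; exists y, z; split.
- by rewrite addrC.
- by move=> k; rewrite -fE; exact: (yP k).
- move=> [|k]; first by rewrite expr0 mulmx1; exact: (zP 0).
  by rewrite -gE; exact: (zP (Negz k)).
Qed.

(** This is [tidy_mx] for p^-j x, scaled back: the whole backward orbit of [z] becomes as small as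
    desired, on which the lower bound of [orbit_unbounded_ge] rests. *)
Lemma scaled_tidy (A A' : M) : A * A' = 1 -> A' * A = 1 ->
  exists2 e : rat, 0 < e & forall x (j : nat), N x < e * p%:R ^- j ->
  exists y z, [/\ x = y + z, orbit_bounded A y, orbit_bounded A' z
                & forall k : nat, N (z *m A' ^+ k) <= p%:R ^- j].
Proof.
move=> AA' A'A; have [e e0 he] := tidy_mx AA' A'A; exists e => // x j xj.
pose q : K := p%:R ^+ j.
have Nq : Np q = p%:R ^- j by rewrite padic_normX padic_norm_p exprVn.
have q0 : q != 0 by rewrite expf_neq0 // padic_p_neq0.
have pj0 : 0 < (p%:R : rat) ^- j by rewrite invr_gt0 pexpr_gt0.
have [|y [z [E yP zP]]] := he (q^-1 *: x).
  by rewrite vec_normZ padic_normV Nq mulrC ltr_pdivrMr.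
have zP' k : N (q *: z *m A' ^+ k) <= p%:R ^- j.
  by rewrite -scalemxAl vec_normZ Nq ler_piMr // ltW.
exists (q *: y), (q *: z); split=> //; last by exists (p%:R ^- j).
  by rewrite -scalerDr -E scalerA divff // scale1r.
exists (p%:R ^- j) => k; rewrite -scalemxAl vec_normZ Nq ler_piMr //; exact: ltW.
Qed.

Lemma orbit_boundedL A (a : K) x y :
  orbit_bounded A x -> orbit_bounded A y -> orbit_bounded A (a *: x + y).
Proof.
move=> [C hC] [D hD]; exists (Num.max (Np a * C) D) => k.
rewrite mulmxDl -scalemxAl; apply: le_trans (vec_norm_maxD _ _) _.
rewrite ge_max !le_max vec_normZ; apply/andP; split; apply/orP; [left|right; exact: hD].
by apply: ler_wpM2l; [exact: padic_norm_ge0|exact: hC].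
Qed.

Lemma orbit_bounded0 A : orbit_bounded A 0.
Proof. by exists 0 => k; rewrite mul0mx vec_norm0. Qed.

Lemma orbit_boundedZ A (a : K) x : orbit_bounded A x -> orbit_bounded A (a *: x).
Proof. by move=> h; have := orbit_boundedL a h (orbit_bounded0 A); rewrite addr0. Qed.

Lemma orbit_boundedB A x y :
  orbit_bounded A x -> orbit_bounded A y -> orbit_bounded A (x - y).
Proof. by move=> hx hy; have := orbit_boundedL (-1) hy hx; rewrite scaleN1r addrC. Qed.

Lemma orbit_boundedD A x y :
  orbit_bounded A x -> orbit_bounded A y -> orbit_bounded A (x + y).
Proof. by move=> hx hy; have := orbit_boundedL 1 hx hy; rewrite scale1r. Qed.

(** The orbit of x A'^k is the orbit of x with k points prepended. *)
Lemma orbit_boundedV (A A' : M) x k : A' * A = 1 -> orbit_bounded A x ->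
  orbit_bounded A (x *m A' ^+ k).
Proof.
move=> A'A hx; elim: k => [|k [C hC]]; first by rewrite expr0 mulmx1.
exists (Num.max C (N (x *m A' ^+ k.+1))) => -[|j].
  by rewrite expr0 mulmx1 le_max lexx orbT.
rewrite [A' ^+ _]exprSr [A ^+ _]exprS -!mulmxE !mulmxA.
have := mulmx_expK (x *m A' ^+ k) 1 A'A.
by rewrite !expr1 => ->; rewrite le_max hC.
Qed.

Lemma orbit_split (A A' : M) x : A * A' = 1 -> A' * A = 1 ->
  exists y z, [/\ x = y + z, orbit_bounded A y & orbit_bounded A' z].
Proof.
move=> AA' A'A; have [e e0 he] := scaled_tidy AA' A'A.
have pV1 := prime_inv_itv p_pr.
have x1 : 0 < N x + 1 by rewrite ltr_wpDl // vec_norm_ge0.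
have [M hM] := archi_exp pV1 (divr_gt0 e0 x1).
pose q : K := p%:R ^+ M.
have q0 : q != 0 by rewrite expf_neq0 // padic_p_neq0.
have [|y [z [E yP zP _]]] := he (q *: x) 0%N.
  rewrite expr0 invr1 mulr1 vec_normZ padic_normX padic_norm_p.
  rewrite ltr_pdivlMr // in hM; apply: le_lt_trans hM.
  by rewrite ler_wpM2l ?lerDl // exprn_ge0 // invr_ge0.
exists (q^-1 *: y), (q^-1 *: z); split; last 2 first.
- exact: orbit_boundedZ.
- exact: orbit_boundedZ.
- by rewrite -scalerDr -E scalerA mulVf // scale1r.
Qed.

(* The subspace of vectors with bounded forward orbit is the kernel of a matrix
   [C], so it suffices to bound [y *m C] from below. *)
Lemma orbit_unbounded_ge (A A' : M) y : A * A' = 1 -> A' * A = 1 -> ~ orbit_bounded A y ->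
  exists2 c : rat, 0 < c & forall k : nat, c <= N (y *m A ^+ k).
Proof.
move=> AA' A'A ny; have [S hS] := linear_set_mx (orbit_bounded0 A) (orbit_boundedL (A := A)).
pose C := cokermx S.
have hC x : orbit_bounded A x <-> x *m C = 0.
  by rewrite hS submxE; split=> [/eqP|->].
have c0 : 0 < N (y *m C) by apply: vec_norm_gt0 => /hC.
have [g g1 hg] := vec_norm_mulmx C.
have g0 : 0 < g by exact: lt_le_trans g1.
have pV1 := prime_inv_itv p_pr.
(* With this [j], a vector of norm at most p^-j has an image under [C] shorter than y C. *)
have [j hj] := archi_exp pV1 (divr_gt0 c0 g0).
have [e e0 he] := scaled_tidy AA' A'A.
have pj0 : 0 < (p%:R : rat) ^- j by rewrite invr_gt0 pexpr_gt0.
exists (e * p%:R ^- j); first exact: mulr_gt0.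
(* If y A^k were so small, its summand z2 would have a tiny backward orbit. Carried back by A'^k,
   the other summand is killed by [C], so y C would be the image of a tiny vector. *)
move=> k; rewrite leNgt; apply/negP => /he[z1 [z2 [E z1P z2B z2P]]].
have yE : y = z1 *m A' ^+ k + z2 *m A' ^+ k by rewrite -mulmxDl -E mulmx_expK.
have z10 : z1 *m A' ^+ k *m C = 0 by apply/hC; exact: orbit_boundedV.
have yC : y *m C = z2 *m A' ^+ k *m C by rewrite {1}yE mulmxDl z10 add0r.
have := hg (z2 *m A' ^+ k); rewrite -yC leNgt => /negP; apply.
rewrite exprVn (ltr_pdivlMr _ _ g0) mulrC in hj.
apply: le_lt_trans hj; apply: ler_wpM2l; first exact: ltW.
exact: z2P.
Qed.

(* [A' ^+ k] is the adjugate of [A ^+ k], so its entries are bounded as well. *)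
Lemma unimodular_bounded (A A' : M) : A' * A = 1 -> \det A = 1 -> (forall x, orbit_bounded A x) ->
  exists2 C : rat, 0 < C & forall (k : nat) x,
    N (x *m A ^+ k) <= C * N x /\ N (x *m A' ^+ k) <= C * N x.
Proof.
move=> A'A detA hA.
(* The rows of A^k are the k-th points of the orbits of the standard basis. *)
have /choice[D hD] : forall i : 'I_d.+2, exists C, forall k : nat,
  N (row i (1%:M : M) *m A ^+ k) <= C by move=> i; exact: hA.
pose c := 1 + max_norm D.
have D0 := max_norm_ge0 D.
have c0 : 0 <= c by rewrite /c; lra.
have hc k i j : Np ((A ^+ k) i j) <= c.
  have E : (A ^+ k) i j = (row i (1%:M : M) *m A ^+ k) ord0 j.
    by rewrite -row_mul mul1mx mxE.
  rewrite E; apply: le_trans (le_max_norm (fun j => Np ((row i (1%:M : M) *m A ^+ k) ord0 j)) j) _.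
  by apply: le_trans (hD i k) _; apply: le_trans (le_max_norm D i) _; rewrite lerDr.
have hc' k i j : Np ((A' ^+ k) i j) <= c ^+ d.+1.
  have detAk : \det (A ^+ k) = 1.
    elim: k => [|k IH]; first by rewrite expr0 det1.
    by rewrite exprS det_mulmx detA IH mulr1.
  have -> : A' ^+ k = \adj (A ^+ k).
    rewrite -[RHS]mul1mx -(mx_expV k A'A) -mulmxA mul_mx_adj detAk.
    by rewrite mulmx1.
  exact: padic_norm_adj_le.
have bnd (B : M) (b : rat) x : 0 <= b -> (forall i j, Np (B i j) <= b) -> N (x *m B) <= b * N x.
  move=> b0 hB; have x0 := vec_norm_ge0 x.
  apply: max_norm_le => [|j]; first exact: mulr_ge0.
  rewrite mxE; apply: padic_norm_sum_le => [|i _]; first exact: mulr_ge0.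
  rewrite padic_normM mulrC; apply: ler_pM; rewrite ?padic_norm_ge0 //.
  exact: (le_max_norm (fun i => Np (x ord0 i))).
have cd0 : 0 <= c ^+ d.+1 by exact: exprn_ge0.
exists (1 + c + c ^+ d.+1); first by lra.
move=> k x; split.
  apply: le_trans (bnd _ c x c0 (hc k)) _.
  by rewrite ler_wpM2r ?vec_norm_ge0 //; lra.
apply: le_trans (bnd _ _ x cd0 (hc' k)) _.
by rewrite ler_wpM2r ?vec_norm_ge0 //; lra.
Qed.

(** Replacing [A] by a nonzero multiple scales both sides alike, which permits the normalisation to
    determinant 1. *)
Definition dominated A v w := exists2 C : rat, 0 < C &
  forall k : nat, N (v *m A ^+ k) <= C * N (w *m A ^+ k).

Lemma unimodular_dominated (A A' : M) : A * A' = 1 -> A' * A = 1 ->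
  \det A = 1 -> \det A' = 1 -> exists v w,
  [/\ forall s, v <> s *: w, dominated A v w & dominated A' v w].
Proof.
move=> AA' A'A detA detA'.
have both (C : rat) : 0 < C -> (forall (k : nat) x,
      N (x *m A ^+ k) <= C * N x /\ N (x *m A' ^+ k) <= C * N x) ->
    exists v w, [/\ forall s, v <> s *: w, dominated A v w & dominated A' v w].
  (* When all powers are uniformly bounded, two independent vectors suffice; in dimension [d.+2] the
     first and last basis vectors differ. *)
  move=> C0 h; pose v : 'rV[K]_(d.+2) := delta_mx 0 ord0; pose w : 'rV[K]_(d.+2) := delta_mx 0 ord_max.
  have w0 : 0 < N w.
    apply: vec_norm_gt0 => /(congr1 (fun x : 'rV_(d.+2) => x 0 ord_max)).
    by rewrite !mxE !eqxx => /eqP; rewrite oner_eq0.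
  have v0 : 0 < N v.
    apply: vec_norm_gt0 => /(congr1 (fun x : 'rV_(d.+2) => x 0 ord0)).
    by rewrite !mxE !eqxx => /eqP; rewrite oner_eq0.
  have CC : 0 < C * C * (N v / N w) by rewrite !mulr_gt0 ?invr_gt0.
  (* Combines |v B| <= C |v| with |w| = |w B B'| <= C |w B|. *)
  have key (B B' : M) : B *m B' = 1%:M -> (forall x, N (x *m B) <= C * N x) ->
      (forall x, N (x *m B') <= C * N x) -> N (v *m B) <= C * C * (N v / N w) * N (w *m B).
    move=> BB hB hB'; have := hB' (w *m B); rewrite -mulmxA BB mulmx1 => hw.
    apply: le_trans (hB v) _.
    rewrite [X in _ <= X](_ : _ = C * N v * (C * N (w *m B) / N w)); last by ring.
    by rewrite ler_peMr ?mulr_ge0 ?(ltW C0) ?(ltW v0) // ler_pdivlMr // mul1r.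
  exists v, w; split.
  - move=> s /(congr1 (fun x : 'rV_(d.+2) => x 0 ord0)); rewrite !mxE !eqxx /= mulr0 => /eqP.
    by rewrite oner_eq0.
  - exists (C * C * (N v / N w)) => // k; apply: (key _ (A' ^+ k)) => [|x|x].
    + exact: mx_expV.
    + by have [] := h k x.
    + by have [] := h k x.
  - exists (C * C * (N v / N w)) => // k; apply: (key _ (A ^+ k)) => [|x|x].
    + exact: mx_expV.
    + by have [] := h k x.
    + by have [] := h k x.
have [hA|/existsNP[x0 nx0]] := pselect (forall x, orbit_bounded A x).
  by have [C C0 h] := unimodular_bounded A'A detA hA; exact: both h.
have [hA|/existsNP[x1 nx1]] := pselect (forall x, orbit_bounded A' x).
  have [C C0 h] := unimodular_bounded AA' detA' hA; apply: (both C C0) => k x.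
  by have [h1 h2] := h k x.
(* Removing the summands [u] and [u'] leaves [y], unbounded forward and bounded backward, and [x],
   with the opposite behaviour. *)
have [u [y [E0 uP yP]]] := orbit_split x0 AA' A'A.
have [x [u' [E1 xP uP']]] := orbit_split x1 AA' A'A.
have ny : ~ orbit_bounded A y.
  by move=> h; apply: nx0; rewrite E0; exact: orbit_boundedD.
have nx : ~ orbit_bounded A' x.
  by move=> h; apply: nx1; rewrite E1; exact: orbit_boundedD.
have nw1 : ~ orbit_bounded A (x + y).
  by move=> h; apply: ny; rewrite -[y](addKr x) addrC; exact: orbit_boundedB.
have nw2 : ~ orbit_bounded A' (x + y).
  by move=> h; apply: nx; rewrite -[x](addrK y); exact: orbit_boundedB.
have [c1 c10 h1] := orbit_unbounded_ge AA' A'A nw1.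
have [c2 c20 h2] := orbit_unbounded_ge A'A AA' nw2.
(* The sum w = x + y is unbounded, hence bounded below, in both directions. Forward, x is bounded;
   backward, x = w - y with y bounded. *)
exists x, (x + y); split.
- move=> s xs; have [s0|s0] := eqVneq s 0.
    by apply: nx; rewrite xs s0 scale0r; exact: orbit_bounded0.
  by apply: nw1; rewrite -[x + y](scalerK s0) -xs; exact: orbit_boundedZ.
- have [C hC] := xP; have C0 : 0 <= C by apply: le_trans (hC 0%N); exact: vec_norm_ge0.
  have Cc : 0 <= C / c1 by exact: divr_ge0 C0 (ltW c10).
  exists (C / c1 + 1); first exact: ltr_wpDl Cc ltr01.
  move=> k; apply: le_trans (hC k) _; apply: le_trans (_ : C / c1 * c1 <= _).
    by rewrite (divfK (lt0r_neq0 c10)) lexx.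
  apply: ler_pM; [exact: Cc|exact: ltW|by rewrite lerDl ler01|exact: h1].
- have [C hC] := yP; have C0 : 0 <= C by apply: le_trans (hC 0%N); exact: vec_norm_ge0.
  have Cc : 0 <= C / c2 by exact: divr_ge0 C0 (ltW c20).
  exists (C / c2 + 1); first exact: ltr_wpDl Cc ltr01.
  move=> k; have := vec_norm_maxB ((x + y) *m A' ^+ k) (y *m A' ^+ k).
  rewrite -mulmxBl addrK le_max => /orP[] h; apply: le_trans h _.
    by rewrite ler_peMl ?vec_norm_ge0 ?lerDr.
  apply: le_trans (hC k) _; apply: le_trans (_ : C / c2 * c2 <= _).
    by rewrite (divfK (lt0r_neq0 c20)) lexx.
  apply: ler_pM; [exact: Cc|exact: ltW|by rewrite lerDl ler01|exact: h2].
Qed.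

(** Write k = q m + r with r < m. The scalar a^q occurs on both sides and cancels, and the r
    remaining steps cost at most b1^m for v and b2^m for w. *)
Lemma dominated_root (B B' : M) (a : K) (m : nat) v w : B * B' = 1 -> a != 0 ->
  (0 < m)%N -> dominated (a *: B ^+ m) v w -> dominated B v w.
Proof.
move=> BB a0 m0 [C C0 hC].
have [b1 b11 hb1] := vec_norm_mulmx B; have [b2 b21 hb2] := vec_norm_mulmx B'.
pose b := b1 * b2.
have b10 : 0 <= b1 by apply: le_trans b11.
have b20 : 0 <= b2 by apply: le_trans b21.
have hB1 r x : N (x *m B ^+ r) <= b1 ^+ r * N x.
  elim: r => [|r IH]; first by rewrite !expr0 mulmx1 mul1r.
  rewrite exprSr mulmxA exprS -mulrA; apply: le_trans (hb1 _) _.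
  by rewrite ler_wpM2l.
have hB2 r x : N (x *m B' ^+ r) <= b2 ^+ r * N x.
  elim: r => [|r IH]; first by rewrite !expr0 mulmx1 mul1r.
  rewrite exprSr mulmxA exprS -mulrA; apply: le_trans (hb2 _) _.
  by rewrite ler_wpM2l.
have b1m : 0 < b1 ^+ m by rewrite exprn_gt0 // (lt_le_trans ltr01).
have b2m : 0 < b2 ^+ m by rewrite exprn_gt0 // (lt_le_trans ltr01).
exists (b1 ^+ m * C * b2 ^+ m); first by rewrite !mulr_gt0.
move=> k; rewrite {1}(divn_eq k m) exprD mulmxA.
set q := (k %/ m)%N; set r := (k %% m)%N.
have rm : (r <= m)%N by rewrite ltnW // ltn_mod.
apply: le_trans (hB1 r _) _; rewrite -!mulrA.
apply: ler_pM; rewrite ?exprn_ge0 ?vec_norm_ge0 //; first by rewrite ler_weXn2l.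
have Aq x : N (x *m (a *: B ^+ m) ^+ q) = Np a ^+ q * N (x *m B ^+ (q * m)).
  by rewrite exprZn -exprM mulnC -scalemxAr vec_normZ padic_normX.
have aq0 : 0 < Np a ^+ q by rewrite exprn_gt0 // lt_neqAle padic_norm_ge0 eq_sym padic_norm_eq0 a0.
have := hC q; rewrite !Aq mulrCA ler_pM2l // => h; apply: le_trans h _.
rewrite ler_pM2l //.
have -> : w *m B ^+ (q * m) = w *m B ^+ k *m B' ^+ r.
  by rewrite {1}(divn_eq k m) exprD mulmxA mulmx_expK.
apply: le_trans (hB2 r _) _; rewrite ler_wpM2r ?vec_norm_ge0 //.
by rewrite ler_weXn2l.
Qed.

Lemma exists_dominated (B B' : M) : B * B' = 1 -> B' * B = 1 -> exists v w,
  [/\ forall s, v <> s *: w, dominated B v w & dominated B' v w].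
Proof.
move=> BB' B'B; have detBB' : \det B * \det B' = 1.
  by rewrite -det_mulmx (BB' : B *m B' = 1%:M) det1.
have detX k (C : M) : \det (C ^+ k) = \det C ^+ k.
  by elim: k => [|k IH]; rewrite ?expr0 ?det1 // !exprS det_mulmx IH.
have det0 : \det B != 0.
  by apply/eqP => d0; move/eqP: detBB'; rewrite d0 mul0r eq_sym oner_eq0.
have det0' : \det B' != 0.
  by apply/eqP => d0; move/eqP: detBB'; rewrite d0 mulr0 eq_sym oner_eq0.
have prod1 (C C' : M) : C * C' = 1 -> \det C * \det C' = 1 ->
    (\det C' *: C ^+ d.+2) * (\det C *: C' ^+ d.+2) = 1.
  move=> CC dC; rewrite -scalerAl -scalerAr scalerA mulrC dC scale1r.
  exact: mx_expV.
(* The exponent is the dimension, so the scalar cancels the determinant exactly. *)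
have det_unit (C C' : M) : \det C * \det C' = 1 -> \det (\det C' *: C ^+ d.+2) = 1.
  by move=> dC; rewrite detZ detX -exprMn mulrC dC expr1n.
have detB'B : \det B' * \det B = 1 by rewrite mulrC.
have [v [w [vw h1 h2]]] := unimodular_dominated (prod1 _ _ BB' detBB')
  (prod1 _ _ B'B detB'B) (det_unit _ _ detBB') (det_unit _ _ detB'B).
exists v, w; split; first exact: vw.
- exact: dominated_root BB' det0' (ltn0Sn _) h1.
- exact: dominated_root B'B det0 (ltn0Sn _) h2.
Qed.

End Orbits.
End PadicMatrix.

(** * Higher rank factors *)

(** Iterates of [mulmxr] replace matrix powers, so that the statement applies to a dimension [m i]
    that is not literally [d.+2]. *)
Lemma exists_dominated_iter (p : nat) (p_pr : prime p) (m : nat)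
    (B B' : 'M[padic p_pr]_m) : (1 < m)%N -> B *m B' = 1%:M -> B' *m B = 1%:M ->
  exists v w, [/\ forall s, v <> s *: w,
    exists2 C : rat, 0 < C & forall k : nat,
      vec_norm (iter k (mulmxr B) v) <= C * vec_norm (iter k (mulmxr B) w) &
    exists2 C : rat, 0 < C & forall k : nat,
      vec_norm (iter k (mulmxr B') v) <= C * vec_norm (iter k (mulmxr B') w)].
Proof.
case: m B B' => [|[|d]] // B B' _ BB' B'B.
have iterE (A : 'M[padic p_pr]_d.+2) k v : iter k (mulmxr A) v = v *m A ^+ k.
  elim: k => [|k IH]; first by rewrite expr0 mulmx1.
  by rewrite iterS IH exprSr /= -mulmxA.
have [v [w [vw [C C0 h] [C' C'0 h']]]] := exists_dominated BB' B'B.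
exists v, w; split; first exact: vw.
  by exists C => // k; rewrite !iterE; exact: h.
by exists C' => // k; rewrite !iterE; exact: h'.
Qed.

Section HigherRank.
Variables (R : realType) (n : nat) (p : 'I_n -> nat)
  (p_pr : forall i, prime (p i)) (p_inj : injective p) (m : 'I_n -> nat).
Local Notation V := (fun i : 'I_n => padic_space (p_pr i) (m i)).
Local Notation G := (prod_topology V).
Local Notation Nf := (fun i : 'I_n => (@vec_norm (p i) (p_pr i) (m i) : V i -> rat)).
Local Notation N := (prod_norm Nf).
Local Notation inj_ i t := (@inj_factor _ V i t).

Let Nfp i : padic_normed (p i) (Nf i) := vec_norm_padic_normed (p_pr i) (m i).

Let Nu : unorm N.
Proof. by apply: prod_norm_unorm => i; exact: Nfp. Qed.

Variable i : 'I_n.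
Local Notation K := (padic (p_pr i)).
Local Notation W := 'rV[K]_(m i).

Definition factor_map (f : G -> G) (v : W) : W := f (inj_ i v) i.

Lemma factor_mapB (f : G -> G) : zmod_morphism f -> zmod_morphism (factor_map f).
Proof.
move=> fB v w; rewrite /factor_map.
have -> : inj_ i (v - w) = inj_ i v - inj_ i w by exact: (@inj_factorB _ V i).
by rewrite fB.
Qed.

(** Linearity over Q_p follows from additivity and continuity by [padic_morph_eq]. *)
Lemma factor_mapZ (f : G -> G) : zmod_morphism f -> continuous f ->
  forall (t : K) (v : W), factor_map f (t *: v) = t *: factor_map f v.
Proof.
move=> fB fc t v.
have gB := factor_mapB fB.
have := @padic_morph_eq _ (p_pr i) _ _ (Nfp i) (fun t => factor_map f (t *: v))
  (fun t => t *: factor_map f v).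
apply=> //.
- by move=> a b; rewrite scalerBl gB.
- by move=> a b; rewrite scalerBl.
- move=> e e0; have /(un_continuousP Nu Nu fB)/(_ e e0)[d d0 hd] := fc.
  have v1 : 0 < vec_norm v + 1 by rewrite ltr_wpDl // vec_norm_ge0.
  exists (d / (vec_norm v + 1)); first by rewrite divr_gt0.
  move=> a ha; apply: le_lt_trans (le_prod_norm Nf _ i) _; apply: hd.
  rewrite (prod_norm_inj Nfp) vec_normZ.
  rewrite ltr_pdivlMr // in ha; apply: le_lt_trans ha.
  by rewrite ler_wpM2l ?padic_norm_ge0 // lerDl.
- move=> e e0; set z := factor_map f v.
  have v1 : 0 < vec_norm z + 1 by rewrite ltr_wpDl // vec_norm_ge0.
  exists (e / (vec_norm z + 1)); first by rewrite divr_gt0.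
  move=> a ha; rewrite vec_normZ.
  rewrite ltr_pdivlMr // in ha; apply: le_lt_trans ha.
  by rewrite ler_wpM2l ?padic_norm_ge0 // lerDl.
- by rewrite !scale1r.
Qed.

Definition factor_mx (f : G -> G) : 'M[K]_(m i) :=
  \matrix_(j, l) factor_map f (delta_mx 0 j) 0 l.

Lemma factor_mxE (f : G -> G) : zmod_morphism f -> continuous f ->
  forall v, factor_map f v = v *m factor_mx f.
Proof.
move=> fB fc v; have gB := factor_mapB fB.
rewrite {1}(row_sum_delta v) (big_morph _ (zmod_morphD gB) (zmod_morph0 gB)).
rewrite mulmx_sum_row; apply: eq_bigr => j _; rewrite factor_mapZ //.
by congr (_ *: _); apply/rowP => l; rewrite !mxE.
Qed.

Lemma aut_inj_factor (S : top_aut G) v : S (inj_ i v) = inj_ i (factor_map S v).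
Proof.
apply: eq_inj_factor; apply: (aut_factor p_pr p_inj Nfp) => j ji.
exact: inj_factor_out.
Qed.

Lemma homeo_iter_inj_factor (S : top_aut G) k v :
  homeo_iter S k (inj_ i v) = inj_ i (factor_map (homeo_iter S k) v).
Proof.
apply: eq_inj_factor; apply: (homeo_iter_factor p_pr p_inj Nfp) => j ji.
exact: inj_factor_out.
Qed.

Lemma factor_map_iter (S : top_aut G) (k : nat) v :
  factor_map (homeo_iter S k) v = iter k (factor_map S) v.
Proof.
elim: k => [|k IH]; first by rewrite /factor_map /= inj_factor_id.
rewrite iterS -IH; have -> : k.+1%:Z = k%:Z + 1 by lia.
by rewrite /factor_map homeo_iterS homeo_iter_inj_factor inj_factor_id.
Qed.

Lemma factor_mxK (S S' : top_aut G) : cancel S S' -> factor_mx S *m factor_mx S' = 1%:M.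
Proof.
move=> SK; apply/row_matrixP => j; rewrite row_mul.
have E (S0 : top_aut G) v := factor_mxE (aut_zmod_morphism S0) (@homeo_continuous _ S0) v.
have -> : row j (factor_mx S) = delta_mx 0 j *m factor_mx S by rewrite rowE.
rewrite -!E row1; have := congr1 (fun x : G => x i) (SK (inj_ i (delta_mx 0 j))).
by rewrite aut_inj_factor inj_factor_id => SE; exact: SE.
Qed.

Section Aut.
Variable T : top_aut G.
Local Notation T_ k := (homeo_iter T k).

Lemma exists_dominated_factor : (1 < m i)%N -> exists v w,
  (forall s, v <> s *: w) /\ exists2 C : rat, 0 < C & forall k : int,
    vec_norm (factor_map (T_ k) v) <= C * vec_norm (factor_map (T_ k) w).
Proof.
move=> mi; have BB' := @factor_mxK T (autV T) (homeoK T).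
have B'B := @factor_mxK (autV T) T (homeoVK T).
have [v [w [vw [C C0 h] [C' C'0 h']]]] := exists_dominated_iter mi BB' B'B.
exists v, w; split; first exact: vw.
have E (S : top_aut G) u (k : nat) :
    iter k (mulmxr (factor_mx S)) u = factor_map (homeo_iter S k) u.
  rewrite factor_map_iter; apply: eq_iter => u' /=.
  rewrite factor_mxE //; first exact: aut_zmod_morphism.
  exact: homeo_continuous.
exists (Num.max C C'); first by rewrite lt_max C0.
move=> k; have [k0|k0] := leP 0 k.
  have -> : k = `|k|%N by lia.
  rewrite -!E; apply: le_trans (h _) _.
  by rewrite ler_wpM2r ?vec_norm_ge0 // le_max lexx.
have kE u : factor_map (T_ k) u = factor_map (homeo_iter (autV T) `|k|%N) u.
  by rewrite /factor_map autV_iter (_ : - `|k|%N%:Z = k) //; lia.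
rewrite !kE -!E; apply: le_trans (h' _) _.
by rewrite ler_wpM2r ?vec_norm_ge0 // le_max lexx orbT.
Qed.

Definition factor_line (w : W) : set G :=
  [set x | (forall j, j <> i -> x j = 0) /\ exists s : K, x i = s *: w].

(** Inside the i-th factor the line is the kernel of [cokermx w], a map bounded by [g]. *)
Lemma factor_line_closed w : closed (factor_line w).
Proof.
apply/(un_closedP Nu) => x h; split=> [j ji|].
  apply: contrapT => /(un_gt0 (Nfp j))/h[y [/(_ j ji) yj _]].
  apply/negP; rewrite -leNgt; apply: le_trans (le_prod_norm Nf _ j).
  change (Nf j (x j) <= Nf j (y j - x j)).
  by rewrite yj sub0r (un_opp (Nfp j)).
pose C := cokermx w; have [g g1 hg] := vec_norm_mulmx C.
have g0 : 0 < g by exact: lt_le_trans g1.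
apply/sub_rVP; rewrite submxE; apply/eqP; apply: contrapT => /vec_norm_gt0 xC.
have [y [_ [s ys]] yx] := h _ (divr_gt0 xC g0).
have yx' : vec_norm (y i - x i) < vec_norm ((x i : W) *m C) / g.
  exact: le_lt_trans (le_prod_norm Nf (y - x) i) yx.
have yC : (y i : W) *m C = 0.
  by apply/eqP; rewrite -submxE; apply/sub_rVP; exists s.
have := hg ((y i : W) - (x i : W)); rewrite mulmxBl yC sub0r.
have -> : vec_norm (- ((x i : W) *m C)) = vec_norm ((x i : W) *m C).
  exact: (un_opp (vec_norm_unorm (p_pr i) (m i))).
rewrite leNgt => /negP; apply.
by rewrite mulrC -ltr_pdivlMr.
Qed.

Lemma factor_line_subgroup w : subgroup (factor_line w).
Proof.
split=> [|x y [x1 [s xs]] [y1 [t yt]]].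
  by split=> //; exists 0; rewrite scale0r.
split=> [j ji|]; first by change (x j - y j = 0); rewrite x1 // y1 // subrr.
exists (s - t); change (x i - y i = (s - t) *: w).
by rewrite xs yt scalerBl.
Qed.

Definition factor_line_sub w :=
  ClosedSubgroup (factor_line_closed (w := w)) (factor_line_subgroup w).

Lemma factor_map_line k w x : (T_ k @` factor_line w) x <->
  exists s, x = inj_ i (s *: factor_map (T_ k) w).
Proof.
have TB := homeo_iter_zmod_morphism T k; have Tc := @homeo_iter_continuous _ T k.
split=> [[y [y1 [s ys]] <-]|[s ->]].
  exists s; rewrite -factor_mapZ // -homeo_iter_inj_factor -ys.
  by congr (homeo_iter _ _ _); exact: eq_inj_factor.
exists (inj_ i (s *: w)); last by rewrite homeo_iter_inj_factor factor_mapZ.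
split; first by move=> j ji; exact: (@inj_factor_out n V i (s *: w) j ji).
by exists s; rewrite inj_factor_id.
Qed.

Lemma expansive_sub_rank_one : expansive_homeo R (sub_action T) -> (m i <= 1)%N.
Proof.
move=> /(expansive_sub_actionP R T Nu)[e he]; rewrite leqNgt; apply/negP => mi.
have [v [w [vw [C C0 hC]]]] := exists_dominated_factor mi.
have e0 : 0 < (e.+1%:R : rat) by [].
have pV1 := prime_inv_itv (p_pr i).
(* [D] is chosen so that r = |q| C satisfies 2 r (e+1)^2 < 1. Then r < 1, and a displacement of
   relative size r moves a point of norm at most e+1 by at most 1/(e+1). *)
pose D := 2 * C * e.+1%:R * e.+1%:R; have D0 : 0 < D by rewrite !mulr_gt0.
have b0 : 0 < D^-1 by rewrite invr_gt0.
have [M hM] := archi_exp pV1 b0.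
pose q : K := (p i)%:R ^+ M.
have Nq : padic_norm q = (p i)%:R^-1 ^+ M by rewrite padic_normX padic_norm_p.
have q0 : q != 0 by rewrite expf_neq0 // padic_p_neq0.
pose r := padic_norm q * C.
have r0 : 0 <= r by rewrite mulr_ge0 ?padic_norm_ge0 // ltW.
have hD : 2 * (r * e.+1%:R * e.+1%:R) < 1.
  have -> : 2 * (r * e.+1%:R * e.+1%:R) = padic_norm q * D by rewrite /r /D; ring.
  by rewrite -ltr_pdivlMr // div1r Nq.
have ree : 0 <= r * e.+1%:R * e.+1%:R by exact: mulr_ge0 (mulr_ge0 r0 (ltW e0)) (ltW e0).
have e1 : 1 <= e.+1%:R :> rat by rewrite (ler1n _ e.+1).
have rE : r * e.+1%:R <= e.+1%:R^-1 by rewrite -(ler_pM2r e0) mulVf ?gt_eqF //; lra.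
have r1 : r < 1.
  have : r <= r * e.+1%:R * e.+1%:R by rewrite -mulrA ler_peMr // (le_trans e1) // ler_peMr.
  lra.
pose w' := w + q *: v.
have [|k] := he (factor_line_sub w) (factor_line_sub w').
  move=> /(congr1 (@csub_val G)) /= E.
  have : factor_line w' (inj_ i w).
    rewrite -E; split; first by move=> j ji; exact: (@inj_factor_out n V i w j ji).
    by exists 1; rewrite inj_factor_id scale1r.
  move=> [_ [s]]; rewrite inj_factor_id /w' scalerDr scalerA => ws.
  (* s = 0 would give w = 0, hence v = 0 by domination at time 0, and then v would be a multiple of
     w. *)
  have [s0|s0] := eqVneq s 0.
    have w0 : w = 0 by rewrite ws s0 mul0r !scale0r addr0.
    have := hC 0; rewrite w0.
    have f0 u : factor_map (T_ 0) u = u by rewrite /factor_map /= inj_factor_id.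
    rewrite !f0 vec_norm0 mulr0 leNgt => /negP; apply; apply: vec_norm_gt0 => v0.
    by apply: (vw 0); rewrite v0 scale0r.
  apply: (vw ((s * q)^-1 * (1 - s))).
  have sq0 : s * q != 0 by rewrite mulf_neq0.
  have E' : (s * q) *: v = (1 - s) *: w.
    by rewrite scalerBl scale1r {1}ws addrAC subrr add0r.
  by rewrite -scalerA -E' scalerA mulVf // scale1r.
apply; pose L u := factor_map (T_ k) u.
have TB := homeo_iter_zmod_morphism T k; have Tc := @homeo_iter_continuous _ T k.
have Lw' : L w' = L w + q *: L v.
  by rewrite /L /w' (zmod_morphD (factor_mapB TB)) factor_mapZ.
have vLw : vec_norm (q *: L v) <= r * vec_norm (L w).
  by rewrite vec_normZ /r -mulrA ler_wpM2l ?padic_norm_ge0 //; exact: hC.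
(* As r < 1, the ultrametric inequality prevents the perturbation from shortening the vector. *)
have wLw' : vec_norm (L w) <= vec_norm (L w').
  have := vec_norm_maxB (L w') (q *: L v); rewrite Lw' addrK le_max => /orP[//|h].
  have := le_trans h vLw; have := vec_norm_ge0 (L w); rewrite -Lw'.
  have [->|w0] := eqVneq (vec_norm (L w)) 0; first by rewrite vec_norm_ge0.
  by rewrite le0r (negbTE w0) /= => w1; rewrite leNgt gtr_pMl ?r1.
(* Points of the two lines with the same coefficient [s] are matched; they differ by s q T^k v,
   which has size at most r relative to either. The generator [u] is w or w', so that one estimate
   serves both inclusions. *)
have close s (x y : G) u : x = inj_ i (s *: L u) ->
    y - x = inj_ i (s *: (q *: L v)) \/ y - x = - inj_ i (s *: (q *: L v)) ->
    vec_norm (L w) <= vec_norm (L u) -> N x <= e.+1%:R -> N (y - x) <= e.+1%:R^-1.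
  move=> -> yx wu xe.
  have -> : N (y - inj_ i (s *: L u)) = N (inj_ i (s *: (q *: L v))).
    by case: yx => ->; rewrite ?(un_opp Nu).
  apply: le_trans rE; apply: le_trans (_ : r * N (inj_ i (s *: L u)) <= _).
    rewrite !(prod_norm_inj Nfp) !(vec_normZ s) [leRHS]mulrCA.
    apply: ler_wpM2l; first exact: padic_norm_ge0.
    apply: le_trans vLw _; exact: ler_wpM2l.
  by rewrite ler_wpM2l.
split=> x /factor_map_line[s xE] xe.
  exists (inj_ i (s *: L w')); first by apply/factor_map_line; exists s.
  apply: (close s x _ w) => //; left; rewrite xE -(@inj_factorB _ V i).
  by rewrite -scalerBr Lw' addrC addKr.
exists (inj_ i (s *: L w)); first by apply/factor_map_line; exists s.
apply: (close s x _ w') => //; right; rewrite xE -(@inj_factorB _ V i).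
by rewrite -scalerBr -/(L w') Lw' opprD addNKr scalerN (zmod_morphN (@inj_factorB _ V i)).
Qed.

End Aut.
End HigherRank.

Theorem corollary4p6 (R : realType) (n : nat) (n_gt0 : (0 < n)%N)
    (p : 'I_n -> nat) (p_pr : forall i : 'I_n, prime (p i))
    (p_inj : injective p) :
  (forall (m : 'I_n -> nat) (m_gt0 : forall i : 'I_n, (0 < m i)%N)
      (T : top_aut (prod_topology (fun i : 'I_n => padic_space (p_pr i) (m i)))),
    (expansive_aut T ->
      (forall i : 'I_n, T @` direct_factor i = direct_factor i) /\
      internal_direct_product (contraction_group T) (contraction_group (autV T)))
    /\
    (expansive_homeo R (sub_action T) -> forall i : 'I_n, m i = 1%N))
  /\
  (forall T : top_aut (prod_topology (fun i : 'I_n => padic (p_pr i))),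
    expansive_aut T <-> expansive_homeo R (sub_action T)).
Proof.
split=> [m m_gt0 T|T]; last exact: rank_one_expansive.
have Nfp i := vec_norm_padic_normed (p_pr i) (m i).
split=> [Texp|Tsub i].
  split=> [i|]; first exact: (aut_direct_factor p_pr p_inj Nfp T).
  exact: (padic_product_contraction p_pr p_inj Nfp Texp).
apply/eqP; rewrite eqn_leq m_gt0 andbT.
exact: (expansive_sub_rank_one p_inj i Tsub).
Qed.
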